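(* Let $X$ be a stationary piecewise deterministic Markov process with time reversal $X^\star_t=X_{(T-t)-}$, satisfying all assumptions of the context. Suppose that there is a $\sigma$-finite measure $\mu$ on $\mathbb E$ such that $\mu_x\ll\mu$ for every $x\in\mathbb E^\star$. Then $\pi_Q\ll\mu$ and $$\frac{d\pi_Q}{d\mu}(y)\,\mu^\star_y(dx)=\frac{d\mu_x}{d\mu}(y)\,\pi_W(dx)$$ (as measures in $x\in\mathbb E^\star$, for $\mu$-almost every $y$). The jump intensity of the reversed process fulfils $$\lambda^\star(y)\,\nu(dy)=\|\xi\|\,\frac{d\pi_Q}{d\mu}(y)\;\mu|_{\mathbb E^\star}(dy),$$ and for the boundary measure of the reversed process we have $\sigma^\star\ll\mu|_{\Gamma^\star}$ and $$\sigma^\star(dy)=\|\xi\|\,\frac{d\pi_Q}{d\mu}(y)\;\mu|_{\Gamma^\star}(dy).$$ Here $\mu|_A(B)=\mu(A\cap B)$.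
   Context: **PDMP.** Let $K=\{1,\dots,k\}$. For $i\in K$ let $\mathbb E_i^\circ\subseteq\mathbb R^{d_i}$ be open with boundary $\partial\mathbb E_i$, and let $r_i:\mathbb E_i^\circ\to\mathbb R^{d_i}$ be locally Lipschitz. The flow $\varphi_i(x,t)$ is the unique (non-exploding) solution of $\partial_t\varphi_i(x,t)=r_i(\varphi_i(x,t))$, $\varphi_i(x,0)=x$, followed (in both time directions) until it leaves $\mathbb E_i^\circ$ and extended by continuity to the boundary points where it leaves or enters. The active boundary is $\Gamma_i=\{z\in\partial\mathbb E_i: z=\varphi_i(x,t)\text{ for some }x\in\mathbb E_i^\circ,t>0\}$, the passive boundary is $\Gamma_i^\star=\{z\in\partial\mathbb E_i: z=\varphi_i(x,-t)\text{ for some }x\in\mathbb E_i^\circ,t>0\}$; $\mathbb E_i=\mathbb E_i^\circ\cup\Gamma_i^\star$, $\mathbb E_i^\star=\mathbb E_i^\circ\cup\Gamma_i$. The symbols $\mathbb E^\circ,\mathbb E,\mathbb E^\star,\Gamma,\Gamma^\star$ denote the disjoint unions over $i\in K$; the index $i$ is suppressed. Let $\tau(x)=\inf\{t\ge0:\varphi(x,t)\in\Gamma\}$ ($\inf\emptyset=\infty$). Given a measurable jump intensity $\lambda:\mathbb E\to[0,\infty)$ and jump measures $\mu_x$ (probability measures on $\mathbb E$, $x\in\mathbb E\cup\Gamma$), the PDMP $X$ with state space $\mathbb E$ started at $x$ follows $X_t=\varphi(x,t)$ for $t<T_1$, where $P_x(T_1>t)=1_{\{t<\tau(x)\}}\exp(-\int_0^t\lambda(\varphi(x,u))\,du)$;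 at $T_1$ it jumps to a point with distribution $\mu_{\varphi(x,T_1)}$ and restarts from there. $T_1<T_2<\dots$ are the jump times, $N_t$ is the number of jumps in $[0,t]$, and $N_t^+(B)$, $B\subseteq\Gamma$ Borel, is the number of jumps in $[0,t]$ at which $X_{T_n-}\in B$ (forced jumps). **Notation.** $\tau(x,B)=t$ if the flow from $x$ reaches $B$ (first) at time $t\ge0$, $=\infty$ if it never does; $\partial_hB=\{x\in\mathbb E:\tau(x,B)<h\}$. **Standing assumptions.** (A1) For each $x\in\mathbb E$ there is $\varepsilon(x)>0$ with $\int_0^{\varepsilon(x)}\lambda(\varphi(x,s))ds<\infty$. (A2) $\int_0^\infty\lambda(\varphi(x,s))ds=\infty$ whenever $\tau(x)=\infty$. (A3) $E_x(N_t)<\infty$ for all $x\in\mathbb E,t>0$. (A4) $\mu_x(\{x\})=0$ for all $x\in\mathbb E$. (B1) There is a stationary distribution $\nu$ of $X$ on $\mathbb E$ (fixed throughout). (B2) $\int_{\mathbb E}\lambda\,d\nu<\infty$. (B3) $\lambda$ is continuous. (B4) For Borel $A\subseteq\mathbb E$ and $x\in\mathbb E$, $\mu_{\varphi(x,h)}(A)\to\mu_x(A)$ as $h\to0$. (B5) $\mu_x(\partial_h\Gamma)\to0$ as $h\to0$ uniformly in $x\in\Gamma$. **Boundary measure and embedded stationary laws.** $\sigma$ is the finite measure on $\Gamma$ with $\sigma(B)=E_\nu(N_t^+(B))/t$ for every $t>0$. The number $\|\xi\|=\int_{\mathbb E}\lambda\,d\nu+\sigma(\Gamma)$ is finite and strictly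 positive. For Borel $A\subseteq\mathbb E^\star$, $B\subseteq\mathbb E$ put $\pi_W(A)=\frac1{\|\xi\|}\big(\int_{A\cap\mathbb E}\lambda\,d\nu+\sigma(A\cap\Gamma)\big)$ and $\pi_Q(B)=\frac1{\|\xi\|}\big(\int_{\mathbb E}\lambda(x)\mu_x(B)\nu(dx)+\int_\Gamma\mu_x(B)\sigma(dx)\big)$ (stationary laws of $W_k=X_{T_k-}$ and $Q_k=X_{T_k}$). **Reversal.** $X$ is started with distribution $\nu$; for fixed $T>0$, $X_t^\star=X_{(T-t)-}$, $t\in[0,T]$. It is a time-homogeneous Markov process with state space $\mathbb E^\star$ and stationary distribution $\nu$, following the flow $\varphi^\star(x,t)=\varphi(x,-t)$ between jumps. Assume (D1): the restriction of $\pi_Q$ to $\mathbb E^\circ$ is absolutely continuous with respect to $\nu$ with density $\beta$; (D2): for every $x\in\mathbb E^\star$ there is $\varepsilon(x)>0$ with $\int_0^{\varepsilon(x)}\beta(\varphi(x,-s))ds<\infty$. Under these assumptions $X^\star$ is a PDMP with active boundary $\Gamma^\star$; $\lambda^\star$ denotes its jump intensity, $\mu_y^\star$ its jump measure (a probability measure on $\mathbb E^\star$), and $\sigma^\star(B)$, $B\subseteq\Gamma^\star$ Borel, its boundary measure, i.e. the expected number per unit time of forced jumps of the stationary process $X^\star$ from $B$. *)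

(* Defs.v *)
From HB Require Import structures.
From mathcomp Require Import all_boot all_order all_algebra.
From mathcomp Require Import all_classical all_reals all_analysis.
From mathcomp Require Import measurable_realfun.
Import numFieldNormedType.Exports.

Set Implicit Arguments.
Unset Strict Implicit.
Unset Printing Implicit Defensive.

Import Order.TTheory GRing.Theory Num.Theory.

Local Open Scope classical_set_scope.
Local Open Scope ring_scope.

(* The disjoint union of the spaces R^(dim i), i in K, with the disjoint union
   topology and its Borel sigma-algebra. All processes and measures live on
   this ambient space; E, Gamma, ... are subsets of it. *)
Definition state (R : realType) (k : nat) (dim : 'I_k.+1 -> nat) : Type :=
  {i : 'I_k.+1 & 'rV[R]_(dim i)}.

Section StateSpace.
Variables (R : realType) (k : nat) (dim : 'I_k.+1 -> nat).
Local Notation S := (state R dim).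

HB.instance Definition _ := Topological.copy S {i : 'I_k.+1 & 'rV[R]_(dim i)}.
HB.instance Definition _ :=
  isPointed.Build S (existT (fun i => 'rV[R]_(dim i)) ord0 0).
HB.instance Definition _ := @isMeasurable.Build (sigma_display (@open S)) S
  <<s @open S >> (@sigma_algebra0 _ setT _) (@sigma_algebraC S _)
  (@sigma_algebra_bigcup _ setT _).

End StateSpace.

Section Flow.
Variables (R : realType) (k : nat) (dim : 'I_k.+1 -> nat).
Local Notation S := (state R dim).
Variable Eo : forall i, set 'rV[R]_(dim i).
Variable r : forall i, 'rV[R]_(dim i) -> 'rV[R]_(dim i).

(* For t >= 0: some solution of g' = r(g) runs from x to z in time t and stays
   in the open set at all intermediate times. The end points may lie on the
   boundary: they are attained by continuity only. *)
Definition reaches i (x : 'rV[R]_(dim i)) (t : R) (z : 'rV[R]_(dim i)) : Prop :=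
  exists g : R -> 'rV[R]_(dim i),
    [/\ g 0 = x, g t = z, {within `[0, t], continuous g} &
        forall s, 0 < s -> s < t -> Eo (g s) /\ is_derive s 1 g (r (g s))].

Definition flow_graph i (x : 'rV[R]_(dim i)) (t : R) : set 'rV[R]_(dim i) :=
  [set z | if 0 <= t then reaches x t z else reaches z (- t) x].

(* The times at which the trajectory through x has not yet left. *)
Definition flow_defined (x : S) : set R :=
  [set t | exists z, flow_graph (projT2 x) t z].

(* The flow phi(x,t); by convention phi(x,t) = x outside [flow_defined x]. *)
Definition flow (x : S) (t : R) : S :=
  existT _ (projT1 x) (xget (projT2 x) (flow_graph (projT2 x) t)).

Definition interior_states : set S := [set x | Eo (projT2 x)].

Definition boundary_states : set S :=
  [set x | (closure (@Eo (projT1 x)) `\` @Eo (projT1 x)) (projT2 x)].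

Definition active_boundary : set S :=
  boundary_states `&` [set z | exists x t,
    [/\ interior_states x, 0 < t & z = flow x t]].

Definition passive_boundary : set S :=
  boundary_states `&` [set z | exists x t,
    [/\ interior_states x, 0 < t & z = flow x (- t)]].

Definition states : set S := interior_states `|` passive_boundary.

Definition reversed_states : set S := interior_states `|` active_boundary.

(* [fs_unique_fwd] and [fs_unique_bwd] follow from the Lipschitz condition at
   interior points; at entrance and exit points they say that phi(x,t) is well
   defined there. [fs_forward] and [fs_backward] are non-explosion. Measurability
   of the flow includes that of the two boundaries, which are countable unions
   of sections of its domain. *)
Record flow_setting : Prop := {
  fs_open : forall i, open (@Eo i);
  fs_lipschitz : forall i, [locally [lipschitz (@r i) x | x in @Eo i]];
  fs_unique_fwd : forall i (x z z' : 'rV[R]_(dim i)) t, 0 <= t ->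
    reaches x t z -> reaches x t z' -> z = z';
  fs_unique_bwd : forall i (x x' z : 'rV[R]_(dim i)) t, 0 <= t ->
    reaches x t z -> reaches x' t z -> x = x';
  fs_forward : forall x, states x ->
    (forall t, 0 <= t -> flow_defined x t) \/
    (exists2 t, 0 <= t & active_boundary (flow x t));
  fs_backward : forall x, reversed_states x ->
    (forall t, 0 <= t -> flow_defined x (- t)) \/
    (exists2 t, 0 <= t & passive_boundary (flow x (- t)));
  fs_measurable_dom :
    measurable [set z : S * R | flow_defined z.1 z.2];
  fs_measurable_flow :
    measurable_fun [set z : S * R | flow_defined z.1 z.2]
      (fun z => flow z.1 z.2) }.

End Flow.

Section Pdmp.
Variables (R : realType) (k : nat) (dim : 'I_k.+1 -> nat).
Local Notation S := (state R dim).
Local Open Scope ereal_scope.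

Record pdmp_data := PdmpData {
  pd_flow : S -> R -> S;
  pd_space : set S;
  pd_boundary : set S;
  pd_rate : S -> R;
  pd_jump : R.-pker S ~> S }.

Definition hitting_time (phi : S -> R -> S) (B : set S) (x : S) : \bar R :=
  ereal_inf [set t%:E | t in [set t : R | (0 <= t)%R /\ B (phi x t)]].

Definition exit_time (c : pdmp_data) : S -> \bar R :=
  hitting_time (pd_flow c) (pd_boundary c).

Definition cumulative_rate (phi : S -> R -> S) (f : S -> R) (x : S)
    (D : set R) : \bar R :=
  \int[lebesgue_measure]_(s in D) (f (phi x s))%:E.

(* P_x(T_1 > t) *)
Definition survival (c : pdmp_data) (x : S) (t : R) : \bar R :=
  if t%:E < exit_time c x then
    expeR (- cumulative_rate (pd_flow c) (pd_rate c) x `[0%R, t])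
  else 0.

Record pdmp_data_wf (c : pdmp_data) : Prop := {
  wf_measurable_rate : measurable_fun (pd_space c) (pd_rate c);
  wf_rate_ge0 : forall x, pd_space c x -> (0 <= pd_rate c x)%R;
  wf_jump : forall x, (pd_space c `|` pd_boundary c) x ->
    pd_jump c x (pd_space c) = 1 }.

Definition no_self_jump (c : pdmp_data) : Prop :=
  forall x, pd_space c x -> pd_jump c x [set x] = 0.

Section Process.
Context {d : measure_display} {Omega : measurableType d}.
Variable P : probability Omega R.

(* Cylinder events of the history (T_0, Q_0, ..., T_n, Q_n). *)
Definition history (T : nat -> Omega -> \bar R) (Q : nat -> Omega -> S)
    (A : nat -> set S) (B : nat -> set (\bar R)) (n : nat) : set Omega :=
  [set w | forall j, (j <= n)%N -> A j (Q j w) /\ B j (T j w)].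

(* Jump times T_1, T_2, ... and post-jump states Q_1, Q_2, ... of a PDMP observed
   on [0, H), with T_0 = 0 and Q_0 the initial state; T_n = +oo when there is no
   n-th jump before H. Given the history up to T_n < H, the waiting time has the
   prescribed survival function, and given also T_{n+1} < H the new state has law
   pd_jump at the point where the flow has arrived. *)
Record pdmp_skeleton (c : pdmp_data) (H : \bar R)
    (T : nat -> Omega -> \bar R) (Q : nat -> Omega -> S) : Prop := {
  sk_measurable_time : forall n, measurable_fun setT (T n);
  sk_measurable_state : forall n, measurable_fun setT (Q n);
  sk_start : {ae P, forall w, T 0%N w = 0 /\ pd_space c (Q 0%N w)};
  sk_order : {ae P, forall w, forall n,
    T n w <= T n.+1 w /\ (T n w < H \/ T n w = +oo)};
  sk_waiting : forall n A B (t : R),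
    (forall j, measurable (A j)) -> (forall j, measurable (B j)) ->
    (0 <= t)%R ->
    P (history T Q A B n `&`
       [set w | T n w + t%:E < H /\ T n w + t%:E < T n.+1 w]) =
    \int[P]_(w in history T Q A B n `&` [set w | T n w + t%:E < H])
       survival c (Q n w) t;
  sk_jump : forall n A B C D,
    (forall j, measurable (A j)) -> (forall j, measurable (B j)) ->
    measurable C -> measurable D ->
    P (history T Q A B n `&`
       [set w | [/\ T n.+1 w < H, C (T n.+1 w) & D (Q n.+1 w)]]) =
    \int[P]_(w in history T Q A B n `&`
                  [set w | T n.+1 w < H /\ C (T n.+1 w)])
       pd_jump c (pd_flow c (Q n w) (fine (T n.+1 w - T n w))) D }.

(* X = (X_t), 0 <= t < H, is a PDMP with the given skeleton. *)
Record is_pdmp (c : pdmp_data) (H : \bar R) (X : R -> Omega -> S)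
    (T : nat -> Omega -> \bar R) (Q : nat -> Omega -> S) : Prop := {
  ip_skeleton : pdmp_skeleton c H T Q;
  ip_measurable : forall t, (0 <= t)%R -> t%:E < H -> measurable_fun setT (X t);
  ip_strict : {ae P, forall w, forall n,
    T n.+1 w < H -> T n.+1 w < T n.+2 w};
  ip_no_accumulation : {ae P, forall w, forall t : R, t%:E < H ->
    exists n, t%:E < T n w};
  ip_path : {ae P, forall w, forall n (t : R), t%:E < H ->
    T n w <= t%:E -> t%:E < T n.+1 w ->
    X t w = pd_flow c (Q n w) (t - fine (T n w))} }.

Definition count_events (A : nat -> set Omega) (w : Omega) : \bar R :=
  \sum_(0 <= n <oo) (\1_(A n) w)%:E.

(* N_t *)
Definition jump_count (T : nat -> Omega -> \bar R) (t : R) : Omega -> \bar R :=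
  count_events (fun n => [set w | T n.+1 w <= t%:E]).

Definition left_limit (X : R -> Omega -> S) (t : R) (w : Omega) : S :=
  lim (X u w @[u --> t^'-]).

(* N_t^+(B) for subsets B of the active boundary. *)
Definition forced_jump_count (X : R -> Omega -> S) (T : nat -> Omega -> \bar R)
    (t : R) (B : set S) : Omega -> \bar R :=
  count_events (fun n => [set w | T n.+1 w <= t%:E /\
                                  B (left_limit X (fine (T n.+1 w)) w)]).

(* The boundary measure, as a measure on the ambient space carried by the active
   boundary. *)
Definition is_boundary_measure (c : pdmp_data) (H : \bar R)
    (X : R -> Omega -> S) (T : nat -> Omega -> \bar R)
    (sigma : set S -> \bar R) : Prop :=
  forall t : R, (0 < t)%R -> t%:E <= H -> forall B, measurable B ->
  sigma B =
    (t^-1)%:E * \int[P]_w forced_jump_count X T t (B `&` pd_boundary c) w.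

Definition stationary_law (X : R -> Omega -> S) (nu : set S -> \bar R) : Prop :=
  forall t : R, (0 <= t)%R -> forall B, measurable B -> P (X t @^-1` B) = nu B.

(* X*_t = X_{(T-t)-}; t = T is left out because X_{0-} does not exist. *)
Definition is_time_reversal (T : R) (X Xs : R -> Omega -> S) : Prop :=
  {ae P, forall w, forall t : R, (0 <= t)%R -> (t < T)%R ->
    X u w @[u --> (T - t)%R^'-] --> Xs t w}.

End Process.

(* E_x(N_t) < oo for all x in E and t > 0; E_x(N_t) is the same for every
   skeleton started at x, whatever the probability space. *)
Definition finite_expected_jumps (c : pdmp_data) : Prop :=
  forall x, pd_space c x ->
  forall (d : measure_display) (Omega : measurableType d)
    (P : probability Omega R) (T : nat -> Omega -> \bar R)
    (Q : nat -> Omega -> S),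
  pdmp_skeleton P c +oo T Q -> {ae P, forall w, Q 0%N w = x} ->
  forall t : R, (0 < t)%R -> \int[P]_w jump_count T t w < +oo.

Section Laws.
Variables (c : pdmp_data) (nu sigma : set S -> \bar R).

(* ||xi|| *)
Definition total_rate : \bar R :=
  \int[nu]_(x in pd_space c) (pd_rate c x)%:E + sigma (pd_boundary c).

(* The stationary law of X_{T_k-}. *)
Definition pi_W (A : set S) : \bar R :=
  ((fine total_rate)^-1)%:E *
  (\int[nu]_(x in A `&` pd_space c) (pd_rate c x)%:E +
   sigma (A `&` pd_boundary c)).

(* The stationary law of X_{T_k}. *)
Definition pi_Q (B : set S) : \bar R :=
  ((fine total_rate)^-1)%:E *
  (\int[nu]_(x in pd_space c) ((pd_rate c x)%:E * pd_jump c x B) +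
   \int[sigma]_(x in pd_boundary c) pd_jump c x B).

End Laws.

(* q is a version of d rho / d mu. *)
Definition is_density (rho mu : set S -> \bar R) (q : S -> \bar R) : Prop :=
  [/\ measurable_fun setT q, forall y, 0 <= q y &
      forall B, measurable B -> rho B = \int[mu]_(y in B) q y].

(* p is a version of (x, y) |-> (d K_x / d mu)(y), x in D. Joint measurability is
   needed to integrate p(x, y) over x for fixed y. *)
Definition is_kernel_density (K : R.-pker S ~> S) (D : set S)
    (mu : set S -> \bar R) (p : S -> S -> \bar R) : Prop :=
  measurable_fun (D `*` [set: S]) (fun z : S * S => p z.1 z.2) /\
  forall x, D x -> is_density (K x) mu (p x).

End Pdmp.

(* Main.v *)
Require Import Defs.
From HB Require Import structures.
From mathcomp Require Import all_boot all_order all_algebra.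
From mathcomp Require Import all_classical all_reals all_analysis.
From mathcomp Require Import measurable_realfun.
From mathcomp Require Import ring lra.
Import numFieldNormedType.Exports.

Set Implicit Arguments.
Unset Strict Implicit.
Unset Printing Implicit Defensive.

Import Order.TTheory GRing.Theory Num.Theory.

Local Open Scope classical_set_scope.
Local Open Scope ring_scope.
Local Open Scope ereal_scope.

(** The jumps of a stationary path during (0, tT) are the jumps of the reversed path,
    with the states before and after each jump exchanged. Counting the jumps that
    lead from A into B in both directions therefore gives, on average,
    [\int[W]_(x in A) K x B = \int[Ws]_(y in B) Ks y A], where [K] and [Ks] are the
    two jump kernels and [W], [Ws] the expected numbers of forward and backward jumps
    out of a set. All claims follow once [W] and [Ws] are known.

    For a stationary process the expected number of jumps in (0, h) out of [A] is
    [h * (\int[nu]_(x in A) rate x + sigma (A :&: bd))]: the forced jumps are counted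
    by the boundary measure ([boundary_measure_prejumps]) and the others come with the
    intensity along the path ([compensator_formula]); see [prejump_law_formula].
    Forward in time this says that [W] is [tT * xi * piW], and the left-hand side with
    A the whole space is [tT * xi * piQ B]. The right-hand side with A the whole space
    is [Ws B], so that
    [\int[nu]_(y in B) lambdas y + sigmas (B :&: Gammas) = xi * piQ B].
    As nu only charges interior states, and as no jump leads into the active boundary,
    restricting B to the interior or to the passive boundary gives the formulas for
    the reversed intensity and the reversed boundary measure. The remaining identity
    is the general one written with densities with respect to mu: Tonelli turns it into
    an equality of integrals in y over every B, hence into an equality for almost every
    y, first for the sets A of a countable algebra that determines measures and then
    for all A ([exchange_densities]).

    Several points need care. The intensity formula rests on the waiting time having
    a density, which fails at states where the intensity is not integrable along the
    orbit. Forward in time continuity of the intensity excludes such jumps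
    ([continuous_rate_regular]). Backward in time the bad states are null for nu, since
    between jumps the path survives them; by absolute continuity the post-jump law
    does not charge them either, and so no reversed jump starts there. The count of
    forced jumps may include one at time 0, where the left limit is not determined by
    the process; it is harmless because the count is linear in time. Finally, the
    densities of the kernel have to be chosen measurably in both variables: for each
    rational threshold the set where the density exceeds it is approximated by
    near-maximizers, within a countable algebra, of a difference of two measures
    ([jointly_measurable_density]). *)

(** * Weighted laws and uniqueness of measures *)

Lemma prob_kernel_setC d1 d2 (T1 : measurableType d1) (T2 : measurableType d2)
    (R : realType) (K : R.-pker T1 ~> T2) x (A : set T2) :
  measurable A -> K x A = 1 -> K x (~` A) = 0.
Proof.
move=> mA KA; have : K x setT = 1 by exact: prob_kernel.
rewrite -(setUv A) measureU//; [|exact: measurableC|exact: setICr].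
rewrite [X in X + _]KA; have h (y : \bar R) : 1 + y = 1 -> y = 0.
  by case: y => [u| |]//= [u0]; congr (_%:E); lra.
exact: h.
Qed.

Lemma ge0_integral_ae0 d (T : measurableType d) (R : realType)
    (m : {measure set T -> \bar R}) (D : set T) (f : T -> \bar R) :
  measurable D -> measurable_fun D f -> (forall x, D x -> 0 <= f x) ->
  {ae m, forall x, D x -> f x = 0} -> \int[m]_(x in D) f x = 0.
Proof.
move=> mD mf f0 h; have [_ <-//] := ae_eq_integral_abs m mD mf.
by apply: eq_integral => x /set_mem Dx; rewrite gee0_abs// f0.
Qed.

Section weighted_law.
Context d1 d2 (T1 : measurableType d1) (T2 : measurableType d2) (R : realType).
Variables (m : {measure set T1 -> \bar R}) (f : T1 -> R) (Y : T1 -> T2).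
Hypotheses (mf : measurable_fun setT f) (f0 : forall x, (0 <= f x)%R)
  (mY : measurable_fun setT Y).

Definition weighted_law of measurable_fun setT f & (forall x, (0 <= f x)%R) &
  measurable_fun setT Y := fun A : set T2 => \int[m]_(x in Y @^-1` A) (f x)%:E.

Local Notation wl := (weighted_law mf f0 mY).

Let mpre A : measurable A -> measurable (Y @^-1` A).
Proof. by move=> mA; rewrite -[X in measurable X]setTI; exact: mY. Qed.

Let mEf : measurable_fun setT (EFin \o f).
Proof. exact/measurable_EFinP. Qed.

Let wl0 : wl set0 = 0.
Proof. by rewrite /weighted_law preimage_set0 integral_set0. Qed.

Let wl_ge0 A : 0 <= wl A.
Proof. by apply: integral_ge0 => x _; rewrite lee_fin. Qed.

Let wl_sigma : semi_sigma_additive wl.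
Proof.
move=> F mF tF mUF; rewrite /weighted_law preimage_bigcup.
rewrite ge0_integral_bigcup//.
- by apply: is_cvg_nneseries => n _ _; apply: integral_ge0 => x _; rewrite lee_fin.
- by move=> k; exact: mpre.
- exact: measurable_funTS.
- by move=> x _; rewrite lee_fin.
- apply/trivIsetP => i j _ _ ij; rewrite -preimage_setI.
  by move/trivIsetP : tF => -> //; rewrite preimage_set0.
Qed.

HB.instance Definition _ := isMeasure.Build d2 T2 R wl wl0 wl_ge0 wl_sigma.

Import HBNNSimple.

Let integral_weighted_law_nnsfun (g : {nnsfun T2 >-> R}) :
  \int[wl]_y (g y)%:E = \int[m]_x ((g (Y x))%:E * (f x)%:E).
Proof.
under [LHS]eq_integral do rewrite fimfunE -fsumEFin//.
rewrite ge0_integral_fsum//; last 2 first.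
- by move=> r; exact/measurable_EFinP/measurable_funM.
- by move=> r x _; rewrite nnfun_muleindic_ge0.
have g0 x r : 0 <= (r * \1_(g @^-1` [set r]) (Y x))%:E :> \bar R.
  exact: nnfun_muleindic_ge0.
have mg r : measurable_fun setT (fun x => (r * \1_(g @^-1` [set r]) (Y x))%:E : \bar R).
  apply/measurable_EFinP; apply: measurable_funM => //.
  exact: (measurableT_comp (measurable_indic (measurable_funPTI g _ )) mY).
transitivity (\int[m]_x (\sum_(r \in range g)
    ((r * \1_(g @^-1` [set r]) (Y x))%:E * (f x)%:E))); last first.
  apply: eq_integral => x _.
  by rewrite -ge0_mule_fsuml// fsumEFin// -fimfunE.
rewrite ge0_integral_fsum//; last 2 first.
- by move=> r; apply: emeasurable_funM.
- by move=> r x _; rewrite mule_ge0// lee_fin.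
apply: eq_fsbigr => r _; rewrite integralZl_indic_nnsfun// integral_indic// setIT.
under [RHS]eq_integral => x _ do rewrite EFinM -muleA.
have [r0|r0] := ltP r 0%R.
  rewrite preimage_nnfun0// measure0 mule0; apply/esym.
  by rewrite integral0_eq// => x _; rewrite indicE in_set0 mul0e mule0.
rewrite ge0_integralZl//; last 2 first.
- apply: emeasurable_funM => //; apply/measurable_EFinP.
  exact: (measurableT_comp (measurable_indic (measurable_funPTI g _ )) mY).
- by move=> x _; rewrite mule_ge0// lee_fin.
congr (_ * _); rewrite [LHS]integral_mkcond; apply: eq_integral => x _.
rewrite patchE indicE; case: ifPn => xA; last first.
  by rewrite (_ : _ \in _ = false) ?mul0e//; apply/negbTE.
by rewrite (_ : _ \in _ = true) ?mul1e.
Qed.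

(** Integrating against the law of [Y] with weight [f]: the change of variables
    formula and the rule for densities at once. *)
Lemma integral_weighted_law (g : T2 -> \bar R) : measurable_fun setT g ->
  (forall y, 0 <= g y) ->
  \int[wl]_y g y = \int[m]_x (g (Y x) * (f x)%:E).
Proof.
move=> mg g0; pose g_ := nnsfun_approx measurableT mg.
transitivity (limn (fun n => \int[wl]_x (g_ n x)%:E)).
  rewrite -monotone_convergence//.
  - apply: eq_integral => y _; apply/esym/cvg_lim => //.
    by apply: cvg_nnsfun_approx.
  - by move=> n; exact/measurable_EFinP/measurable_funP.
  - by move=> n y _; rewrite lee_fin.
  - by move=> y _ a b ab; rewrite lee_fin; exact/lefP/nd_nnsfun_approx.
under eq_fun do rewrite integral_weighted_law_nnsfun.
rewrite -monotone_convergence//.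
- apply: eq_integral => x _; apply/cvg_lim => //; apply: cvgeZr => //.
  by apply: cvg_nnsfun_approx.
- move=> n; apply: emeasurable_funM => //; apply/measurable_EFinP.
  exact: (measurableT_comp (measurable_funP (g_ n)) mY).
- by move=> n x _; rewrite mule_ge0// lee_fin.
- move=> x _ a b ab; rewrite lee_wpmul2r ?lee_fin//.
  exact/lefP/nd_nnsfun_approx.
Qed.

End weighted_law.

(** Rectangles are stable under intersection and generate the product
    sigma-algebra. *)
Lemma measure_prod_unique d1 d2 (T1 : measurableType d1)
    (T2 : measurableType d2) (R : realType)
    (m1 m2 : {measure set (T1 * T2) -> \bar R}) :
  (forall A B, measurable A -> measurable B -> m1 (A `*` B) = m2 (A `*` B)) ->
  m1 setT < +oo -> forall X, measurable X -> m1 X = m2 X.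
Proof.
move=> m12 m1oo X mX.
pose G : set (set (T1 * T2)) :=
  [set A `*` B | A in measurable & B in measurable].
apply: (measure_unique G (fun=> setT)) => //.
- by rewrite measurable_prod_measurableType.
- move=> _ _ [A1 mA1 [A2 mA2 <-]] [B1 mB1 [B2 mB2 <-]].
  exists (A1 `&` B1); first exact: measurableI.
  by exists (A2 `&` B2); [exact: measurableI|rewrite setXI].
- by move=> _; exists setT => //; exists setT => //; rewrite setXTT.
- by rewrite bigcup_const.
- by move=> _ [A mA [B mB <-]]; exact: m12.
Qed.

Lemma measure_prod3_unique d1 d2 d3 (T1 : measurableType d1)
    (T2 : measurableType d2) (T3 : measurableType d3) (R : realType)
    (m1 m2 : {measure set ((T1 * T2) * T3) -> \bar R}) :
  (forall A B C, measurable A -> measurable B -> measurable C ->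
    m1 ((A `*` B) `*` C) = m2 ((A `*` B) `*` C)) ->
  m1 setT < +oo -> forall X, measurable X -> m1 X = m2 X.
Proof.
move=> m12 m1oo; apply: measure_prod_unique => // Z C mZ mC.
have mf : measurable_fun setT ((\1_C : T3 -> R) \o (@snd (T1 * T2) T3)).
  exact: (measurableT_comp (measurable_indic mC) measurable_snd).
have f0 z : (0 <= ((\1_C : T3 -> R) \o (@snd (T1 * T2) T3)) z)%R by [].
have e (m : {measure set ((T1 * T2) * T3) -> \bar R}) A : measurable A ->
    weighted_law m mf f0 measurable_fst A = m (A `*` C).
  move=> mA; rewrite /weighted_law.
  transitivity (\int[m]_(x in fst @^-1` A) (\1_(setT `*` C) x)%:E).
    apply: eq_integral => x _; rewrite /= !indicE.
    suff -> : (x \in setT `*` C) = (x.2 \in C) by [].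
    by apply/idP/idP => /set_mem h; apply/mem_set => //; case: h.
  rewrite integral_indic//.
  - by congr (m _); apply/seteqP; split => [x [[_ ?] ?]|x [? ?]]; do ?split.
  - by rewrite -[X in measurable X]setTI; exact: measurable_fst.
  - exact: measurableX.
rewrite -!e//; apply: measure_prod_unique mZ => //=.
- by move=> A B mA mB; rewrite !e ?m12//; exact: measurableX.
- by rewrite e//; apply: le_lt_trans m1oo; apply: le_measure; rewrite ?inE//;
    exact: measurableX.
Qed.

Section joint_law.
Context d d1 d2 (Omega : measurableType d) (T1 : measurableType d1)
  (T2 : measurableType d2) (R : realType).
Variables (m : {measure set Omega -> \bar R}) (K : R.-pker T1 ~> T2)
  (D : set Omega) (Y : Omega -> T1).
Hypotheses (mD : measurable D) (mY : measurable_fun setT Y).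

Definition joint_law of measurable D & measurable_fun setT Y :=
  fun A : set (T1 * T2) => \int[m]_(w in D) K (Y w) (xsection A (Y w)).

Local Notation jl := (joint_law mD mY).

Let mK A : measurable A ->
  measurable_fun setT (fun w => K (Y w) (xsection A (Y w))).
Proof.
move=> mA.
exact: (measurableT_comp (measurable_fun_xsection_finite_kernel K (mem_set mA)) mY).
Qed.

Let jl0 : jl set0 = 0.
Proof. by apply: integral0_eq => w _; rewrite xsection0 measure0. Qed.

Let jl_ge0 A : 0 <= jl A.
Proof. by apply: integral_ge0 => w _. Qed.

Let jl_sigma : semi_sigma_additive jl.
Proof.
move=> F mF tF mUF.
rewrite (_ : jl _ = \sum_(n <oo) jl (F n)).
  by apply: is_cvg_nneseries => n _ _; exact: integral_ge0.
rewrite /joint_law -integral_nneseries//; last first.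
  by move=> n; apply: measurable_funTS; exact: mK.
apply: eq_integral => w _; rewrite xsection_bigcup measure_bigcup//.
- by apply: eq_eseriesl => n; rewrite in_setT.
- by move=> n _; exact: measurable_xsection.
- exact: trivIset_xsection.
Qed.

HB.instance Definition _ :=
  isMeasure.Build _ (T1 * T2)%type R jl jl0 jl_ge0 jl_sigma.

(** Needed on the diagonal, to decide whether [Z = Y] is possible: both sides are
    measures in [A], so it is enough to know them on rectangles. *)
Lemma joint_lawP (Z : Omega -> T2) : measurable_fun setT Z -> m D < +oo ->
  (forall A B, measurable A -> measurable B ->
    m (D `&` [set w | A (Y w) /\ B (Z w)]) =
    \int[m]_(w in D `&` Y @^-1` A) K (Y w) B) ->
  forall A, measurable A -> m (D `&` [set w | A (Y w, Z w)]) = jl A.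
Proof.
move=> mZ mDoo h A mA.
have mYZ : measurable_fun setT (fun w => (Y w, Z w)).
  exact: measurable_fun_pair.
pose f : Omega -> R := \1_D.
have mf : measurable_fun setT f by exact: measurable_indic.
have f0 w : (0 <= f w)%R by rewrite /f indicE.
have e B : measurable B -> weighted_law m mf f0 mYZ B =
    m (D `&` [set w | B (Y w, Z w)]).
  by move=> mB; rewrite /weighted_law/= integral_indic//;
    rewrite -[X in measurable X]setTI; exact: mYZ.
rewrite -e//; apply: measure_prod_unique mA => /=.
- move=> B C mB mC; rewrite e; last exact: measurableX.
  rewrite (h _ _ mB mC) integral_mkcondr /joint_law; apply: eq_integral => w _.
  rewrite patchE; case: ifPn => BY.
    by rewrite in_xsectionX//; move: BY; rewrite !inE.
  by rewrite notin_xsectionX ?measure0//; apply: contra BY; rewrite !inE.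
- rewrite e//; apply: le_lt_trans mDoo; apply: le_measure; rewrite ?inE//.
  by rewrite (_ : [set w | _] = setT) ?setIT//; apply/seteqP.
Qed.

End joint_law.

Section weighted_law_restrict.
Context d1 d2 (T1 : measurableType d1) (T2 : measurableType d2) (R : realType).
Variables (m : {measure set T1 -> \bar R}) (f : T1 -> R) (E : set T1)
  (Y : T1 -> T2).
Hypotheses (mf : measurable_fun setT (f \_ E))
  (f0 : forall x, (0 <= (f \_ E) x)%R) (mY : measurable_fun setT Y).

Lemma weighted_law_restrict A :
  weighted_law m mf f0 mY A = \int[m]_(x in Y @^-1` A `&` E) (f x)%:E.
Proof.
rewrite /weighted_law integral_mkcondr; apply: eq_integral => x _.
by rewrite !patchE; case: ifP.
Qed.

End weighted_law_restrict.

Lemma restrict_ge0 (T : Type) (R : realType) (f : T -> R) (E : set T) :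
  (forall x, (0 <= f x)%R) -> forall x, (0 <= (f \_ E) x)%R.
Proof. by move=> f0 x; rewrite patchE; case: ifP. Qed.

Lemma measurable_restrict_setT d (T : measurableType d) (R : realType)
    (f : T -> R) (E : set T) :
  measurable E -> measurable_fun setT f -> measurable_fun setT (f \_ E).
Proof.
by move=> mE mf; apply/(measurable_restrictT _ mE); exact: measurable_funTS.
Qed.

Lemma measure_R_unique (R : realType) (m1 m2 : {measure set R -> \bar R}) :
  (forall a : R, m1 `]a, +oo[%classic = m2 `]a, +oo[%classic) ->
  m1 setT < +oo -> forall A, measurable A -> m1 A = m2 A.
Proof.
move=> m12 m1oo A mA.
apply: (measure_unique (@RGenOInfty.G R) (fun n => `](- n%:R)%R, +oo[%classic)) => //.
- exact: RGenOInfty.measurableE.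
- move=> _ _ [x ->] [y ->]; exists (Num.max x y).
  apply/seteqP; split => z /=; rewrite !in_itv/= !andbT gt_max.
    by move=> [-> ->].
  by move=> /andP[].
- by move=> n; exists (- n%:R)%R.
- apply/seteqP; split => // z _; exists (Num.truncn (- z)%R).+1 => //=.
  by rewrite in_itv/= andbT ltrNl truncnS_gt.
- by move=> _ [x ->].
- move=> n; apply: le_lt_trans m1oo; apply: le_measure; rewrite ?inE//.
Qed.

Lemma measure_prod_half_lines_unique d1 d2 (T1 : measurableType d1)
    (T2 : measurableType d2) (R : realType)
    (m1 m2 : {measure set ((T1 * T2) * R) -> \bar R}) :
  (forall A B a, measurable A -> measurable B ->
    m1 ((A `*` B) `*` `]a, +oo[%classic) = m2 ((A `*` B) `*` `]a, +oo[%classic)) ->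
  m1 setT < +oo -> forall X, measurable X -> m1 X = m2 X.
Proof.
move=> m12 m1oo; apply: measure_prod3_unique => // A B C mA mB mC.
have mAB : measurable (A `*` B) by exact: measurableX.
pose f : (T1 * T2) * R -> R := \1_(A `*` B) \o fst.
have mf : measurable_fun setT f.
  exact: (measurableT_comp (measurable_indic mAB) measurable_fst).
have f0 z : (0 <= f z)%R by [].
have e (m : {measure set ((T1 * T2) * R) -> \bar R}) I : measurable I ->
    weighted_law m mf f0 measurable_snd I = m ((A `*` B) `*` I).
  move=> mI; rewrite /weighted_law.
  transitivity (\int[m]_(x in snd @^-1` I) (\1_((A `*` B) `*` setT) x)%:E).
    apply: eq_integral => x _; rewrite /f/= !indicE.
    suff -> : (x \in (A `*` B) `*` setT) = (x.1 \in A `*` B) by [].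
    by apply/idP/idP => /set_mem h; apply/mem_set => //; case: h.
  rewrite integral_indic//.
  - congr (m _); apply/seteqP; split => [x [[h _] h1]|x [h h1]].
      exact: (conj h h1).
    exact: (conj (conj h Logic.I) h1).
  - by rewrite -[X in measurable X]setTI; exact: measurable_snd.
  - exact: measurableX.
rewrite -!e//; apply: measure_R_unique mC => /=.
- by move=> a; rewrite !e ?m12.
- by rewrite e//; apply: le_lt_trans m1oo; apply: le_measure; rewrite ?inE//;
    exact: measurableX.
Qed.

(** * The primitive of an exponential *)

Lemma measurable_bool_set d (T : measurableType d) (b : T -> bool) :
  measurable_fun setT b -> measurable [set x | b x].
Proof.
move=> mb; rewrite -[X in measurable X]setTI.
rewrite (_ : [set x | b x] = b @^-1` [set true]); last first.
  by apply/seteqP; split=> x /=.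
exact: mb.
Qed.

Lemma measurable_lte_set d (T : measurableType d) (R : realType)
    (f g : T -> \bar R) :
  measurable_fun setT f -> measurable_fun setT g ->
  measurable [set x | f x < g x].
Proof. by move=> mf mg; apply: measurable_bool_set; exact: measurable_fun_lte. Qed.

Lemma measurable_lee_set d (T : measurableType d) (R : realType)
    (f g : T -> \bar R) :
  measurable_fun setT f -> measurable_fun setT g ->
  measurable [set x | f x <= g x].
Proof. by move=> mf mg; apply: measurable_bool_set; exact: measurable_fun_lee. Qed.

Lemma measurable_expeR (R : realType) : measurable_fun setT (@expeR R).
Proof.
have -> : @expeR R = (fun x => if x == +oo then +oo else
    if x == -oo then 0 else (expR (fine x))%:E).
  by apply/funext => -[].
apply: measurable_fun_ifT => //; first exact: measurable_fun_eqe.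
apply: measurable_fun_ifT => //; first exact: measurable_fun_eqe.
apply/measurable_EFinP; apply: measurableT_comp; first exact: measurable_expR.
exact: fine_measurable.
Qed.

Section exponential_primitive.
Context (R : realType) (f : R -> R) (b : R).
Hypotheses (mf : measurable_fun setT f) (f0 : forall x, (0 <= f x)%R).
Local Notation leb := (@lebesgue_measure R).
Let F s := \int[leb]_(u in `[0%R, s]) (f u)%:E.
Hypothesis Fb : F b < +oo.

Let mEf : measurable_fun setT (EFin \o f).
Proof. exact/measurable_EFinP. Qed.

Let f0E x : 0 <= (f x)%:E. Proof. by rewrite lee_fin. Qed.

Let FD x y : (0 <= x)%R -> (x <= y)%R ->
  F y = F x + \int[leb]_(u in `]x, y]) (f u)%:E.
Proof.
move=> x0 xy; rewrite /F -ge0_integral_setU//=; last 2 first.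
- exact: measurable_funTS.
- rewrite disj_set2E; apply/eqP; rewrite -subset0 => z [] /=.
  by rewrite !in_itv/= => /andP[_ zx] /andP[]; rewrite ltNge zx.
congr (integral _ _ _); apply/seteqP; split=> z /=; rewrite !in_itv/=.
  move=> /andP[z0 zy]; have [zx|xz] := leP z x; first by left; rewrite z0.
  by right; rewrite zy.
by move=> [/andP[-> zx]|/andP[xz ->]]/=; [exact: le_trans zx xy|rewrite andbT (le_trans x0)// ltW].
Qed.

Let F_ge0 s : 0 <= F s. Proof. exact: integral_ge0. Qed.

Let F_fin s : (0 <= s)%R -> (s <= b)%R -> F s \is a fin_num.
Proof.
move=> s0 sb; rewrite ge0_fin_numE//; apply: le_lt_trans Fb.
by rewrite (FD s0 sb) leeDl// integral_ge0.
Qed.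

Let Fr s := fine (F s).

Let FrE s : (0 <= s)%R -> (s <= b)%R -> F s = (Fr s)%:E.
Proof. by move=> s0 sb; rewrite /Fr fineK// F_fin. Qed.

Let incE x y : (0 <= x)%R -> (x <= y)%R -> (y <= b)%R ->
  \int[leb]_(u in `]x, y]) (f u)%:E = (Fr y - Fr x)%:E.
Proof.
move=> x0 xy yb; have := FD x0 xy.
rewrite !FrE ?(le_trans x0 xy) ?(le_trans xy yb)// => e.
by apply/eqP; rewrite EFinB e addeAC subee// add0e.
Qed.

Let Fr_homo x y : (0 <= x)%R -> (x <= y)%R -> (y <= b)%R -> (Fr x <= Fr y)%R.
Proof.
move=> x0 xy yb; rewrite -subr_ge0 -lee_fin -incE//; exact: integral_ge0.
Qed.

Let mF : measurable_fun setT F.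
Proof.
pose g (z : R * R) := (f z.2)%:E * (\1_[set z : R * R | (0 <= z.2 <= z.1)%R] z)%:E.
have -> : F = (fun s => \int[leb]_u g (s, u)).
  apply/funext => s; rewrite /F integral_mkcond; apply: eq_integral => u _.
  rewrite patchE /g indicE/= mem_setE in_itv/=.
  have -> : ((s, u) \in [set z : R * R | (0 <= z.2 <= z.1)%R]) = (0 <= u <= s)%R.
    by apply/idP/idP => [/set_mem//|su]; exact/mem_set.
  by case: ifP => _; rewrite ?mule1 ?mule0.
apply: measurable_fun_fubini_tonelli_F => //.
  apply: emeasurable_funM.
    by apply/measurable_EFinP; exact: measurableT_comp.
  apply/measurable_EFinP; apply: measurable_indic.
  apply: measurable_bool_set.
  apply: measurable_and; exact: measurable_fun_ler.
by move=> z; rewrite /g mule_ge0// lee_fin.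
Qed.

Let g s := (f s)%:E * expeR (- F s).

Let mg : measurable_fun setT g.
Proof.
apply: emeasurable_funM => //; apply: measurableT_comp; first exact: measurable_expeR.
exact: measurableT_comp.
Qed.

Let g0 s : 0 <= g s. Proof. by rewrite mule_ge0// expeR_ge0. Qed.

Let gE s : (0 <= s)%R -> (s <= b)%R -> g s = (f s * expR (- Fr s))%:E.
Proof. by move=> s0 sb; rewrite /g (FrE s0 sb) EFinM. Qed.

Let I x y := \int[leb]_(s in `]x, y]) g s.

Let I_bound x y : (0 <= x)%R -> (x <= y)%R -> (y <= b)%R ->
  (expR (- Fr y) * (Fr y - Fr x))%:E <= I x y <=
  (expR (- Fr x) * (Fr y - Fr x))%:E.
Proof.
move=> x0 xy yb; have y0 := le_trans x0 xy; have xb := le_trans xy yb.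
apply/andP; split; rewrite EFinM -incE// -ge0_integralZl//;
  rewrite ?lee_fin ?expR_ge0//; try exact: measurable_funTS.
- apply: ge0_le_integral => //=; try exact: measurable_funTS.
  + by move=> s _; rewrite mule_ge0// lee_fin expR_ge0.
  + by apply: measurable_funTS; exact: measurable_funeM.
  + move=> s; rewrite in_itv/= => /andP[xs sy].
    have s0 : (0 <= s)%R by rewrite (le_trans x0)// ltW.
    rewrite [leRHS](gE s0 (le_trans sy yb)) -EFinM lee_fin mulrC; apply: ler_wpM2l => //.
    by rewrite ler_expR lerN2; exact: Fr_homo.
- apply: ge0_le_integral => //=; try exact: measurable_funTS.
  + by apply: measurable_funTS; exact: measurable_funeM.
  + move=> s; rewrite in_itv/= => /andP[xs sy].
    have s0 : (0 <= s)%R by rewrite (le_trans x0)// ltW.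
    rewrite [leLHS](gE s0 (le_trans sy yb)) -EFinM lee_fin mulrC; apply: ler_wpM2r => //.
    by rewrite ler_expR lerN2; apply: Fr_homo => //; [exact: ltW|exact: le_trans yb].
Qed.

Let I_fin x y : (0 <= x)%R -> (x <= y)%R -> (y <= b)%R -> I x y \is a fin_num.
Proof.
move=> x0 xy yb; have /andP[_ h] := I_bound x0 xy yb.
by rewrite ge0_fin_numE ?integral_ge0//; apply: (le_lt_trans h); rewrite ltry.
Qed.

Let D x y := (fine (I x y) - (expR (- Fr x) - expR (- Fr y)))%R.

Let D_bound x y : (0 <= x)%R -> (x <= y)%R -> (y <= b)%R ->
  (`|D x y| <= (Fr y - Fr x) ^+ 2)%R.
Proof.
move=> x0 xy yb; have := I_bound x0 xy yb.
rewrite -(fineK (I_fin x0 xy yb)) !lee_fin => /andP[h1 h2].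
have := Fr_homo x0 xy yb; rewrite -subr_ge0 => h.
have e1 : (expR (- Fr x) <= 1)%R.
  by rewrite expR_le1 oppr_le0 fine_ge0.
have eE : (expR (- Fr y) = expR (- Fr x) * expR (- (Fr y - Fr x)))%R.
  by rewrite -expRD; congr expR; ring.
have eE' : (expR (- Fr x) = expR (- Fr y) * expR (Fr y - Fr x))%R.
  by rewrite -expRD; congr expR; ring.
have h3 := expR_ge1Dx (- (Fr y - Fr x)).
have h4 := expR_ge1Dx (Fr y - Fr x).
have p1 := expR_gt0 (- Fr x); have p2 := expR_gt0 (- Fr y).
rewrite /D; set i := fine _ in h1 h2 *; set u := (Fr y - Fr x)%R in h h1 h2 h3 h4 eE eE' *.
set A := expR (- Fr x) in e1 eE eE' p1 h2 *; set B := expR (- Fr y) in eE eE' p2 h1 *.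
have g1 : (A - B <= A * u)%R.
  rewrite eE -[X in (X - _)%R]mulr1 -mulrBr ler_wpM2l ?(ltW p1)//; lra.
have g2 : (B * u <= A - B)%R.
  by rewrite eE' -[X in (_ <= _ - X)%R]mulr1 -mulrBr ler_wpM2l ?(ltW p2)//; lra.
have g3 : (A * u - B * u <= u ^+ 2)%R.
  by rewrite -mulrBl expr2 ler_wpM2r// (le_trans g1)// ler_piMl.
by rewrite ler_norml; apply/andP; split; lra.
Qed.

Let ID x z y : (0 <= x)%R -> (x <= z)%R -> (z <= y)%R -> (y <= b)%R ->
  D x y = (D x z + D z y)%R.
Proof.
move=> x0 xz zy yb; have z0 := le_trans x0 xz; have zb := le_trans zy yb.
have : I x y = I x z + I z y.
  rewrite /I -ge0_integral_setU//=; last 2 first.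
  - exact: measurable_funTS.
  - rewrite disj_set2E; apply/eqP; rewrite -subset0 => t [] /=.
    by rewrite !in_itv/= => /andP[_ tz] /andP[]; rewrite ltNge tz.
  congr (integral _ _ _); apply/seteqP; split=> t /=; rewrite !in_itv/=.
    move=> /andP[xt ty]; have [tz|tz] := leP t z; first by left; rewrite xt.
    by right; rewrite ty.
  move=> [/andP[-> tz]|/andP[zt ->]]/=; first exact: le_trans tz zy.
  by rewrite andbT (le_lt_trans xz).
move=> IE; have IEr := etrans (congr1 fine IE) (fineD (I_fin x0 xz zb) (I_fin z0 zy yb)).
have reassemble (a a1 a2 e1 e2 e3 : R) : a = (a1 + a2)%R ->
    (a - (e1 - e3) = (a1 - (e1 - e2)) + (a2 - (e2 - e3)))%R by move=> ->; ring.
exact: reassemble IEr.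
Qed.

Let Fr_continuous : (0 < b)%R -> {within `[0%R, b], continuous Fr}.
Proof.
move=> b0; apply: (parameterized_integral_continuous (ltW b0)).
apply/integrableP; split; first exact: measurable_funTS.
by under eq_integral do rewrite /= ger0_norm//.
Qed.

Let D_halving k x y : (0 <= x)%R -> (x <= y)%R -> (y <= b)%R ->
  (`|D x y| <= (Fr y - Fr x) ^+ 2 / 2 ^+ k)%R.
Proof.
elim: k x y => [|k ih] x y x0 xy yb; first by rewrite expr0 divr1 D_bound.
have [xyE|xny] := eqVneq x y.
  by rewrite (le_trans (D_bound x0 xy yb))// xyE subrr expr0n/= mul0r.
have xltey : (x < y)%R by rewrite lt_neqAle xny.
have b0 : (0 < b)%R by rewrite (lt_le_trans _ yb)// (le_lt_trans x0).
have FF := Fr_homo x0 xy yb.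
have [z] : exists2 z, z \in `[x, y] & Fr z = ((Fr x + Fr y) / 2)%R.
  apply: (IVT xy).
    apply: continuous_subspaceW (Fr_continuous b0) => t /=.
    by rewrite !in_itv/= => /andP[/(le_trans x0)-> /le_trans->].
  by rewrite (min_idPl FF) (max_idPr FF); apply/andP; split; lra.
rewrite in_itv/= => /andP[xz zy] Fz.
rewrite (ID x0 xz zy yb) (le_trans (ler_normD _ _))//.
have h1 := ih _ _ x0 xz (le_trans zy yb).
have h2 := ih _ _ (le_trans x0 xz) zy yb.
rewrite (le_trans (lerD h1 h2))// Fz (exprS _ k).
have k0 : (2 ^+ k != 0 :> R)%R by rewrite expf_neq0// pnatr_eq0.
by rewrite le_eqVlt; apply/orP; left; apply/eqP; field.
Qed.

Let D0 x y : (0 <= x)%R -> (x <= y)%R -> (y <= b)%R -> D x y = 0%R.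
Proof.
move=> x0 xy yb; apply/eqP; rewrite -normr_eq0 eq_le normr_ge0 andbT.
apply/ler_addgt0Pl => e e0; rewrite addr0.
set C := ((Fr y - Fr x) ^+ 2)%R.
have C0 : (0 <= C)%R by rewrite sqr_ge0.
pose k := (Num.truncn (C / e)).+1.
apply: (le_trans (D_halving k x0 xy yb)); rewrite ler_pdivrMr ?exprn_gt0//.
have h : (C / e < k%:R)%R by apply: truncnS_gt.
have : (k%:R <= 2 ^+ k :> R)%R by rewrite -natrX ler_nat ltnW// ltn_expl.
move=> /(lt_le_trans h); rewrite ltr_pdivrMr// mulrC => /ltW.
by [].
Qed.

(** The derivative of [exp (- F)] is [- f exp (- F)] only almost everywhere when
    [f] is merely integrable. The two sides differ on [x, y] by at most the
    square of the increment of [F]; halving that increment repeatedly makes the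
    total error vanish. *)
Lemma integral_expR_primitive x y :
  (0 <= x)%R -> (x <= y)%R -> (y <= b)%R ->
  \int[leb]_(s in `]x, y]) ((f s)%:E * expeR (- F s)) + expeR (- F y) =
  expeR (- F x).
Proof.
move=> x0 xy yb; have := D0 x0 xy yb; rewrite /D => /eqP; rewrite subr_eq0 => /eqP.
move=> IE; rewrite -/(I x y) -(fineK (I_fin x0 xy yb)) IE.
have y0 := le_trans x0 xy; have xb := le_trans xy yb.
by rewrite !FrE//= -EFinD subrK.
Qed.

End exponential_primitive.

(** * Translation invariance and fixed times *)

Lemma integral_lebesgue_shift (R : realType) (c : R) (g : R -> \bar R) :
  measurable_fun setT g -> (forall s, 0 <= g s) ->
  \int[@lebesgue_measure R]_s g (s - c)%R = \int[@lebesgue_measure R]_s g s.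
Proof.
move=> mg g0; have mc : measurable_fun setT (fun s : R => s - c)%R.
  by apply: measurable_funB.
transitivity (\int[pushforward (@lebesgue_measure R)
    ((fun s => s - c)%R : measurableTypeR R -> measurableTypeR R)]_s g s).
  by rewrite ge0_integral_pushforward//.
apply: eq_measure_integral => B mB _; apply/esym/lebesgue_measure_unique => //=.
move=> _ [[x y]] _ <-; rewrite /pushforward.
rewrite (_ : _ @^-1` _ = `](x + c)%R, (y + c)%R]%classic); last first.
  by apply/seteqP; split => z /=; rewrite !in_itv/= ltrBrDr lerBlDr.
by rewrite !lebesgue_measure_itv/= !lte_fin ltrD2r; case: ifP => // _; congr (_%:E); ring.
Qed.

Section hitting.
Context d (Omega : measurableType d) (R : realType) (P : probability Omega R).
Variable (T : nat -> Omega -> \bar R).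
Hypothesis mT : forall n, measurable_fun setT (T n).

(** Tonelli: a point process has no atom at almost every time, because a path
    visits each of its countably many times on a Lebesgue null set. *)
Lemma ae_no_fixed_time :
  {ae @lebesgue_measure R, forall t, P [set w | exists n, T n w = t%:E] = 0}.
Proof.
pose Z : set (R * Omega) := \bigcup_n [set z | T n z.2 = z.1%:E].
have mZ : measurable Z.
  apply: bigcup_measurable => n _; have mTn : measurable_fun setT (fun z : R * Omega => T n z.2).
    exact: (measurableT_comp (mT n) measurable_snd).
  have mt : measurable_fun setT (fun z : R * Omega => z.1%:E).
    by apply/measurable_EFinP; exact: measurable_fst.
  by rewrite -[X in measurable X]setTI; exact: measurable_eqe.
pose f (z : R * Omega) : \bar R := (\1_Z z)%:E.
have mf : measurable_fun setT f by apply/measurable_EFinP; exact: measurable_indic.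
have f0 z : 0 <= f z by rewrite lee_fin.
have fE t : P [set w | exists n, T n w = t%:E] = \int[P]_w f (t, w).
  have -> : [set w | exists n, T n w = t%:E] = xsection Z t.
    apply/seteqP; split => w /=; rewrite /xsection/= inE.
      by move=> [n e]; exists n.
    by move=> [n _ e]; exists n.
  rewrite -[RHS](_ : \int[P]_w (\1_(xsection Z t) w)%:E = _); last first.
    by apply: eq_integral => w _; rewrite /f !indicE /xsection/= mem_setE.
  by rewrite integral_indic ?setIT//; exact: measurable_xsection.
have f2 w : \int[@lebesgue_measure R]_t f (t, w) = 0.
  rewrite (_ : integral _ _ _ = \int[@lebesgue_measure R]_t (\1_(ysection Z w) t)%:E); last first.
    by apply: eq_integral => t _; rewrite /f !indicE /ysection/= mem_setE.
  rewrite integral_indic ?setIT//; last exact: measurable_ysection.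
  apply: countable_lebesgue_measure0.
  apply: (@sub_countable _ _ _ (range (fun n => fine (T n w)))).
    apply: subset_card_le => t; rewrite /ysection/= inE => -[n _ /= e].
    by exists n => //; rewrite e.
  exact: card_image_le.
have h : \int[@lebesgue_measure R]_t P [set w | exists n, T n w = t%:E] = 0.
  under eq_integral do rewrite fE.
  transitivity (\int[P]_w \int[@lebesgue_measure R]_t f (t, w)).
    exact: fubini_tonelli.
  by apply: integral0_eq => w _; exact: f2.
have mg : measurable_fun setT (fun t => P [set w | exists n, T n w = t%:E]).
  by under eq_fun do rewrite fE; exact: measurable_fun_fubini_tonelli_F.
have [+ _] := ae_eq_integral_abs (@lebesgue_measure R) measurableT mg.
under eq_integral do rewrite gee0_abs//.
by move=> /(_ h); apply: filterS => t /(_ Logic.I).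
Qed.

End hitting.

(** * The state space and the flow *)

Lemma is_derive_comp_shift (R : realType) (V : normedModType R) (g : R -> V)
    (c s : R) (df : V) :
  is_derive (s + c)%R (1%R : R) g df ->
  is_derive s (1%R : R) (fun u => g (u + c)%R) df.
Proof.
move=> [gd gv].
have e : (fun h : R => h^-1 *: (((fun u => g (u + c)%R) \o shift s) (h *: 1) -
      g (s + c)%R))%R =
    (fun h : R => h^-1 *: ((g \o shift (s + c)) (h *: 1) - g (s + c)%R))%R.
  by apply/funext => h /=; rewrite addrA.
apply: DeriveDef; first by rewrite /derivable e.
by rewrite /derive e.
Qed.

Lemma is_derive_comp_reverse (R : realType) (V : normedModType R) (g : R -> V)
    (c s : R) (df : V) :
  is_derive (c - s)%R (1%R : R) g df ->
  is_derive s (1%R : R) (fun u => g (c - u)%R) (- df)%R.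
Proof.
move=> [gd gv]; have dg := (derivable1_diffP _ _).1 gd.
pose h (u : R) := (c - u)%R.
have dh : is_derive s (1%R : R) h (- 1)%R.
  have hE : h = (cst c - id)%R by [].
  by rewrite hE -[(- 1)%R]sub0r; exact: is_deriveB.
have dh' : differentiable h s by apply/derivable1_diffP; case: dh.
have dgh : differentiable (g \o h) s by exact: differentiable_comp.
apply: DeriveDef; first by apply/derivable1_diffP.
rewrite deriveE// diff_comp//= -(deriveE _ dh').
case: dh => _ ->; rewrite linearN/= -deriveE//; congr (- _)%R.
exact: gv.
Qed.

Lemma at_left_within (R : realType) (b t : R) : (0 < t)%R -> (t <= b)%R ->
  t^'- `=>` within `[0%R, b] (nbhs t).
Proof.
move=> t0 tb A.
change ((\forall u \near t, `[0%R, b]%classic u -> A u) ->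
  (\forall u \near t, (u < t)%R -> A u)).
apply: filterS2 (lt_nbhsr t0) => u u0 h ut; apply: h.
by rewrite /= in_itv/= !ltW// (lt_le_trans ut).
Qed.

Lemma at_right_within (R : realType) (b t : R) : (0 <= t)%R -> (t < b)%R ->
  t^'+ `=>` within `[0%R, b] (nbhs t).
Proof.
move=> t0 tb A.
change ((\forall u \near t, `[0%R, b]%classic u -> A u) ->
  (\forall u \near t, (t < u)%R -> A u)).
apply: filterS2 (lt_nbhsl tb) => u ub h tu; apply: h.
by rewrite /= in_itv/= (ltW ub) ltW// (le_lt_trans t0).
Qed.

Lemma cvg_at_left_shift (R : realType) (V : topologicalType) (f : R -> V)
    (s a : R) (l : V) :
  f u @[u --> s^'-] --> l -> f (u - a)%R @[u --> (s + a)^'-] --> l.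
Proof.
move=> fl A /fl; rewrite /nbhs/= => hA.
have h : (u - a)%R @[u --> (s + a)%R] --> s.
  have -> : s = (s + a - a)%R by rewrite addrK.
  by rewrite subrK; apply: cvgB; [exact: cvg_id|exact: cvg_cst].
have {}hA : \forall u \near s, (u < s)%R -> A (f u) by exact: hA.
change (\forall u \near (s + a)%R, (u < s + a)%R -> A (f (u - a)%R)).
have {}h : \forall u \near (s + a)%R, (u - a < s)%R -> A (f (u - a)%R).
  exact: h _ hA.
by apply: filterS h => u; rewrite ltrBlDr.
Qed.

Lemma cvg_at_right_shift (R : realType) (V : topologicalType) (f : R -> V)
    (s a : R) (l : V) :
  f u @[u --> s^'+] --> l -> f (u - a)%R @[u --> (s + a)^'+] --> l.
Proof.
move=> fl A /fl; rewrite /nbhs/= => hA.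
have h : (u - a)%R @[u --> (s + a)%R] --> s.
  have -> : s = (s + a - a)%R by rewrite addrK.
  by rewrite subrK; apply: cvgB; [exact: cvg_id|exact: cvg_cst].
have {}hA : \forall u \near s, (s < u)%R -> A (f u) by exact: hA.
change (\forall u \near (s + a)%R, (s + a < u)%R -> A (f (u - a)%R)).
have {}h : \forall u \near (s + a)%R, (s < u - a)%R -> A (f (u - a)%R).
  exact: h _ hA.
by apply: filterS h => u; rewrite ltrBrDr.
Qed.

Section state_topology.
Variables (R : realType) (k : nat) (dim : 'I_k.+1 -> nat).
Local Notation S := (state R dim).

Lemma state_existT_continuous (i : 'I_k.+1) :
  continuous (fun x : 'rV[R]_(dim i) => existT _ i x : S).
Proof. exact: existT_continuous. Qed.

Lemma state_openP (U : set S) :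
  open U <-> forall i, open ((fun x : 'rV[R]_(dim i) => existT _ i x : S) @^-1` U).
Proof. exact: sigT_openP. Qed.

Lemma measurable_state_open (U : set S) : open U -> measurable U.
Proof. by move=> oU; exact: sub_sigma_algebra. Qed.

Lemma rV_hausdorff (n : nat) : hausdorff_space 'rV[R]_n.
Proof. exact: norm_hausdorff. Qed.

Lemma state_hausdorff : hausdorff_space S.
Proof.
rewrite open_hausdorff => -[i x] [j y] xy.
have [ij|ij] := eqVneq i j; last first.
  exists ([set z : S | projT1 z = i], [set z : S | projT1 z = j]) => /=.
    by rewrite !inE.
  split.
  - apply/state_openP => l; have [->|li] := eqVneq l i.
      rewrite (_ : _ @^-1` _ = setT); first exact: openT.
      by apply/seteqP; split.
    rewrite (_ : _ @^-1` _ = set0); first exact: open0.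
    by apply/seteqP; split => // z /= /eqP; rewrite (negbTE li).
  - apply/state_openP => l; have [->|li] := eqVneq l j.
      rewrite (_ : _ @^-1` _ = setT); first exact: openT.
      by apply/seteqP; split.
    rewrite (_ : _ @^-1` _ = set0); first exact: open0.
    by apply/seteqP; split => // z /= /eqP; rewrite (negbTE li).
  - apply/eqP; rewrite -subset0 => z /= [-> /eqP]; exact/negP.
subst j; have xy' : x != y.
  by apply: contra xy => /eqP ->.
have := @rV_hausdorff (dim i); rewrite open_hausdorff => /(_ _ _ xy')[[U V] /=].
rewrite !inE => -[xU yV] [oU oV /seteqP[UV _]].
exists ((fun x => existT _ i x) @` U, (fun x => existT _ i x) @` V) => /=.
  by rewrite !inE; split; [exists x|exists y].
split; [exact: existT_open_map|exact: existT_open_map|].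
apply/eqP; rewrite -subset0 => z /= -[[u Uu <-] [v Vv /eqP]].
by rewrite -tag_eqE /tag_eq/= eqxx/= tagged_asE => /eqP vu; subst v; exact: (UV u).
Qed.

End state_topology.

(** What the jump process sees of a flow: [space] is where it may start,
    [inner] the open part, and [bd] the boundary at which a jump is forced. The
    same properties hold for the flow and for the reversed flow, with the two
    boundaries exchanged. *)
Record regular_flow (R : realType) (k : nat) (dim : 'I_k.+1 -> nat)
  (phi : state R dim -> R -> state R dim)
  (space bd inner : set (state R dim)) : Prop := {
  rf_measurable : measurable_fun setT (fun z : state R dim * R => phi z.1 z.2);
  rf_mspace : measurable space;
  rf_mbd : measurable bd;
  rf_minner : measurable inner;
  rf_sub : inner `<=` space;
  rf_disj : forall x, inner x -> ~ bd x;
  rf_0 : forall x, phi x 0%R = x;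
  rf_inner : forall x s, space x -> (0 < s)%R -> s%:E < hitting_time phi bd x ->
    inner (phi x s);
  rf_exit : forall x s, space x -> (0 < s)%R -> hitting_time phi bd x = s%:E ->
    bd (phi x s);
  rf_left : forall x s, space x -> (0 < s)%R -> s%:E <= hitting_time phi bd x ->
    phi x u @[u --> s^'-] --> phi x s;
  rf_right : forall x s, space x -> (0 <= s)%R -> s%:E < hitting_time phi bd x ->
    phi x u @[u --> s^'+] --> phi x s;
  rf_semigroup : forall x s v, space x -> (0 <= s)%R -> (0 <= s + v)%R ->
    s%:E < hitting_time phi bd x -> (s + v)%:E < hitting_time phi bd x ->
    phi (phi x s) v = phi x (s + v)%R;
  rf_mtau : forall b, (0 <= b)%R ->
    measurable [set x | space x /\ b%:E < hitting_time phi bd x];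
  rf_bd0 : forall x, bd x -> hitting_time phi bd x = 0;
  rf_pos : forall x, ~ bd x -> 0 < hitting_time phi bd x }.

Section flow_theory.
Variables (R : realType) (k : nat) (dim : 'I_k.+1 -> nat).
Local Notation S := (state R dim).
Variable Eo : forall i, set 'rV[R]_(dim i).
Variable r : forall i, 'rV[R]_(dim i) -> 'rV[R]_(dim i).

Definition trajectory i (g : R -> 'rV[R]_(dim i)) (t : R) : Prop :=
  {within `[0%R, t], continuous g} /\
  forall s, (0 < s)%R -> (s < t)%R -> Eo (g s) /\ is_derive s (1%R : R) g (r (g s)).

Lemma reaches_sub i (g : R -> 'rV[R]_(dim i)) t a b :
  trajectory g t -> (0 <= a)%R -> (a <= b)%R -> (b <= t)%R ->
  reaches Eo r (g a) (b - a)%R (g b).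
Proof.
move=> [cg dg] a0 ab bt; exists (fun u => g (u + a)%R); split.
- by rewrite add0r.
- by rewrite subrK.
- apply/subspace_continuousP => s /=; rewrite in_itv/= => /andP[s0 sb].
  have sa : `[0%R, t]%classic (s + a)%R.
    by rewrite /= in_itv/= addr_ge0//= (le_trans _ bt)// -lerBrDr.
  have h : (u + a)%R @[u --> s] --> (s + a)%R.
    by apply: cvgD; [exact: cvg_id|exact: cvg_cst].
  apply: (@cvg_comp _ _ _ (fun u => u + a)%R g _ (within `[0%R, t] (nbhs (s + a)%R))).
    move=> A hA.
    have {}h : \forall u \near s, `[0%R, t]%classic (u + a)%R -> A (u + a)%R.
      exact: h _ hA.
    change (\forall u \near s, `[0%R, (b - a)%R]%classic u -> A (u + a)%R).
    apply: filterS h => u Hu.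
    rewrite /= in_itv/= => /andP[u0 ub]; apply: Hu.
    by rewrite /= in_itv/= addr_ge0//= (le_trans _ bt)// -lerBrDr.
  by move/subspace_continuousP : cg; exact.
- move=> s s0 sb; have [| |? ?] := dg (s + a)%R.
  + by rewrite ltr_wpDr.
  + by rewrite (lt_le_trans _ bt)// -ltrBrDr.
  + by split => //; apply: is_derive_comp_shift.
Qed.

Lemma reaches_reverse i (x z : 'rV[R]_(dim i)) t : (0 <= t)%R ->
  reaches Eo r x t z -> reaches Eo (fun i y => - r y)%R z t x.
Proof.
move=> t0 [g [g0 gt cg dg]]; exists (fun u => g (t - u)%R); split.
- by rewrite subr0.
- by rewrite subrr.
- apply/subspace_continuousP => s /=; rewrite in_itv/= => /andP[s0 st].
  have sa : `[0%R, t]%classic (t - s)%R.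
    by rewrite /= in_itv/= subr_ge0 st/= gerBl.
  have h : (t - u)%R @[u --> s] --> (t - s)%R.
    by apply: cvgB; [exact: cvg_cst|exact: cvg_id].
  apply: (@cvg_comp _ _ _ (fun u => t - u)%R g _ (within `[0%R, t] (nbhs (t - s)%R))).
    move=> A hA.
    have {}h : \forall u \near s, `[0%R, t]%classic (t - u)%R -> A (t - u)%R.
      exact: h _ hA.
    change (\forall u \near s, `[0%R, t]%classic u -> A (t - u)%R).
    apply: filterS h => u Hu.
    rewrite /= in_itv/= => /andP[u0 ub]; apply: Hu.
    by rewrite /= in_itv/= subr_ge0 ub/= gerBl.
  by move/subspace_continuousP : cg; exact.
- move=> s s0 st; have [| |? ?] := dg (t - s)%R.
  + by rewrite subr_gt0.
  + by rewrite gtrBl.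
  + by split => //; apply: is_derive_comp_reverse.
Qed.

Hypothesis open_Eo : forall i, open (@Eo i).
Hypothesis unique_fwd : forall i (x z z' : 'rV[R]_(dim i)) t, (0 <= t)%R ->
  reaches Eo r x t z -> reaches Eo r x t z' -> z = z'.
Hypothesis unique_bwd : forall i (x x' z : 'rV[R]_(dim i)) t, (0 <= t)%R ->
  reaches Eo r x t z -> reaches Eo r x' t z -> x = x'.

Local Notation phi := (flow Eo r).
Local Notation E0 := (interior_states Eo).
Local Notation bd := (active_boundary Eo r).
Local Notation E := (states Eo r).
Local Notation dom := (flow_defined Eo r).

Lemma flowE (x : S) t z : flow_graph Eo r (projT2 x) t z ->
  phi x t = existT _ (projT1 x) z.
Proof.
move=> xz; rewrite /flow; congr existT; apply: xget_unique => // z' xz'.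
move: xz xz'; rewrite /flow_graph/=; case: ifPn => [t0 h h'|].
  exact: unique_fwd t0 h' h.
by rewrite -ltNge => t0 h h'; apply: unique_bwd h' h; rewrite oppr_ge0 ltW.
Qed.

Lemma flow_undefined (x : S) t : ~ dom x t -> phi x t = x.
Proof.
move=> xt; case: x xt => i x xt; rewrite /flow/=; congr existT.
by apply: xgetPN => z xz; apply: xt; exists z.
Qed.

Lemma reaches0 i (x : 'rV[R]_(dim i)) : reaches Eo r x 0 x.
Proof.
exists (fun=> x); split => //; first exact: cst_continuous.
by move=> s s0 /(lt_trans s0); rewrite ltxx.
Qed.

Lemma flow0 (x : S) : phi x 0 = x.
Proof.
case: x => i x; apply: flowE; rewrite /flow_graph/= lexx; exact: reaches0.
Qed.

(** Uniqueness in both time directions makes all trajectories through a point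
    agree, so an orbit segment may be restarted from any of its points. *)
Lemma flow_segment (x : S) t : (0 <= t)%R -> dom x t ->
  [/\ forall s, (0 <= s <= t)%R -> dom x s,
      forall s, (0 < s < t)%R -> E0 (phi x s),
      forall s, (0 <= s <= t)%R ->
        phi x u @[u --> within `[0%R, t] (nbhs s)] --> phi x s &
      forall s v, (0 <= s <= t)%R -> (0 <= s + v <= t)%R ->
        dom (phi x s) v /\ phi (phi x s) v = phi x (s + v)%R].
Proof.
move=> t0 [z]; rewrite /flow_graph/= t0 => -[g [g0 gt cg dg]].
have gT : trajectory g t by split.
have R_ s : (0 <= s <= t)%R -> flow_graph Eo r (projT2 x) s (g s).
  move=> /andP[s0 st]; rewrite /flow_graph/= s0.
  by have := reaches_sub gT (lexx 0%R) s0 st; rewrite subr0 g0.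
have PE s : (0 <= s <= t)%R -> phi x s = existT _ (projT1 x) (g s).
  by move=> /R_ /flowE.
split.
- by move=> s /R_ ?; exists (g s).
- move=> s /andP[s0 st]; rewrite PE ?(ltW s0) ?(ltW st)//.
  by have [] := dg _ s0 st.
- move=> s st; rewrite PE//.
  apply: (@cvg_trans _ ((fun u => existT _ (projT1 x) (g u) : S) @
      within `[0%R, t] (nbhs s))).
    apply: near_eq_cvg; apply: filterS (withinT _ _) => u /=.
    by rewrite in_itv/= => /PE ->.
  apply: (@cvg_comp _ _ _ g (fun y => existT _ (projT1 x) y : S)
     (within `[0%R, t] (nbhs s)) (nbhs (g s))).
    by move/subspace_continuousP : cg; apply; rewrite /= in_itv.
  exact: state_existT_continuous.
- move=> s v st svt; rewrite (PE _ st) (PE _ svt).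
  suff h : flow_graph Eo r (g s) v (g (s + v)%R).
    by split; [exists (g (s + v)%R)|exact: flowE].
  move: st svt => /andP[s0 st] /andP[sv0 svt].
  rewrite /flow_graph/=; case: ifPn => [v0|].
    have := reaches_sub gT s0 _ svt; rewrite lerDl => /(_ v0).
    by rewrite addrAC subrr add0r.
  rewrite -ltNge => v0; have := reaches_sub gT sv0 _ st.
  rewrite gerDl => /(_ (ltW v0)).
  by rewrite opprD addrA subrr add0r.
Qed.

Hypothesis forward : forall x, E x ->
  (forall t, (0 <= t)%R -> dom x t) \/ (exists2 t, (0 <= t)%R & bd (phi x t)).
Hypothesis mdom : measurable [set z : S * R | dom z.1 z.2].
Hypothesis mflow : measurable_fun [set z : S * R | dom z.1 z.2]
  (fun z => phi z.1 z.2).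

Local Notation tau := (hitting_time phi bd).

Lemma tau_ge0 x : 0 <= tau x.
Proof. by apply: le_ereal_inf_tmp => _ [t [t0 _] <-]; rewrite lee_fin. Qed.

Lemma tau_le x t : (0 <= t)%R -> bd (phi x t) -> tau x <= t%:E.
Proof. by move=> t0 xt; apply: ereal_inf_lbound; exists t. Qed.

Lemma tau_lt x (c : \bar R) : tau x < c ->
  exists t, [/\ (0 <= t)%R, bd (phi x t) & t%:E < c].
Proof. by move=> /ereal_inf_lt[_ [t [t0 xt] <-] tc]; exists t. Qed.

Lemma tau_bd x : bd x -> tau x = 0.
Proof.
move=> xb; apply/eqP; rewrite eq_le tau_ge0 andbT.
by apply: tau_le => //; rewrite flow0.
Qed.

Lemma bd_not_inner x : E0 x -> ~ bd x.
Proof. by move=> x0 [[_ +] _]. Qed.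

(** A boundary point reached at a positive time is reached only once: the orbit
    is interior before it. So the infimum defining the exit time is attained. *)
Lemma exit_at x t : ~ bd x -> (0 <= t)%R -> bd (phi x t) ->
  [/\ (0 < t)%R, dom x t & tau x = t%:E].
Proof.
move=> xb t0 xt.
have dt : dom x t by apply: contrapT => /flow_undefined e; rewrite e in xt.
have {}t0 : (0 < t)%R.
  by rewrite lt_neqAle t0 andbT eq_sym; apply: contra_notN xb => /eqP t00; rewrite t00 flow0 in xt.
split=> //; apply/eqP; rewrite eq_le tau_le ?(ltW t0)//= leNgt.
apply/negP => /tau_lt[s [s0 xs]]; rewrite lte_fin => st.
have [_ + _ _] := flow_segment (ltW t0) dt; move=> /(_ s).
rewrite st andbT lt_neqAle s0 andbT => h.
have /h /bd_not_inner : (0%R != s) by apply: contra_notN xb => /eqP s00; rewrite -s00 flow0 in xs.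
exact.
Qed.

Lemma tau_gt0 x : ~ bd x -> 0 < tau x.
Proof.
move=> xb; rewrite lt_neqAle tau_ge0 andbT; apply/eqP => t0.
have /tau_lt[t [t0' xt _]] : tau x < 1 by rewrite -t0 lte01.
have [tp _ te] := exit_at xb t0' xt.
by move: t0; rewrite te => -[/esym]; apply/eqP; rewrite gt_eqF.
Qed.

Lemma tau_fin x s : ~ bd x -> tau x = s%:E -> dom x s /\ bd (phi x s).
Proof.
move=> xb ts.
have /tau_lt[t [t0 xt _]] : tau x < (s + 1)%:E by rewrite ts lte_fin ltrDl.
by have [_ dt] := exit_at xb t0 xt; rewrite ts => -[->].
Qed.

Lemma dom_before_tau x s : E x -> (0 <= s)%R -> s%:E < tau x -> dom x s.
Proof.
move=> xE s0 st.
have xb : ~ bd x.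
  by move=> /tau_bd xb; move: st; rewrite xb lte_fin ltNge s0.
have [|[t t0 xt]] := forward xE; first exact.
have [tp dt te] := exit_at xb t0 xt.
have [+ _ _ _] := flow_segment t0 dt; apply.
by rewrite s0 ltW//; move: st; rewrite te.
Qed.

Lemma tau_between x s : s%:E < tau x -> exists2 t, (s < t)%R & t%:E < tau x.
Proof.
case: (tau x) => [u|_|//]; rewrite ?lte_fin.
  by move=> su; exists ((s + u) / 2)%R; rewrite ?lte_fin ?midf_lt.
by exists (s + 1)%R; rewrite ?ltrDl// ltry.
Qed.

Lemma before_tauP x b : (0 < b)%R ->
  (E x /\ b%:E < tau x) <-> [/\ E x, ~ bd x, dom x b & E0 (phi x b)].
Proof.
move=> b0; split=> [[xE bt]|[xE xb db xb0]].
  have xb : ~ bd x by move=> /tau_bd xb; move: bt; rewrite xb lte_fin ltNge ltW.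
  split => //; first exact: dom_before_tau (ltW b0) bt.
  have [t bt' tt] := tau_between bt.
  have t0 := ltW (lt_trans b0 bt').
  have [_ + _ _] := flow_segment t0 (dom_before_tau xE t0 tt).
  by apply; rewrite b0.
split => //; rewrite ltNge; apply/negP => tb.
case tE : (tau x) => [t| |]; rewrite ?tE in tb => //; last first.
  by have := tau_ge0 x; rewrite tE.
have [dt xt] := tau_fin xb tE; rewrite lee_fin in tb.
have t0 : (0 < t)%R by rewrite -lte_fin -tE tau_gt0.
have [tb'|bt] := ltP t b; last first.
  have e : t = b by apply/eqP; rewrite eq_le tb.
  by rewrite e in xt; exact: bd_not_inner xb0 xt.
have [_ + _ _] := flow_segment (ltW b0) db => /(_ t).
by rewrite t0 tb' => /(_ isT)/bd_not_inner.
Qed.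

Lemma measurable_flow_total : measurable_fun setT (fun z : S * R => phi z.1 z.2).
Proof.
move=> _ Y mY; rewrite setTI.
rewrite (_ : _ @^-1` _ =
  ([set z : S * R | dom z.1 z.2] `&` (fun z => phi z.1 z.2) @^-1` Y) `|`
  (~` [set z : S * R | dom z.1 z.2] `&` fst @^-1` Y)).
  apply: measurableU; first exact: mflow.
  apply: measurableI; first exact: measurableC.
  by rewrite -[X in measurable X]setTI; exact: measurable_fst.
apply/seteqP; split=> z /=.
  have [d|nd] := pselect (dom z.1 z.2); first by left.
  by rewrite flow_undefined//; right.
by move=> [[]//|[nd Yz]]; rewrite flow_undefined.
Qed.

Lemma measurable_dom_section t : measurable [set x : S | dom x t].
Proof. by have := measurable_ysection t mdom; rewrite ysectionE. Qed.

Lemma measurable_interior_states : measurable E0.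
Proof. by apply: measurable_state_open; apply/state_openP => i; exact: open_Eo. Qed.

Lemma closure_end i (x z : 'rV[R]_(dim i)) t : (0 < t)%R ->
  reaches Eo r x t z -> closure (@Eo i) z.
Proof.
move=> t0 [g [g0 gt /subspace_continuousP cg dg]] B; rewrite -gt => Bz.
have tt : `[0%R, t]%classic t by rewrite /= in_itv/= lexx ltW.
have h : \forall u \near t^'-, B (g u).
  exact: (at_left_within t0 (lexx t) (cg _ tt _ Bz)).
have h' : \forall u \near t^'-, [/\ B (g u), (0 < u)%R & (u < t)%R].
  near=> u; split; first by near: u.
  - by near: u; exact: nbhs_left_gt.
  - by near: u; exact: nbhs_left_lt.
have [u [Bu u0 ut]] : exists u, [/\ B (g u), (0 < u)%R & (u < t)%R].
  exact: (@filter_ex _ t^'- _ _ h').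
by exists (g u); split => //; have [] := dg u u0 ut.
Unshelve. all: by end_near. Qed.

(** A backward orbit from an exit point can be shortened to a length [1 / n]; a
    countable union of sections of the domain of the flow is thus enough, and it is
    measurable. *)
Lemma active_boundaryE :
  bd = ~` E0 `&` \bigcup_n [set z | dom z (- n.+1%:R^-1)%R].
Proof.
apply/seteqP; split=> z.
  move=> [[_ z0] [x [t [x0 t0 zE]]]]; split=> //.
  have dt : dom x t.
    by apply: contrapT => /flow_undefined e; rewrite e in zE; rewrite zE in z0.
  pose n := Num.truncn (t^-1)%R; have nt : (n.+1%:R^-1 <= t)%R.
    by rewrite -[leRHS]invrK lef_pV2 ?posrE ?invr_gt0// ltW// truncnS_gt.
  have [_ _ _ h] := flow_segment (ltW t0) dt.
  exists n => //=; have [||+ _] := h t (- n.+1%:R^-1)%R.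
  - by rewrite lexx ltW.
  - by rewrite subr_ge0 nt/= gerBl invr_ge0.
  - by rewrite -zE.
move=> [z0 [n _ [z']]].
rewrite /flow_graph/= leNgt oppr_lt0 invr_gt0 ltr0n/= opprK => h.
have n0 : (0 < n.+1%:R^-1 :> R)%R by rewrite invr_gt0.
split; first by split => //; exact: closure_end n0 h.
case: h => g [g0 gt cg dg].
pose u := (n.+1%:R^-1 / 2 : R)%R.
have u0 : (0 < u)%R by rewrite divr_gt0.
have un : (u < n.+1%:R^-1)%R by rewrite /u ltr_pdivrMr// ltr_pMr// ltr1n.
exists (existT _ (projT1 z) (g u)), (n.+1%:R^-1 - u)%R; split.
- by have [] := dg _ u0 un.
- by rewrite subr_gt0.
- have gT : trajectory g (n.+1%:R^-1)%R by split.
  have := reaches_sub gT (ltW u0) (ltW un) (lexx _); rewrite gt => ug.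
  have -> : phi (existT _ (projT1 z) (g u)) (n.+1%:R^-1 - u)%R =
      existT _ (projT1 z) (projT2 z).
    by apply: flowE; rewrite /flow_graph/= subr_ge0 ltW.
  by case: (z).
Qed.

Lemma measurable_active_boundary : measurable bd.
Proof.
rewrite active_boundaryE; apply: measurableI.
  by apply: measurableC; exact: measurable_interior_states.
by apply: bigcup_measurable => n _; exact: measurable_dom_section.
Qed.

Hypothesis mE : measurable E.

Lemma regular_flow_forward : regular_flow phi E bd E0.
Proof.
have mE0 := measurable_interior_states.
have mphi := measurable_flow_total.
have segment x s : E x -> (0 <= s)%R -> s%:E <= tau x -> ~ bd x -> dom x s.
  move=> xE s0; rewrite le_eqVlt => /predU1P[/esym st xb|st _].
    by have [] := tau_fin xb st.
  exact: dom_before_tau.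
split => //.
- exact: measurable_active_boundary.
- by move=> x; left.
- exact: bd_not_inner.
- exact: flow0.
- by move=> x s xE s0 st; have [] := (before_tauP x s0).1 (conj xE st).
- move=> x s xE s0 st; have xb : ~ bd x.
    by move=> /tau_bd; rewrite st => -[/eqP]; rewrite gt_eqF.
  by have [] := tau_fin xb st.
- move=> x s xE s0 st; have xb : ~ bd x.
    by move=> /tau_bd xb; move: st; rewrite xb lee_fin leNgt s0.
  have [_ _ h _] := flow_segment (ltW s0) (segment _ _ xE (ltW s0) st xb).
  have ss : (0 <= s <= s)%R by rewrite lexx ltW.
  exact: cvg_trans (cvg_app _ (at_left_within s0 (lexx s))) (h _ ss).
- move=> x s xE s0 /tau_between[t st tt].
  have t0 := ltW (le_lt_trans s0 st).
  have [_ _ h _] := flow_segment t0 (dom_before_tau xE t0 tt).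
  have ss : (0 <= s <= t)%R by rewrite s0 ltW.
  exact: cvg_trans (cvg_app _ (at_right_within s0 st)) (h _ ss).
- move=> x s v xE s0 sv0 st svt.
  have [sv|vs] := leP s (s + v)%R.
    have [_ _ _ h] := flow_segment sv0 (dom_before_tau xE sv0 svt).
    by have [||_ ->] := h s v => //; rewrite ?s0 ?sv0 ?lexx.
  have [_ _ _ h] := flow_segment s0 (dom_before_tau xE s0 st).
  by have [||_ ->] := h s v => //; rewrite ?s0 ?sv0 ?lexx ?ltW.
- move=> b; rewrite le_eqVlt => /predU1P[<-|b0].
    rewrite (_ : [set _ | _] = E `\` bd).
      by apply: measurableD => //; exact: measurable_active_boundary.
    apply/seteqP; split=> x /= [xE h]; split => //.
      by move=> /tau_bd xb; rewrite xb ltxx in h.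
    exact: tau_gt0.
  rewrite (_ : [set _ | _] = (E `\` bd) `&` ([set x | dom x b] `&`
      (fun x => phi x b) @^-1` E0)).
    apply: measurableI.
      by apply: measurableD => //; exact: measurable_active_boundary.
    apply: measurableI; first exact: measurable_dom_section.
    have mb : measurable_fun setT (fun x => phi x b).
      exact: (measurableT_comp mphi (pair2_measurable b)).
    by rewrite -[X in measurable X]setTI; exact: mb.
  apply/seteqP; split=> x /=.
    by move=> /(before_tauP x b0)[].
  by move=> [[? ?] [? ?]]; apply/(before_tauP x b0).
- exact: tau_bd.
- exact: tau_gt0.
Qed.

End flow_theory.

Section reversed_flow.
Variables (R : realType) (k : nat) (dim : 'I_k.+1 -> nat).
Local Notation S := (state R dim).
Variable Eo : forall i, set 'rV[R]_(dim i).
Variable r : forall i, 'rV[R]_(dim i) -> 'rV[R]_(dim i).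

Let oppr_field i (y : 'rV[R]_(dim i)) := (- r y)%R.

Lemma reaches_oppE i (x z : 'rV[R]_(dim i)) t : (0 <= t)%R ->
  reaches Eo oppr_field x t z <-> reaches Eo r z t x.
Proof.
move=> t0; split; last exact: reaches_reverse.
move=> /(reaches_reverse t0).
rewrite (_ : (fun j (y : 'rV_(dim j)) => - oppr_field y)%R = r)//.
by apply: functional_extensionality_dep => j; apply/funext => y; rewrite /oppr_field opprK.
Qed.

Lemma flow_graph_opp i (x : 'rV[R]_(dim i)) t :
  flow_graph Eo oppr_field x t = flow_graph Eo r x (- t)%R.
Proof.
apply/funext => z; apply/propext; rewrite /flow_graph/=.
have [->|t0] := eqVneq t 0%R.
  rewrite oppr0 lexx reaches_oppE//.
  by split=> -[g [g0 gx _ _]]; (have -> : x = z by rewrite -g0 -gx);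
    exact: reaches0.
have [tp|tn] := leP 0%R t.
  rewrite oppr_ge0 leNgt lt_neqAle eq_sym t0 tp/= opprK.
  exact: reaches_oppE.
by rewrite oppr_ge0 (ltW tn) reaches_oppE// oppr_ge0 ltW.
Qed.

Lemma flow_opp (x : S) t : flow Eo oppr_field x t = flow Eo r x (- t)%R.
Proof. by rewrite /flow flow_graph_opp. Qed.

Lemma flow_defined_opp (x : S) t :
  flow_defined Eo oppr_field x t = flow_defined Eo r x (- t)%R.
Proof. by rewrite /flow_defined/= flow_graph_opp. Qed.

Lemma active_boundary_opp :
  active_boundary Eo oppr_field = passive_boundary Eo r.
Proof.
congr (_ `&` _); apply/seteqP; split=> z [x [t [x0 t0 ->]]]; exists x, t;
  by rewrite flow_opp.
Qed.

Lemma passive_boundary_opp :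
  passive_boundary Eo oppr_field = active_boundary Eo r.
Proof.
congr (_ `&` _); apply/seteqP; split=> z [x [t [x0 t0 ->]]]; exists x, t;
  by rewrite flow_opp opprK.
Qed.

Hypothesis hflow : flow_setting Eo r.

Let fwd_opp i (x z z' : 'rV[R]_(dim i)) t : (0 <= t)%R ->
  reaches Eo oppr_field x t z -> reaches Eo oppr_field x t z' -> z = z'.
Proof.
move=> t0 /(reaches_oppE _ _ t0) + /(reaches_oppE _ _ t0).
exact: fs_unique_bwd.
Qed.

Let bwd_opp i (x x' z : 'rV[R]_(dim i)) t : (0 <= t)%R ->
  reaches Eo oppr_field x t z -> reaches Eo oppr_field x' t z -> x = x'.
Proof.
move=> t0 /(reaches_oppE _ _ t0) + /(reaches_oppE _ _ t0).
exact: fs_unique_fwd.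
Qed.

Let mopp : measurable_fun setT (fun z : S * R => (z.1, - z.2)%R).
Proof.
apply/measurable_fun_pairP; split => /=.
  by rewrite [X in measurable_fun _ X](_ : _ = fst).
rewrite [X in measurable_fun _ X](_ : _ = (-%R \o snd))//.
exact: measurableT_comp.
Qed.

Let mdom_opp :
  measurable [set z : S * R | flow_defined Eo oppr_field z.1 z.2].
Proof.
have := mopp measurableT (fs_measurable_dom hflow); rewrite setTI.
by congr measurable; apply/seteqP; split=> z /=; rewrite flow_defined_opp.
Qed.

Let mflow_opp :
  measurable_fun [set z : S * R | flow_defined Eo oppr_field z.1 z.2]
    (fun z => flow Eo oppr_field z.1 z.2).
Proof.
move=> mD Y mY.
have := mopp measurableT (fs_measurable_flow hflow (fs_measurable_dom hflow) mY).
rewrite setTI; congr measurable; apply/seteqP; split=> z /=.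
  by rewrite flow_defined_opp flow_opp.
by rewrite flow_defined_opp flow_opp.
Qed.

Lemma measurable_passive_boundary : measurable (passive_boundary Eo r).
Proof.
rewrite -active_boundary_opp; apply: measurable_active_boundary.
- exact: fs_open hflow.
- exact: fwd_opp.
- exact: bwd_opp.
- exact: mdom_opp.
Qed.

Lemma measurable_active_boundary' : measurable (active_boundary Eo r).
Proof.
apply: measurable_active_boundary.
- exact: fs_open hflow.
- exact: fs_unique_fwd hflow.
- exact: fs_unique_bwd hflow.
- exact: fs_measurable_dom hflow.
Qed.

Let mE0 : measurable (interior_states Eo).
Proof. by exact: measurable_interior_states (fs_open hflow). Qed.

Lemma regular_flow_states : regular_flow (flow Eo r) (states Eo r)
  (active_boundary Eo r) (interior_states Eo).
Proof.
apply: regular_flow_forward.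
- exact: fs_open hflow.
- exact: fs_unique_fwd hflow.
- exact: fs_unique_bwd hflow.
- exact: fs_forward hflow.
- exact: fs_measurable_dom hflow.
- exact: fs_measurable_flow hflow.
by apply: measurableU => //; exact: measurable_passive_boundary.
Qed.

(** The reversed flow has vector field [- r], for which the two boundaries are
    exchanged; the forward statements apply to it. *)
Lemma regular_flow_reversed : regular_flow (fun x t => flow Eo r x (- t)%R)
  (reversed_states Eo r) (passive_boundary Eo r) (interior_states Eo).
Proof.
have -> : (fun x t => flow Eo r x (- t)%R) = flow Eo oppr_field.
  by apply/funext => x; apply/funext => t; rewrite flow_opp.
have <- : states Eo oppr_field = reversed_states Eo r.
  by rewrite /states passive_boundary_opp.
rewrite -active_boundary_opp; apply: regular_flow_forward.
- exact: fs_open hflow.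
- exact: fwd_opp.
- exact: bwd_opp.
- rewrite /states passive_boundary_opp => x /(fs_backward hflow)[h|[t t0 xt]].
    by left=> t t0; rewrite flow_defined_opp; exact: h.
  by right; exists t => //; rewrite active_boundary_opp flow_opp.
- exact: mdom_opp.
- exact: mflow_opp.
- rewrite /states passive_boundary_opp; apply: measurableU => //.
  exact: measurable_active_boundary'.
Qed.

End reversed_flow.

(** * A countable base of the state space *)

Section countable_base.
Context (R : realType) (k : nat) (dim : 'I_k.+1 -> nat).
Local Notation S := (state R dim).

(** Balls with rational centre and radius [1 / n] form a countable base, which also
    generates the sigma-algebra and separates points. *)
Definition rational_ball (b : {i : 'I_k.+1 & ('rV[rat]_(dim i) * nat)%type}) : set S :=
  (fun y => existT _ (projT1 b) y : S) @`
    ball (map_mx (@ratr R) (projT2 b).1) ((projT2 b).2.+1%:R^-1)%R.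

Definition state_base (n : nat) : set S :=
  if @unpickle {i : 'I_k.+1 & ('rV[rat]_(dim i) * nat)%type} n is Some b
  then rational_ball b else set0.

Lemma state_base_open n : open (state_base n).
Proof.
rewrite /state_base; case: unpickle => [b|]; last exact: open0.
by apply: existT_open_map; apply: ball_open; rewrite invr_gt0.
Qed.

Lemma state_baseP (U : set S) x : open U -> U x ->
  exists2 n, state_base n x & state_base n `<=` U.
Proof.
case: x => i x /state_openP/(_ i) oU Ux.
have := open_nbhs_nbhs (conj oU Ux) => /nbhs_ballP[e /= e0 xeU].
pose n := Num.truncn (2 / e)%R.
have n0 : (0 < n.+1%:R^-1 :> R)%R by rewrite invr_gt0.
have ne : (n.+1%:R^-1 + n.+1%:R^-1 <= e)%R.
  have h : (2 < n.+1%:R * e)%R by rewrite -ltr_pdivrMr//; exact: truncnS_gt.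
  rewrite (_ : (_ + _ = 2 / n.+1%:R)%R); last by field.
  by rewrite ler_pdivrMr// mulrC ltW.
have qP (j : 'I_(dim i)) : exists q : rat, ball (ratr q : R) (n.+1%:R^-1)%R (x ord0 j).
  have [|q] := @rat_in_itvoo R (x ord0 j - n.+1%:R^-1)%R (x ord0 j + n.+1%:R^-1)%R.
    by rewrite ltrBlDr -addrA ltrDl addr_gt0.
  rewrite in_itv/= => /andP[h1 h2]; exists q.
  rewrite -ball_normE/= ltr_distlC; set a := (n.+1%:R^-1)%R in h1 h2 *. by apply/andP; split=> //; lra.
pose q : 'rV[rat]_(dim i) := \row_j projT1 (cid (qP j)).
have qx : ball (map_mx (@ratr R) q) (n.+1%:R^-1)%R x.
  split => // a j; rewrite !mxE (ord1 a).
  exact: (projT2 (cid (qP j))).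
exists (pickle (existT (fun i => 'rV[rat]_(dim i) * nat)%type i (q, n))).
  by rewrite /state_base pickleK; exists x.
rewrite /state_base pickleK => z [y /= qy <-]; apply: xeU => /=.
by apply: le_ball ne _ _; apply: ball_triangle qy; exact: ball_sym.
Qed.

Lemma measurable_state_base n : measurable (state_base n).
Proof. by apply: measurable_state_open; exact: state_base_open. Qed.

Lemma measurable_state_generated : @measurable _ S = <<s range state_base >>.
Proof.
apply/seteqP; split; last first.
  apply: smallest_sub; first exact: sigma_algebra_measurable.
  by move=> _ [n _ <-]; exact: measurable_state_base.
apply: smallest_sub; first exact: smallest_sigma_algebra.
move=> U oU.
rewrite (_ : U = \bigcup_n (state_base n `&` [set _ | state_base n `<=` U])).
  apply: sigma_algebra_bigcup => n.
  have [nU|nU] := pselect (state_base n `<=` U).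
    rewrite (_ : _ `&` _ = state_base n); first by apply: sub_sigma_algebra; exists n.
    by apply/seteqP; split=> [z []|z].
  rewrite (_ : _ `&` _ = set0); first exact: sigma_algebra0.
  by apply/seteqP; split=> [z []|z].
apply/seteqP; split=> [x Ux|x [n _ [nx nU]]]; last exact: nU.
by have [n nx nU] := state_baseP oU Ux; exists n.
Qed.

Lemma state_base_separates x y : x <> y ->
  exists2 n, state_base n x & ~ state_base n y.
Proof.
move=> /eqP xy; have := @state_hausdorff R k dim.
rewrite open_hausdorff => /(_ _ _ xy)[[U V] /= [/set_mem xU /set_mem yV] [oU oV /eqP/seteqP[UV _]]].
have [n nx nU] := state_baseP oU xU.
by exists n => // /nU Uy; apply: (UV y).
Qed.

Lemma measurable_diagonal : measurable [set z : S * S | z.1 = z.2].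
Proof.
rewrite -[X in measurable X]setCK; apply: measurableC.
rewrite (_ : ~` _ = \bigcup_n (state_base n `*` ~` state_base n)); last first.
  apply/seteqP; split=> -[x y] /=.
    by move=> /state_base_separates[n nx ny]; exists n.
  by move=> [n _ [/= nx ny]] xy; rewrite xy in nx.
apply: bigcup_measurable => n _; apply: measurableX.
  exact: measurable_state_base.
by apply: measurableC; exact: measurable_state_base.
Qed.

End countable_base.

(** * Waiting times and survival *)

Definition rat_seq (R : realType) (k : nat) : R := ratr (odflt 0%R (unpickle k)).

Lemma rat_seq_dense (R : realType) (a b : R) : (a < b)%R ->
  exists k, (a < rat_seq R k < b)%R.
Proof.
move=> /rat_in_itvoo[q]; rewrite in_itv/= => qab.
by exists (pickle q); rewrite /rat_seq pickleK.
Qed.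

Section skeleton.
Context (R : realType) (k : nat) (dim : 'I_k.+1 -> nat).
Local Notation S := (state R dim).
Context d (Omega : measurableType d) (P : probability Omega R).
Variables (c : pdmp_data R dim) (inner : set S) (H : \bar R).
Variables (X : R -> Omega -> S) (T : nat -> Omega -> \bar R)
  (Q : nat -> Omega -> S).
Hypothesis rf : regular_flow (pd_flow c) (pd_space c) (pd_boundary c) inner.
Hypothesis wf : pdmp_data_wf c.
Hypothesis hX : is_pdmp P c H X T Q.

Local Notation phi := (pd_flow c).
Local Notation E := (pd_space c).
Local Notation bd := (pd_boundary c).
Local Notation tau := (hitting_time (pd_flow c) (pd_boundary c)).
Local Notation leb := (@lebesgue_measure R).

Definition rate0 : S -> R := (pd_rate c) \_ E.

Lemma measurable_rate0 : measurable_fun setT rate0.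
Proof.
apply/(measurable_restrictT _ (rf_mspace rf)).
exact: wf_measurable_rate.
Qed.

Lemma rate0_ge0 x : (0 <= rate0 x)%R.
Proof.
by rewrite /rate0 patchE; case: ifPn => // /set_mem; exact: wf_rate_ge0.
Qed.

Lemma measurable_rate0_flow :
  measurable_fun setT (fun z : S * R => rate0 (phi z.1 z.2)).
Proof. exact: (measurableT_comp measurable_rate0 (rf_measurable rf)). Qed.

Definition hazard x t := \int[leb]_(s in `[0%R, t]) (rate0 (phi x s))%:E.

Lemma hazard_ge0 x t : 0 <= hazard x t.
Proof. by apply: integral_ge0 => s _; rewrite lee_fin rate0_ge0. Qed.

Lemma measurable_hazard2 :
  measurable_fun setT (fun z : S * R => hazard z.1 z.2).
Proof.
pose g (z : S * R * R) : \bar R := (rate0 (phi z.1.1 z.2))%:E *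
  (\1_[set y : S * R * R | (0 <= y.2 <= y.1.2)%R] z)%:E.
have -> : (fun z : S * R => hazard z.1 z.2) = (fun z => \int[leb]_s g (z, s)).
  apply/funext => z; rewrite /hazard integral_mkcond; apply: eq_integral => s _.
  rewrite patchE /g indicE/= mem_setE in_itv/=.
  have -> : ((z, s) \in [set y : S * R * R | (0 <= y.2 <= y.1.2)%R]) = (0 <= s <= z.2)%R.
    by apply/idP/idP => [/set_mem//|su]; exact/mem_set.
  by case: ifP => _; rewrite ?mule1 ?mule0.
have m2 : measurable_fun setT (fun z : S * R * R => z.2) by exact: measurable_snd.
have m11 : measurable_fun setT (fun z : S * R * R => z.1.1).
  exact: (measurableT_comp measurable_fst measurable_fst).
have m12 : measurable_fun setT (fun z : S * R * R => z.1.2).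
  exact: (measurableT_comp measurable_snd measurable_fst).
apply: measurable_fun_fubini_tonelli_F => //.
  apply: emeasurable_funM; apply/measurable_EFinP.
    exact: (measurableT_comp measurable_rate0_flow (measurable_fun_pair m11 m2)).
  apply: measurable_indic; apply: measurable_bool_set.
  by apply: measurable_and; exact: measurable_fun_ler.
by move=> z; rewrite /g mule_ge0// lee_fin ?rate0_ge0.
Qed.

Lemma measurable_hazard t : measurable_fun setT (hazard ^~ t).
Proof. exact: (measurableT_comp measurable_hazard2 (pair2_measurable t)). Qed.

Lemma flow_space x s : E x -> (0 <= s)%R -> s%:E < tau x -> E (phi x s).
Proof.
move=> xE; rewrite le_eqVlt => /predU1P[<- _|s0 st]; first by rewrite (rf_0 rf).
exact/(rf_sub rf)/(rf_inner rf).
Qed.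

Lemma survivalE x t : E x -> (0 <= t)%R ->
  survival c x t = if t%:E < tau x then expeR (- hazard x t) else 0.
Proof.
move=> xE t0; rewrite /survival; case: ifPn => // tt; congr (expeR (- _)).
apply: eq_integral => s; rewrite inE/= in_itv/= => /andP[s0 st].
rewrite /rate0 patchE mem_set//; apply: flow_space => //.
by apply: le_lt_trans tt; rewrite lee_fin.
Qed.

(** A trajectory can only survive until time [t] if neither a forced jump nor an
    infinite hazard comes before. *)
Definition viable t := [set x | [/\ E x, t%:E < tau x & hazard x t < +oo]].

Lemma measurable_viable t : (0 <= t)%R -> measurable (viable t).
Proof.
move=> t0; rewrite (_ : viable t = [set x | E x /\ t%:E < tau x] `&`
    [set x | hazard x t < +oo]); last first.
  by apply/seteqP; split=> x [] => [? ? ?|[? ?] ?].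
apply: measurableI; first exact: (rf_mtau rf t0).
rewrite -[X in measurable X]setTI.
exact: measurable_lte (measurable_hazard t) (measurable_cst _).
Qed.

Lemma viable_survival x t : (0 <= t)%R -> viable t x ->
  survival c x t = expeR (- hazard x t).
Proof. by move=> t0 [xE tt _]; rewrite survivalE// tt. Qed.

Let hsk := ip_skeleton hX.

Let mT n : measurable_fun setT (T n). Proof. exact: sk_measurable_time hsk n. Qed.
Let mQ n : measurable_fun setT (Q n). Proof. exact: sk_measurable_state hsk n. Qed.

Lemma history_last (n : nat) (A : set S) (B : set (\bar R)) :
  history T Q (fun j => if j == n then A else setT)
    (fun j => if j == n then B else setT) n = [set w | A (Q n w) /\ B (T n w)].
Proof.
apply/seteqP; split=> w /=; first by move=> /(_ n (leqnn n)); rewrite eqxx.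
by move=> h j _; case: eqP => [->|].
Qed.

Lemma waiting n A B (t : R) : measurable A -> measurable B -> (0 <= t)%R ->
  P [set w | [/\ A (Q n w), B (T n w), T n w + t%:E < H &
                 T n w + t%:E < T n.+1 w]] =
  \int[P]_(w in [set w | [/\ A (Q n w), B (T n w) & T n w + t%:E < H]])
     survival c (Q n w) t.
Proof.
move=> mA mB t0.
have := @sk_waiting _ _ _ _ _ _ _ _ _ _ hsk n (fun j => if j == n then A else setT)
  (fun j => if j == n then B else setT) t.
rewrite history_last => h.
rewrite (_ : [set w | [/\ A (Q n w), B (T n w) & _]] =
  [set w | A (Q n w) /\ B (T n w)] `&` [set w | T n w + t%:E < H]); last first.
  by apply/seteqP; split=> w [] => [? ? ?|[? ?] ?].
rewrite -h//; last 2 first.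
- by move=> j; case: ifP.
- by move=> j; case: ifP.
by congr (P _); apply/seteqP; split=> w [] => [? ? ? ?|[? ?] [? ?]].
Qed.

Let mpre d2 (U : measurableType d2) (f : Omega -> U) (A : set U) :
  measurable_fun setT f -> measurable A -> measurable (f @^-1` A).
Proof. by move=> mf mA; rewrite -[X in measurable X]setTI; exact: mf. Qed.

Lemma survives_viable n t : (0 <= t)%R ->
  {ae P, forall w, E (Q n w) -> T n w + t%:E < H -> T n w + t%:E < T n.+1 w ->
    viable t (Q n w)}.
Proof.
move=> t0; have mE := rf_mspace rf.
have mV : measurable (E `\` viable t).
  by apply: measurableD => //; exact: measurable_viable.
have mTt : measurable_fun setT (fun w => T n w + t%:E).
  by apply: emeasurable_funD.
exists [set w | [/\ (E `\` viable t) (Q n w), setT (T n w), T n w + t%:E < H &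
                 T n w + t%:E < T n.+1 w]]; split.
- rewrite (_ : [set w | _] = (Q n @^-1` (E `\` viable t)) `&`
    (setT `&` [set w | T n w + t%:E < H]) `&`
    (setT `&` [set w | T n w + t%:E < T n.+1 w])); last first.
    by apply/seteqP; split=> w [] => [? ? ? ?|[? [? ?]] [? ?]].
  apply: measurableI; first apply: measurableI.
  + exact: mpre.
  + exact: measurable_lte mTt (measurable_cst _).
  + exact: measurable_lte mTt (mT _).
- rewrite waiting//; apply: integral0_eq => w [[QE Qv] _ _].
  rewrite survivalE//; case: ifPn => // tt.
  suff -> : hazard (Q n w) t = +oo by [].
  have := hazard_ge0 (Q n w) t; case hE : (hazard _ _) => [u| |]// _.
  by exfalso; apply: Qv; split => //; rewrite hE ltry.
- move=> w /= /not_implyP[QE /not_implyP[TH /not_implyP[TT nv]]].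
  by split.
Qed.

(** Only rational times are quantified over, so that this holds almost surely. *)
Definition survives w := forall n, E (Q n w) ->
  forall j, (0 <= rat_seq R j)%R -> T n w + (rat_seq R j)%:E < H ->
  T n w + (rat_seq R j)%:E < T n.+1 w -> viable (rat_seq R j) (Q n w).

Lemma ae_survives : {ae P, forall w, survives w}.
Proof.
apply: ae_foralln => n.
have : {ae P, forall w j, (0 <= rat_seq R j)%R -> E (Q n w) ->
  T n w + (rat_seq R j)%:E < H -> T n w + (rat_seq R j)%:E < T n.+1 w ->
  viable (rat_seq R j) (Q n w)}.
  apply: ae_foralln => j.
  have [j0|j0] := leP 0%R (rat_seq R j); last first.
    by apply: aeW.
  by apply: filterS (survives_viable n j0) => w h _; exact: h.
by apply: filterS => w h QE j j0; exact: h.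
Qed.

Definition proper_path w := [/\ T 0%N w = 0, E (Q 0%N w),
  forall n, T n w <= T n.+1 w /\ (T n w < H \/ T n w = +oo) & survives w].

Lemma ae_proper : {ae P, forall w, proper_path w}.
Proof.
apply: filterS3 (sk_start hsk) (sk_order hsk) ae_survives => w [? ?] ? ?.
by split.
Qed.

Lemma proper_ge0 w n : proper_path w -> 0 <= T n w.
Proof.
move=> [T0 _ TS _]; elim: n => [|n ih]; first by rewrite T0.
by apply: le_trans ih _; have [] := TS n.
Qed.

Lemma proper_fin w n : proper_path w -> T n w < H -> T n w = (fine (T n w))%:E.
Proof.
move=> pw TH; rewrite fineK// ge0_fin_numE ?proper_ge0//.
by rewrite (lt_le_trans TH)// leey.
Qed.

Lemma between_ereal (u : R) (a b : \bar R) : u%:E < a -> u%:E < b ->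
  exists2 v : R, (u < v)%R & v%:E < a /\ v%:E < b.
Proof.
move=> ua ub; have : u%:E < Order.min a b by rewrite lt_min ua.
case mE : (Order.min a b) => [m| |//].
  rewrite lte_fin => um; exists ((u + m) / 2)%R; first by rewrite midf_lt.
  have : ((u + m) / 2)%:E < Order.min a b by rewrite mE lte_fin midf_lt.
  by rewrite lt_min => /andP[].
move=> _; exists (u + 1)%R; first by rewrite ltrDl.
have : (u + 1)%:E < Order.min a b by rewrite mE ltry.
by rewrite lt_min => /andP[].
Qed.

(** The next jump is strictly later, which leaves room for a slightly longer,
    rational, waiting time; surviving that one bounds the hazard beyond [t]. *)
Lemma survives_later w n t (h : \bar R) : h <= H -> proper_path w -> E (Q n w) ->
  T n w < H -> (0 <= t)%R -> T n w + t%:E < h -> T n w + t%:E < T n.+1 w ->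
  exists j, [/\ (t < rat_seq R j)%R, T n w + (rat_seq R j)%:E < h,
    T n w + (rat_seq R j)%:E < T n.+1 w & viable (rat_seq R j) (Q n w)].
Proof.
move=> hH pw QE TH t0; rewrite (proper_fin pw TH) -EFinD => tH tT.
have [v tv [vH vT]] := between_ereal tH tT.
have [|j /andP[tj jv]] := @rat_seq_dense R t (v - fine (T n w))%R.
  by rewrite ltrBrDl.
have jH : (fine (T n w) + rat_seq R j)%:E < h.
  by apply: lt_trans vH; rewrite lte_fin -ltrBrDl.
have jT : (fine (T n w) + rat_seq R j)%:E < T n.+1 w.
  by apply: lt_trans vT; rewrite lte_fin -ltrBrDl.
exists j; split => //.
case: (pw) => _ _ _ sw; apply: sw => //.
- by rewrite ltW// (le_lt_trans t0).
- by rewrite (proper_fin pw TH) (lt_le_trans jH).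
- by rewrite (proper_fin pw TH).
Qed.

Lemma waiting_before_exit w n t : proper_path w -> E (Q n w) -> T n w < H ->
  (0 <= t)%R -> T n w + t%:E < H -> T n w + t%:E < T n.+1 w ->
  t%:E < tau (Q n w).
Proof.
move=> pw QE TH t0 tH tT.
have [j [tj _ _ [_ jt _]]] := survives_later (lexx H) pw QE TH t0 tH tT.
by apply: lt_trans jt; rewrite lte_fin.
Qed.

Definition wait n w := fine (T n.+1 w - T n w).
Definition prejump n w := phi (Q n w) (wait n w).

Lemma measurable_wait n : measurable_fun setT (wait n).
Proof.
apply: measurableT_comp; first exact: fine_measurable.
by apply: emeasurable_funB.
Qed.

Lemma measurable_prejump n : measurable_fun setT (prejump n).
Proof.
apply: (measurableT_comp (rf_measurable rf) (g := fun w => (Q n w, wait n w))).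
exact: measurable_fun_pair (mQ n) (measurable_wait n).
Qed.

Lemma waitE w n : proper_path w -> T n.+1 w < H ->
  [/\ T n w < H, (0 <= wait n w)%R & T n.+1 w = T n w + (wait n w)%:E].
Proof.
move=> pw TH; have TH' : T n w < H.
  by case: (pw) => _ _ /(_ n)[h _] _; exact: le_lt_trans h TH.
have TT : T n w <= T n.+1 w by case: (pw) => _ _ /(_ n)[].
split => //.
  move: TT; rewrite /wait (proper_fin pw TH) (proper_fin pw TH').
  by rewrite -EFinB/= lee_fin subr_ge0.
rewrite /wait (proper_fin pw TH) (proper_fin pw TH') -EFinB/= -EFinD.
by congr (_%:E); ring.
Qed.

Lemma wait_le_exit w n : proper_path w -> E (Q n w) -> T n.+1 w < H ->
  (wait n w)%:E <= tau (Q n w).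
Proof.
move=> pw QE TH; have [TH' w0 TE] := waitE pw TH.
rewrite leNgt; apply/negP => tw.
have t0 : 0 <= tau (Q n w).
  have [/(rf_bd0 rf) ->//|/(rf_pos rf)/ltW//] := pselect (bd (Q n w)).
have tf : tau (Q n w) = (fine (tau (Q n w)))%:E.
  by rewrite fineK// ge0_fin_numE// (lt_trans tw)// ltry.
have : (fine (tau (Q n w)))%:E < tau (Q n w).
  apply: (waiting_before_exit pw) => //.
  - by rewrite fine_ge0.
  - by rewrite -tf (lt_trans _ TH)// TE lteD2lE// (proper_fin pw TH').
  - by rewrite -tf TE lteD2lE// (proper_fin pw TH').
by rewrite -tf ltxx.
Qed.

Lemma prejump_space w n : proper_path w -> E (Q n w) -> T n.+1 w < H ->
  (E `|` bd) (prejump n w).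
Proof.
move=> pw QE TH; have := wait_le_exit pw QE TH.
have [_ + _] := waitE pw TH; rewrite le_eqVlt => /predU1P[w0 _|w0].
  by left; rewrite /prejump -w0 (rf_0 rf).
rewrite le_eqVlt => /predU1P[/esym wt|wt].
  by right; exact: (rf_exit rf).
by left; apply/(rf_sub rf)/(rf_inner rf).
Qed.

Lemma ae_postjump_space n : {ae P, forall w, T n w < H -> E (Q n w)}.
Proof.
elim: n => [|n ih].
  by apply: filterS (sk_start hsk) => w [].
have mE := rf_mspace rf.
have mEc : measurable (~` E) by exact: measurableC.
pose N := [set w | [/\ T n.+1 w < H, setT (T n.+1 w) & (~` E) (Q n.+1 w)]].
have mN : measurable N.
  rewrite (_ : N = (setT `&` [set w | T n.+1 w < H]) `&` (Q n.+1 @^-1` (~` E))).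
    apply: measurableI; last exact: mpre.
    exact: measurable_lte (mT _) (measurable_cst _).
  by apply/seteqP; split=> w [] => [? ? ?|[? ?] ?].
exists N; split => //; last first.
  by move=> w /= /not_implyP[].
have := @sk_jump _ _ _ _ _ _ _ _ _ _ hsk n (fun=> setT) (fun=> setT) setT (~` E).
have -> : history T Q (fun=> setT) (fun=> setT) n = setT.
  by apply/seteqP; split.
rewrite !setTI => h.
rewrite (_ : N = [set w | [/\ T n.+1 w < H, setT (T n.+1 w) & (~` E) (Q n.+1 w)]])//.
rewrite h//; apply: ge0_integral_ae0.
- rewrite (_ : [set w | _] = setT `&` [set w | T n.+1 w < H]).
    exact: measurable_lte (mT _) (measurable_cst _).
  by apply/seteqP; split=> w [].
- apply: measurable_funTS.
  exact: (measurableT_comp (measurable_kernel (pd_jump c) _ mEc) (measurable_prejump n)).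
- by [].
- apply: filterS2 ae_proper ih => w pw QE [TH _].
  have [TH' _ _] := waitE pw TH.
  exact: prob_kernel_setC mE (wf_jump wf (prejump_space pw (QE TH') TH)).
Qed.

End skeleton.

(** * Jumps and paths *)

Section jumps.
Context (R : realType) (k : nat) (dim : 'I_k.+1 -> nat).
Local Notation S := (state R dim).
Context d (Omega : measurableType d) (P : probability Omega R).
Variables (c : pdmp_data R dim) (inner : set S) (H : \bar R).
Variables (X : R -> Omega -> S) (T : nat -> Omega -> \bar R)
  (Q : nat -> Omega -> S).
Hypothesis rf : regular_flow (pd_flow c) (pd_space c) (pd_boundary c) inner.
Hypothesis wf : pdmp_data_wf c.
Hypothesis hX : is_pdmp P c H X T Q.
Variable h : R.
Hypothesis hH : h%:E <= H.

Local Notation phi := (pd_flow c).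
Local Notation E := (pd_space c).
Local Notation bd := (pd_boundary c).
Local Notation tau := (hitting_time (pd_flow c) (pd_boundary c)).
Local Notation leb := (@lebesgue_measure R).
Local Notation K := (pd_jump c).
Local Notation Y := (prejump c T Q).
Local Notation proper_path := (proper_path c H T Q).

Let hsk := ip_skeleton hX.
Let mT n : measurable_fun setT (T n). Proof. exact: sk_measurable_time hsk n. Qed.
Let mQ n : measurable_fun setT (Q n). Proof. exact: sk_measurable_state hsk n. Qed.
Let mY n : measurable_fun setT (Y n). Proof. exact: measurable_prejump rf hX n. Qed.
Let mpre d2 (U : measurableType d2) (f : Omega -> U) (A : set U) :
  measurable_fun setT f -> measurable A -> measurable (f @^-1` A).
Proof. by move=> mf mA; rewrite -[X in measurable X]setTI; exact: mf. Qed.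

(** Jumps at time [0] are left out: they are possible for a process that starts
    on its active boundary, and have no counterpart when time is reversed. *)
Definition jump_in n := [set w | 0 < T n.+1 w /\ T n.+1 w < h%:E].

Lemma measurable_jump_in n : measurable (jump_in n).
Proof.
rewrite (_ : jump_in n = (setT `&` [set w | 0 < T n.+1 w]) `&`
    (setT `&` [set w | T n.+1 w < h%:E])).
  apply: measurableI; first exact: measurable_lte (measurable_cst _) (mT _).
  exact: measurable_lte (mT _) (measurable_cst _).
by apply/seteqP; split=> w [] => [? ?|[? ?] [? ?]]; do ?split.
Qed.

Let zeta n w := (Q n w, T n w, T n.+1 w).
Let mzeta n : measurable_fun setT (zeta n).
Proof. by apply: measurable_fun_pair => //; exact: measurable_fun_pair. Qed.

Lemma measurable_prejump_kernel n (B : set S) : measurable B ->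
  measurable_fun setT (fun w => fine (K (Y n w) B)).
Proof.
move=> mB; apply: measurableT_comp; first exact: fine_measurable.
exact: (measurableT_comp (measurable_kernel K _ mB) (mY n)).
Qed.

Lemma kernel_fine x (B : set S) : measurable B -> K x B = (fine (K x B))%:E.
Proof.
move=> mB; rewrite fineK// ge0_fin_numE//.
apply: (@le_lt_trans _ _ (K x setT)); first by apply: le_measure; rewrite ?inE.
by rewrite prob_kernel ltry.
Qed.

Lemma jump_kernel n (A B : set S) : measurable A -> measurable B ->
  P (jump_in n `&` [set w | A (Y n w) /\ B (Q n.+1 w)]) =
  \int[P]_(w in jump_in n `&` Y n @^-1` A) K (Y n w) B.
Proof.
move=> mA mB.
pose E1 := [set w | T n.+1 w < H /\ B (Q n.+1 w)].
pose E2 := [set w | T n.+1 w < H].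
have mE2 : measurable E2.
  rewrite (_ : E2 = setT `&` [set w | T n.+1 w < H]); last by rewrite setTI.
  exact: measurable_lte (mT _) (measurable_cst _).
have mE1 : measurable E1.
  by rewrite (_ : E1 = E2 `&` Q n.+1 @^-1` B)//; apply: measurableI => //; exact: mpre.
have mf1 : measurable_fun setT ((fun=> 1%R : R) \_ E1).
  by apply: measurable_restrict_setT.
have mf2 : measurable_fun setT ((fun w => fine (K (Y n w) B)) \_ E2).
  by apply: measurable_restrict_setT => //; exact: measurable_prejump_kernel.
have f01 : forall x, (0 <= ((fun=> 1%R : R) \_ E1) x)%R by apply: restrict_ge0.
have f02 : forall x, (0 <= ((fun w => fine (K (Y n w) B)) \_ E2) x)%R.
  by apply: restrict_ge0 => w; rewrite fine_ge0.
pose Z := [set z : S * \bar R * \bar R | [/\ 0 < z.2, z.2 < h%:E &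
   A (phi z.1.1 (fine (z.2 - z.1.2)))]].
have mZ : measurable Z.
  have m2 : measurable_fun setT (fun z : S * \bar R * \bar R => z.2).
    exact: measurable_snd.
  have m11 : measurable_fun setT (fun z : S * \bar R * \bar R => z.1.1).
    exact: (measurableT_comp measurable_fst measurable_fst).
  have m12 : measurable_fun setT (fun z : S * \bar R * \bar R => z.1.2).
    exact: (measurableT_comp measurable_snd measurable_fst).
  rewrite (_ : Z = (setT `&` [set z | 0 < z.2]) `&` (setT `&` [set z | z.2 < h%:E]) `&`
     ((fun z => phi z.1.1 (fine (z.2 - z.1.2))) @^-1` A)); last first.
    by apply/seteqP; split=> z [] => [? ? ?|[[? ?] [? ?]] ?]; do ?split.
  apply: measurableI; first apply: measurableI.
  - exact: measurable_lte (measurable_cst _) m2.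
  - exact: measurable_lte m2 (measurable_cst _).
  - rewrite -[X in measurable X]setTI.
    have mm : measurable_fun setT (fun z : S * \bar R * \bar R =>
        (z.1.1, fine (z.2 - z.1.2))).
      apply: measurable_fun_pair => //.
      apply: measurableT_comp; first exact: fine_measurable.
      exact: emeasurable_funB.
    exact: (measurableT_comp (rf_measurable rf) mm).
have e1 A' : measurable A' -> weighted_law P mf1 f01 (mzeta n) A' =
    P (zeta n @^-1` A' `&` E1).
  move=> mA'; rewrite weighted_law_restrict integral_cst ?mul1e//.
  by apply: measurableI => //; exact: mpre.
transitivity (weighted_law P mf1 f01 (mzeta n) Z).
  rewrite e1//; congr (P _); apply/seteqP; split=> w.
    move=> [[T0 Th] [AY BQ]]; split; first by split.
    by split => //; exact: lt_le_trans hH.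
  by move=> [[? ? ?] [? ?]]; split; split.
transitivity (weighted_law P mf2 f02 (mzeta n) Z); last first.
  rewrite weighted_law_restrict; under eq_integral do rewrite -kernel_fine//.
  congr (integral _ _ _); apply/seteqP; split=> w.
    by move=> [[? ? ?] ?]; split; first split.
  move=> [[T0 Th] AY]; split; first by split.
  exact: lt_le_trans hH.
apply: measure_prod3_unique mZ => /=.
- move=> A' B' C' mA' mB' mC'; rewrite e1; last first.
    by do 2?apply: measurableX.
  rewrite weighted_law_restrict; under eq_integral do rewrite -kernel_fine//.
  have := @sk_jump _ _ _ _ _ _ _ _ _ _ hsk n (fun j => if j == n then A' else setT)
    (fun j => if j == n then B' else setT) C' B.
  rewrite history_last => hj.
  transitivity (P ([set w | A' (Q n w) /\ B' (T n w)] `&`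
     [set w | [/\ T n.+1 w < H, C' (T n.+1 w) & B (Q n.+1 w)]])).
    congr (P _); apply/seteqP; split=> w.
      by move=> [[[? ?] ?] [? ?]]; split; split.
    by move=> [[? ?] [? ? ?]]; split; split.
  rewrite hj//; last 2 first.
  + by move=> j; case: ifP.
  + by move=> j; case: ifP.
  congr (integral _ _ _); apply/seteqP; split=> w.
    by move=> [[? ?] [? ?]]; split; first split.
  by move=> [[[? ?] ?] ?]; split; split.
- rewrite e1//; apply: le_lt_trans (probability_le1 P _) _; last exact: ltry.
  by apply: measurableI => //; exact: mpre.
Qed.

Hypothesis nsj : no_self_jump c.

Lemma kernel_set1 x : (E `|` bd) x -> K x [set x] = 0.
Proof.
move=> xEb; have [xE|nxE] := pselect (E x); first exact: nsj.
have mE := rf_mspace rf.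
have : K x (~` E) = 0 by apply: prob_kernel_setC => //; exact: wf_jump.
move=> KE; apply/eqP; rewrite -measure_le0 -KE; apply: le_measure.
- rewrite inE (_ : [set x] = xsection [set z : S * S | z.1 = z.2] x).
    by apply: measurable_xsection; exact: measurable_diagonal.
  by apply/seteqP; split=> y; rewrite /xsection/= inE/=.
- by rewrite inE; exact: measurableC.
- by move=> y /= ->.
Qed.

(** Conditionally on the state before the jump, the new state has an atom-free
    law at that state, so the path is really discontinuous at its jumps. *)
Lemma ae_genuine_jump n : {ae P, forall w, jump_in n w -> Q n.+1 w <> Y n w}.
Proof.
have mJ := measurable_jump_in n.
pose N := jump_in n `&` [set w | [set z : S * S | z.1 = z.2] (Y n w, Q n.+1 w)].
have mN : measurable N.
  apply: measurableI => //.
  apply: (mpre (f := fun w => (Y n w, Q n.+1 w))).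
    exact: measurable_fun_pair.
  exact: measurable_diagonal.
exists N; split => //; last first.
  by move=> w /= /not_implyP[Jw /contrapT QY]; split.
rewrite /N (joint_lawP (K := K) mJ (mY n) (mQ n.+1) _ _ (@measurable_diagonal R k dim)).
- apply: ge0_integral_ae0 => //.
    apply: measurable_funTS.
    exact: (measurableT_comp (measurable_fun_xsection_finite_kernel K
      (mem_set (@measurable_diagonal R k dim))) (mY n)).
  apply: filterS2 (ae_proper rf wf hX) (ae_postjump_space rf wf hX n).
  move=> w pw QE [T0 Th].
  have TH : T n.+1 w < H by exact: lt_le_trans hH.
  have [TH' _ _] := waitE pw TH.
  rewrite (_ : xsection _ _ = [set Y n w]).
    by apply: kernel_set1; exact: prejump_space rf _ _ pw (QE TH') TH.
  by apply/seteqP; split=> y; rewrite /xsection/= inE/=.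
- by apply: le_lt_trans (probability_le1 P mJ) _; exact: ltry.
- by move=> A B mA mB; exact: jump_kernel.
Qed.

(** The paths along which everything below can be read off. *)
Record good (w : Omega) : Prop := {
  good_proper : proper_path w;
  good_space : forall n, T n w < H -> E (Q n w);
  good_strict : forall n, T n.+1 w < H -> T n.+1 w < T n.+2 w;
  good_unbounded : forall t : R, t%:E < H -> exists n, t%:E < T n w;
  good_path : forall n (t : R), t%:E < H -> T n w <= t%:E -> t%:E < T n.+1 w ->
    X t w = phi (Q n w) (t - fine (T n w))%R;
  good_genuine : forall n, jump_in n w -> Q n.+1 w <> Y n w }.

Lemma ae_good : {ae P, forall w, good w}.
Proof.
apply: filterS3 (ae_proper rf wf hX) (ae_foralln (ae_postjump_space rf wf hX))
  (filterI (filterI (ip_strict hX) (ip_no_accumulation hX))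
    (filterI (ip_path hX) (ae_foralln ae_genuine_jump))).
by move=> w ? ? [[? ?] [? ?]]; split.
Qed.

Lemma locate w v : good w -> (0 <= v)%R -> v%:E < H ->
  exists n, T n w <= v%:E /\ v%:E < T n.+1 w.
Proof.
move=> gw v0 vH; have ex : exists n, v%:E < T n w by exact: good_unbounded.
case: (ex_minnP ex) => -[|n] vn nmin.
  by move: vn; have [-> _ _ _] := good_proper gw; rewrite lte_fin ltNge v0.
exists n; split => //; rewrite leNgt; apply/negP => /nmin.
by rewrite ltnn.
Qed.

Lemma locateP w n v : good w -> v%:E < H -> T n w <= v%:E -> v%:E < T n.+1 w ->
  [/\ T n w < H, (0 <= v - fine (T n w))%R,
      (v - fine (T n w))%:E < tau (Q n w) &
      X v w = phi (Q n w) (v - fine (T n w))%R].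
Proof.
move=> gw vH nv vn; have TH := le_lt_trans nv vH.
have pw := good_proper gw; have Tf := proper_fin pw TH.
have v0 : (0 <= v - fine (T n w))%R by rewrite subr_ge0 -lee_fin -Tf.
split => //; last exact: good_path.
have vE : T n w + (v - fine (T n w))%:E = v%:E.
  by rewrite {1}Tf -EFinD addrC subrK.
by apply: (waiting_before_exit pw (good_space gw TH) TH) => //; rewrite vE.
Qed.

Lemma path_right w v : good w -> (0 <= v)%R -> v%:E < H ->
  X u w @[u --> v^'+] --> X v w.
Proof.
move=> gw v0 vH; have [n [nv vn]] := locate gw v0 vH.
have [TH s0 st ->] := locateP gw vH nv vn.
have [m vm [mT' mH]] := between_ereal vn vH.
apply: (@cvg_trans _ ((fun u => phi (Q n w) (u - fine (T n w))%R) @ v^'+)).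
  apply: near_eq_cvg; near=> u.
  have vu : (v < u)%R by near: u; exact: nbhs_right_gt.
  have um : (u < m)%R by near: u; exact: nbhs_right_lt.
  apply/esym/good_path => //.
  - by apply: lt_trans mH; rewrite lte_fin.
  - by rewrite (le_trans nv)// lee_fin ltW.
  - by apply: lt_trans mT'; rewrite lte_fin.
have := rf_right rf (good_space gw TH) s0 st.
by move=> /(cvg_at_right_shift (fine (T n w))); rewrite subrK.
Unshelve. all: by end_near. Qed.

Lemma path_left w n v : good w -> T n w < v%:E -> v%:E <= T n.+1 w -> v%:E < H ->
  (v - fine (T n w))%:E <= tau (Q n w) ->
  X u w @[u --> v^'-] --> phi (Q n w) (v - fine (T n w))%R.
Proof.
move=> gw nv vn vH vt; have TH := lt_trans nv vH.
have Tf := proper_fin (good_proper gw) TH.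
have fv : (fine (T n w) < v)%R by rewrite -lte_fin -Tf.
have s0 : (0 < v - fine (T n w))%R by rewrite subr_gt0.
apply: (@cvg_trans _ ((fun u => phi (Q n w) (u - fine (T n w))%R) @ v^'-)).
  apply: near_eq_cvg; near=> u.
  have uv : (u < v)%R by near: u; exact: nbhs_left_lt.
  have fu : (fine (T n w) < u)%R by near: u; exact: nbhs_left_gt.
  apply/esym/good_path => //.
  - by apply: lt_trans vH; rewrite lte_fin.
  - by rewrite Tf lee_fin ltW.
  - by apply: lt_le_trans vn; rewrite lte_fin.
have := rf_left rf (good_space gw TH) s0 vt.
by move=> /(cvg_at_left_shift (fine (T n w))); rewrite subrK.
Unshelve. all: by end_near. Qed.

Lemma jump_waitE w n v : good w -> T n.+1 w = v%:E -> (0 < v)%R -> v%:E < H ->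
  [/\ T n w < v%:E, T n w < H & wait T n w = (v - fine (T n w))%R].
Proof.
move=> gw Tv v0 vH; have pw := good_proper gw.
have TH : T n.+1 w < H by rewrite Tv.
have [TH' _ _] := waitE pw TH; split => //.
  case: n Tv {TH} TH' => [Tv _|n Tv TH']; last by rewrite -Tv good_strict.
  by have [-> _ _ _] := pw; rewrite lte_fin.
by rewrite /wait Tv (proper_fin pw TH').
Qed.

Lemma path_left_jump w n v : good w -> T n.+1 w = v%:E -> (0 < v)%R -> v%:E < H ->
  X u w @[u --> v^'-] --> Y n w.
Proof.
move=> gw Tv v0 vH; have pw := good_proper gw.
have [nv TH wE] := jump_waitE gw Tv v0 vH.
have TH' : T n.+1 w < H by rewrite Tv.
rewrite /prejump wE; apply: path_left => //; first by rewrite Tv.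
by rewrite -wE; exact: wait_le_exit rf _ _ pw (good_space gw TH) TH'.
Qed.

Lemma path_at_jump w n v : good w -> T n.+1 w = v%:E -> v%:E < H ->
  X v w = Q n.+1 w.
Proof.
move=> gw Tv vH; have TH : T n.+1 w < H by rewrite Tv.
rewrite (good_path gw vH (n := n.+1)) ?Tv//; last by rewrite -Tv good_strict.
by rewrite /= subrr (rf_0 rf).
Qed.

Lemma locate_nojump w v : good w -> (0 < v)%R -> v%:E < H ->
  (forall n, T n w <> v%:E) -> exists n,
  [/\ T n w < v%:E, v%:E < T n.+1 w, E (Q n w), (0 < v - fine (T n w))%R &
   (v - fine (T n w))%:E < tau (Q n w) /\
      X v w = phi (Q n w) (v - fine (T n w))%R].
Proof.
move=> gw v0 vH nj; have [n [nv vn]] := locate gw (ltW v0) vH.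
have [TH s0 st XE] := locateP gw vH nv vn.
have nv' : T n w < v%:E by rewrite lt_neqAle nv andbT; exact/eqP/nj.
exists n; split => //; first exact: good_space.
by rewrite subr_gt0 -lte_fin -(proper_fin (good_proper gw) TH).
Qed.

Lemma path_left_nojump w v : good w -> (0 < v)%R -> v%:E < H ->
  (forall n, T n w <> v%:E) -> X u w @[u --> v^'-] --> X v w.
Proof.
move=> gw v0 vH nj; have [n [nv vn QE s0 [st ->]]] := locate_nojump gw v0 vH nj.
by apply: path_left => //; exact: ltW.
Qed.

Lemma path_inner w v : good w -> (0 < v)%R -> v%:E < H ->
  (forall n, T n w <> v%:E) -> inner (X v w).
Proof.
move=> gw v0 vH nj; have [n [nv vn QE s0 [st ->]]] := locate_nojump gw v0 vH nj.
exact: (rf_inner rf).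
Qed.

End jumps.

(** * The density of the waiting time *)

Section compensator.
Context (R : realType) (k : nat) (dim : 'I_k.+1 -> nat).
Local Notation S := (state R dim).
Context d (Omega : measurableType d) (P : probability Omega R).
Variables (c : pdmp_data R dim) (inner : set S) (H : \bar R).
Variables (X : R -> Omega -> S) (T : nat -> Omega -> \bar R)
  (Q : nat -> Omega -> S).
Hypothesis rf : regular_flow (pd_flow c) (pd_space c) (pd_boundary c) inner.
Hypothesis wf : pdmp_data_wf c.
Hypothesis hX : is_pdmp P c H X T Q.
Variable h : R.
Hypothesis hH : h%:E <= H.

Local Notation phi := (pd_flow c).
Local Notation E := (pd_space c).
Local Notation bd := (pd_boundary c).
Local Notation tau := (hitting_time (pd_flow c) (pd_boundary c)).
Local Notation leb := (@lebesgue_measure R).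
Local Notation Y := (prejump c T Q).
Local Notation ell := (rate0 c).
Local Notation hz := (hazard c).

Let hsk := ip_skeleton hX.
Let mT n : measurable_fun setT (T n). Proof. exact: sk_measurable_time hsk n. Qed.
Let mQ n : measurable_fun setT (Q n). Proof. exact: sk_measurable_state hsk n. Qed.
Let mY n : measurable_fun setT (Y n). Proof. exact: measurable_prejump rf hX n. Qed.
Let mwait n : measurable_fun setT (wait T n). Proof. exact: measurable_wait hX n. Qed.
Let mpre d1 d2 (U : measurableType d1) (V : measurableType d2) (f : U -> V) (A : set V) :
  measurable_fun setT f -> measurable A -> measurable (f @^-1` A).
Proof. by move=> mf mA; rewrite -[X in measurable X]setTI; exact: mf. Qed.
Let mell : measurable_fun setT (fun z : S * R => ell (phi z.1 z.2)).
Proof. exact: measurable_rate0_flow rf wf. Qed.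
Let ell0 x : (0 <= ell x)%R. Proof. exact: rate0_ge0. Qed.

Definition decay x s := fine (expeR (- hz x s)).

Lemma decayE x s : expeR (- hz x s) = (decay x s)%:E.
Proof.
rewrite /decay fineK// ge0_fin_numE ?expeR_ge0//.
have := hazard_ge0 wf x s; case: (hz x s) => [u| |]//= _; exact: ltry.
Qed.

Lemma decay_ge0 x s : (0 <= decay x s)%R.
Proof. by rewrite -lee_fin -decayE expeR_ge0. Qed.

Lemma measurable_decay : measurable_fun setT (fun z : S * R => decay z.1 z.2).
Proof.
have m1 : measurable_fun setT (fun z : S * R => - hz z.1 z.2).
  by apply: measurableT_comp => //; exact: measurable_hazard2 rf wf.
have m2 : measurable_fun setT (fun z : S * R => expeR (- hz z.1 z.2)).
  exact: (measurableT_comp (@measurable_expeR R) m1).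
rewrite /decay; apply: measurableT_comp m2; exact: fine_measurable.
Qed.

Lemma viable_le s t : (0 <= s)%R -> (s <= t)%R -> viable c t `<=` viable c s.
Proof.
move=> s0 st x [xE xt xh]; split => //.
  by apply: le_lt_trans xt; rewrite lee_fin.
apply: le_lt_trans xh; apply: ge0_subset_integral => //.
- apply: measurable_funTS; apply/measurable_EFinP.
  exact: (measurableT_comp mell (pair1_measurable x)).
- by move=> u _; rewrite lee_fin.
- by apply: subset_itvl; rewrite bnd_simp.
Qed.

(** On the states viable until [r], the part of the waiting time law before [r]
    is absolutely continuous; [window r] records the data of such a jump. *)
Definition window (r : R) : set (S * \bar R * R) :=
  [set z | [/\ viable c r z.1.1, 0 <= z.1.2, z.1.2 + r%:E < h%:E & (0 < z.2 <= r)%R]].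

Lemma measurable_window r : measurable (window r).
Proof.
have [r0|r0] := leP 0%R r; last first.
  rewrite (_ : window r = set0)//; apply/seteqP; split=> // z [_ _ _].
  by move=> /andP[/lt_le_trans h1 /h1]; rewrite ltNge ltW.
have m2 : measurable_fun setT (fun z : S * \bar R * R => z.2) by exact: measurable_snd.
have m11 : measurable_fun setT (fun z : S * \bar R * R => z.1.1).
  exact: (measurableT_comp measurable_fst measurable_fst).
have m12 : measurable_fun setT (fun z : S * \bar R * R => z.1.2).
  exact: (measurableT_comp measurable_snd measurable_fst).
rewrite (_ : window r = ((fun z => z.1.1) @^-1` viable c r) `&`
  (setT `&` [set z | 0 <= z.1.2]) `&` (setT `&` [set z | z.1.2 + r%:E < h%:E]) `&`
  [set z | (0 < z.2 <= r)%R]); last first.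
  apply/seteqP; split=> z [] => [h1 h2 h3 h4|[[h1 [_ h2]] [_ h3]] h4].
    exact: (conj (conj (conj h1 (conj I h2)) (conj I h3)) h4).
  by split.
apply: measurableI; first apply: measurableI; first apply: measurableI.
- exact: mpre m11 (measurable_viable rf wf r0).
- exact: measurable_lee (measurable_cst _) m12.
- by apply: measurable_lte => //; exact: emeasurable_funD.
- apply: measurable_bool_set; apply: measurable_and.
    exact: measurable_fun_ltr.
  exact: measurable_fun_ler.
Qed.

Section one_window.
Variables (n : nat) (r : R).
Hypothesis r0 : (0 <= r)%R.

Let zeta w := (Q n w, T n w, wait T n w).
Let mzeta : measurable_fun setT zeta.
Proof. by apply: measurable_fun_pair => //; exact: measurable_fun_pair. Qed.

Let zeta2 (z : Omega * R) := (Q n z.1, T n z.1, z.2).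
Let mzeta2 : measurable_fun setT zeta2.
Proof.
apply: measurable_fun_pair; last exact: measurable_snd.
apply: measurable_fun_pair; first exact: (measurableT_comp (mQ n) measurable_fst).
exact: (measurableT_comp (mT n) measurable_fst).
Qed.

Let waits := [set z : Omega * R | T n z.1 + z.2%:E < T n.+1 z.1].
Let mwaits : measurable waits.
Proof.
have m2 : measurable_fun setT (fun z : Omega * R => z.2%:E).
  by apply/measurable_EFinP; exact: measurable_snd.
have m1 : measurable_fun setT (fun z : Omega * R => T n z.1).
  exact: (measurableT_comp (mT n) measurable_fst).
have m3 : measurable_fun setT (fun z : Omega * R => T n.+1 z.1).
  exact: (measurableT_comp (mT n.+1) measurable_fst).
have := measurable_lte measurableT (emeasurable_funD m1 m2) m3.
by rewrite setTI.
Qed.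

Let mwaits_at s : measurable [set w | T n w + s%:E < T n.+1 w].
Proof. by have := measurable_ysection s mwaits; rewrite ysectionE. Qed.

Section rectangle.
Variables (A : set S) (B : set (\bar R)).
Hypotheses (mA : measurable A) (mB : measurable B).

Let A' := A `&` viable c r.
Let B' := B `&` [set u | 0 <= u /\ u + r%:E < h%:E].
Let G := [set w | A' (Q n w) /\ B' (T n w)].

Let mA' : measurable A'.
Proof. exact: (measurableI _ _ mA (measurable_viable rf wf r0)). Qed.

Let mB' : measurable B'.
Proof.
apply: measurableI => //.
rewrite (_ : [set u | _] = [set u : \bar R | 0 <= u] `&`
  [set u : \bar R | u + r%:E < h%:E])//.
apply: measurableI.
  exact: measurable_lee_set (measurable_cst _) (@measurable_id _ _ setT).
apply: measurable_lte_set (measurable_cst _).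
by apply: emeasurable_funD => //; exact: measurable_id.
Qed.

Let mG : measurable G.
Proof. by apply: measurableI; exact: mpre. Qed.

(** Inside the window the horizon [H] does not interfere and the survival
    function is the exponential of the hazard. *)
Let waiting_window s (A0 : set S) : measurable A0 -> (0 <= s <= r)%R ->
  A0 `<=` viable c r ->
  P [set w | [/\ A0 (Q n w), B' (T n w) & T n w + s%:E < T n.+1 w]] =
  \int[P]_(w in [set w | A0 (Q n w) /\ B' (T n w)]) (decay (Q n w) s)%:E.
Proof.
move=> mA0 /andP[s0 sr] A0r.
have sH u : B' u -> u + s%:E < H.
  move=> [_ [_ ur]]; apply: lt_le_trans hH; apply: le_lt_trans ur.
  by rewrite leeD2l// lee_fin.
have := waiting hX n mA0 mB' s0.
rewrite (_ : [set w | [/\ _, _, _ & _]] =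
  [set w | [/\ A0 (Q n w), B' (T n w) & T n w + s%:E < T n.+1 w]]); last first.
  by apply/seteqP; split=> w [] => [? ? ? ?|? ? ?]; split => //; exact: sH.
move=> ->.
rewrite (_ : [set w | [/\ _, _ & _ < H]] = [set w | A0 (Q n w) /\ B' (T n w)]); last first.
  by apply/seteqP; split=> w [] => [? ? ?|? ?]; split => //; exact: sH.
apply: eq_integral => w /set_mem[A0Q _].
by rewrite -decayE; apply: (viable_survival rf s0); exact: viable_le s0 sr _ (A0r _ A0Q).
Qed.

Let waiting_density s (g : S -> R) : (0 <= s <= r)%R ->
  measurable_fun setT g -> (forall x, (0 <= g x)%R) ->
  \int[P]_(w in G `&` [set w | T n w + s%:E < T n.+1 w]) (g (Q n w))%:E =
  \int[P]_(w in G) (g (Q n w) * decay (Q n w) s)%:E.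
Proof.
move=> srs mg g0.
pose F1 := [set w | B' (T n w) /\ T n w + s%:E < T n.+1 w].
pose F2 := [set w | B' (T n w)].
have mF2 : measurable F2 by exact: mpre.
have mF1 : measurable F1.
  by rewrite (_ : F1 = F2 `&` [set w | T n w + s%:E < T n.+1 w])//; exact: measurableI.
have mdec : measurable_fun setT (fun w => decay (Q n w) s).
  exact: (measurableT_comp measurable_decay
    (measurable_fun_pair (mQ n) (measurable_cst s))).
have mf1 : measurable_fun setT ((fun=> 1%R : R) \_ F1).
  by apply: measurable_restrict_setT.
have mf2 : measurable_fun setT ((fun w => decay (Q n w) s) \_ F2).
  exact: measurable_restrict_setT.
have f01 : forall x, (0 <= ((fun=> 1%R : R) \_ F1) x)%R by apply: restrict_ge0.
have f02 : forall x, (0 <= ((fun w => decay (Q n w) s) \_ F2) x)%R.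
  by apply: restrict_ge0 => w; exact: decay_ge0.
have mgA : measurable_fun setT (EFin \o (g \_ A')).
  by apply/measurable_EFinP; exact: measurable_restrict_setT.
have gA0 x : 0 <= (EFin \o (g \_ A')) x.
  by rewrite lee_fin; exact: restrict_ge0.
transitivity (\int[weighted_law P mf1 f01 (mQ n)]_x (EFin \o (g \_ A')) x).
  rewrite integral_weighted_law// [LHS]integral_mkcond. apply: eq_integral => w _.
  rewrite /= !patchE; case: ifPn => [/set_mem[[AQ BT] Tw]|nG].
    by rewrite (mem_set AQ) (mem_set (conj BT Tw : F1 w)) mule1.
  case: ifPn => [/set_mem AQ|_]; last by rewrite mul0e.
  rewrite ifN ?mule0//; apply: contra nG => /set_mem[BT Tw]; apply/mem_set.
  exact: (conj (conj AQ BT) Tw).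
transitivity (\int[weighted_law P mf2 f02 (mQ n)]_x (EFin \o (g \_ A')) x); last first.
  rewrite integral_weighted_law// [in RHS]integral_mkcond; apply: eq_integral => w _.
  rewrite /= !patchE; case: ifPn => [/set_mem AQ|nA]; last first.
    by rewrite mul0e ifN//; apply: contra nA => /set_mem[? ?]; apply/mem_set.
  case: ifPn => [/set_mem BT|nB].
    by rewrite (mem_set (conj AQ BT : G w)) -EFinM.
  by rewrite mule0 ifN//; apply: contra nB => /set_mem[? ?]; apply/mem_set.
have e (m : {measure set S -> \bar R}) : \int[m]_x (EFin \o (g \_ A')) x =
    \int[m]_(x in A') (g x)%:E.
  by rewrite [RHS]integral_mkcond; apply: eq_integral => x _; rewrite /= !patchE; case: ifP.
rewrite !e; apply: eq_measure_integral => A0 mA0 A0A'.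
rewrite /= !weighted_law_restrict integral_cst; last by apply: measurableI => //; exact: mpre.
rewrite mul1e -(waiting_window mA0 srs); last by move=> x /A0A' [].
by congr (P _); apply/seteqP; split=> w => [[h1 [h2 h3]]|[h1 h2 h3]].
Qed.


Section interval.
Variables (a1 a2 : R).
Hypotheses (a10 : (0 <= a1)%R) (a12 : (a1 <= a2)%R) (a2r : (a2 <= r)%R).

Let kern (z : Omega * R) : R :=
  (ell (phi (Q n z.1) z.2) * \1_G z.1 * \1_(`]a1, a2]%classic) z.2)%R.

Let mkern : measurable_fun setT kern.
Proof.
apply: measurable_funM; first apply: measurable_funM.
- apply: (measurableT_comp mell (g := fun z : Omega * R => (Q n z.1, z.2))).
  apply: measurable_fun_pair; last exact: measurable_snd.
  exact: (measurableT_comp (mQ n) measurable_fst).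
- exact: (measurableT_comp (measurable_indic mG) measurable_fst).
- exact: (measurableT_comp (measurable_indic _) measurable_snd).
Qed.

Let kern0 z : (0 <= kern z)%R.
Proof. by rewrite /kern !mulr_ge0// indicE. Qed.

Let mdecay2 : measurable_fun setT (fun z : Omega * R => decay (Q n z.1) z.2).
Proof.
apply: (measurableT_comp measurable_decay (g := fun z : Omega * R => (Q n z.1, z.2))).
apply: measurable_fun_pair; last exact: measurable_snd.
exact: (measurableT_comp (mQ n) measurable_fst).
Qed.

(** Tonelli: the waiting time is integrated out through its survival function. *)
Let kern_waits :
  \int[(P \x leb)%E]_z (kern z * \1_waits z)%:E =
  \int[P]_(w in G) \int[leb]_(s in `]a1, a2]) ((ell (phi (Q n w) s))%:E * expeR (- hz (Q n w) s)).
Proof.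
have mk1 : measurable_fun setT (fun z => (kern z * \1_waits z)%:E : \bar R).
  by apply/measurable_EFinP; apply: measurable_funM => //; exact: measurable_indic.
have mk2 : measurable_fun setT (fun z => (kern z * decay (Q n z.1) z.2)%:E : \bar R).
  by apply/measurable_EFinP; exact: measurable_funM.
have k10 z : 0 <= (kern z * \1_waits z)%:E by rewrite lee_fin mulr_ge0// indicE.
have k20 z : 0 <= (kern z * decay (Q n z.1) z.2)%:E.
  by rewrite lee_fin mulr_ge0// decay_ge0.
transitivity (\int[leb]_s \int[P]_w (kern (w, s) * \1_waits (w, s))%:E).
  have := (fubini_tonelli2 (m1 := P) (m2 := leb) (fun z : Omega * R => (kern z * \1_waits z)%:E) mk1 k10).
  by move=> e; exact: e.
transitivity (\int[leb]_s \int[P]_w (kern (w, s) * decay (Q n w) s)%:E).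
  apply: eq_integral => s _.
  have [sI|sI] := boolP (s \in `]a1, a2]%classic); last first.
    by rewrite !integral0_eq// => w _; rewrite /kern/= !indicE (negbTE sI) mulr0 mul0r.
  have sr : (0 <= s <= r)%R.
    move: sI; rewrite inE/= in_itv/= => /andP[h1 h2].
    by rewrite (le_trans h2 a2r) andbT (le_trans a10)// ltW.
  transitivity (\int[P]_(w in G `&` [set w | T n w + s%:E < T n.+1 w])
      (ell (phi (Q n w) s))%:E).
    rewrite [RHS]integral_mkcond; apply: eq_integral => w _.
    rewrite /kern/= patchE !indicE sI in_setI.
    have -> : ((w, s) \in waits) = (w \in [set w | T n w + s%:E < T n.+1 w]).
      by apply/idP/idP => /set_mem ws; exact/mem_set.
    by case: (w \in G); case: (w \in [set _ | _]); rewrite /= ?mulr1 ?mulr0.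
  rewrite (waiting_density (g := fun x => ell (phi x s)))//; last first.
    exact: (measurableT_comp mell (pair2_measurable s)).
  rewrite integral_mkcond; apply: eq_integral => w _.
  rewrite /kern/= patchE !indicE sI.
  by case: (w \in G); rewrite /= ?mulr1 ?mulr0 ?mul0r.
transitivity (\int[P]_w \int[leb]_s (kern (w, s) * decay (Q n w) s)%:E).
  have := fubini_tonelli (m1 := P) (m2 := leb)
    (fun z : Omega * R => (kern z * decay (Q n z.1) z.2)%:E) mk2 k20.
  by move=> e; apply/esym; exact: e.
rewrite [RHS]integral_mkcond; apply: eq_integral => w _; rewrite patchE.
case: ifPn => wG; last first.
  by rewrite integral0_eq// => s _; rewrite /kern/= indicE (negbTE wG) mulr0 !mul0r.
rewrite [RHS]integral_mkcond; apply: eq_integral => s _; rewrite patchE decayE.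
rewrite /kern/= !indicE wG mulr1.
by case: ifP => _; rewrite ?mulr1 ?mulr0 ?mul0r// -EFinM.
Qed.

Let F s := [set w | G w /\ T n w + s%:E < T n.+1 w].

Let mF s : measurable (F s).
Proof.
rewrite (_ : F s = G `&` [set w | T n w + s%:E < T n.+1 w])//.
exact: measurableI.
Qed.

Let PF s : (0 <= s <= r)%R -> P (F s) = \int[P]_(w in G) (decay (Q n w) s)%:E.
Proof.
move=> sr; rewrite -(waiting_window mA' sr); last by move=> x [].
by congr (P _); apply/seteqP; split=> w => [[[? ?] ?]|[h1 h2 h3]].
Qed.

(** By the primitive of [f exp (- F)] the inner integral is a difference of two
    survival probabilities. *)
Let kern_total : \int[(P \x leb)%E]_z (kern z * \1_waits z)%:E = P (F a1 `\` F a2).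
Proof.
have a20 := le_trans a10 a12.
have h1 : \int[(P \x leb)%E]_z (kern z * \1_waits z)%:E + P (F a2) = P (F a1).
  rewrite kern_waits !PF ?a10 ?a20 ?(le_trans a12)//.
  have mdec s : measurable_fun setT (fun w => (decay (Q n w) s)%:E : \bar R).
    apply/measurable_EFinP; exact: (measurableT_comp measurable_decay
      (measurable_fun_pair (mQ n) (measurable_cst s))).
  rewrite -ge0_integralD//; last 4 first.
  - move=> w _; apply: integral_ge0 => s _; rewrite mule_ge0 ?expeR_ge0//.
    by rewrite lee_fin.
  - apply: measurable_funTS.
    pose g (z : Omega * R) : \bar R := (ell (phi (Q n z.1) z.2) *
      decay (Q n z.1) z.2 * \1_(`]a1, a2]%classic) z.2)%:E.
    rewrite (_ : (fun w => _) = (fun w => \int[leb]_s g (w, s))); last first.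
      apply/funext => w; rewrite integral_mkcond; apply: eq_integral => s _.
      rewrite patchE /g/= indicE decayE.
      by case: ifP => _; rewrite ?mulr1 ?mulr0// -EFinM.
    apply: measurable_fun_fubini_tonelli_F => //; last first.
      by move=> z; rewrite lee_fin !mulr_ge0// ?decay_ge0// indicE.
    apply/measurable_EFinP; apply: measurable_funM; first apply: measurable_funM.
    + apply: (measurableT_comp mell (g := fun z : Omega * R => (Q n z.1, z.2))).
      apply: measurable_fun_pair; last exact: measurable_snd.
      exact: (measurableT_comp (mQ n) measurable_fst).
    + exact: mdecay2.
    + exact: (measurableT_comp (measurable_indic _) measurable_snd).
  - by move=> w _; rewrite lee_fin decay_ge0.
  - exact: measurable_funTS.
  apply: eq_integral => w /set_mem[[_ [QE Qt Qh]] _]; rewrite -!decayE.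
  apply: (integral_expR_primitive (b := r)) => //.
  exact: (measurableT_comp mell (pair1_measurable (Q n w))).
have F21 : F a2 `<=` F a1.
  move=> w [Gw w2]; split => //; apply: le_lt_trans w2.
  by rewrite leeD2l// lee_fin.
have h2 : P (F a1 `\` F a2) + P (F a2) = P (F a1).
  rewrite -measureU//; [by rewrite setUC setDUK|exact: measurableD|].
  by rewrite setIC setDIK.
have fin : P (F a2) \is a fin_num.
  by rewrite ge0_fin_numE//; apply: le_lt_trans (probability_le1 P (mF a2)) (ltry _).
have h3 : \int[(P \x leb)%E]_z (kern z * \1_waits z)%:E =
    P (F a1) - P (F a2) by rewrite -h1 addeK.
by rewrite h3 -h2 addeK.
Qed.

Lemma window_interval :
  \int[(P \x leb)%E]_(z in [set z | [/\ G z.1, (a1 < z.2 <= a2)%R & waits z]])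
    (ell (phi (Q n z.1) z.2))%:E =
  P [set w | [/\ G w, T n w + a1%:E < T n.+1 w & ~ T n w + a2%:E < T n.+1 w]].
Proof.
transitivity (P (F a1 `\` F a2)); last first.
  congr (P _); apply/seteqP; split=> w => [[[h1 h2] h3]|[h1 h2 h3]].
    by split=> // h4; apply: h3; split.
  by split; [split|move=> [_]].
rewrite -kern_total integral_mkcond; apply: eq_integral => z _.
rewrite patchE /kern !indicE; case: ifPn => [/set_mem[zG zI zw]|nz].
  by rewrite !mem_set ?mulr1//= in_itv.
case: (boolP (z.1 \in G)) => [/set_mem zG|_]; last by rewrite mulr0 !mul0r.
case: (boolP (z.2 \in _)) => [/set_mem/=|_]; last by rewrite mulr0 mul0r.
rewrite in_itv/= => zI; case: (boolP (z \in waits)) => [/set_mem zw|_]; last by rewrite mulr0.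
by exfalso; move/negP: nz; apply; apply/mem_set.
Qed.

End interval.

Lemma window_rectangle a :
  P (zeta @^-1` ((A `*` B) `*` `]a, +oo[%classic) `&`
     (jump_in T h n `&` zeta @^-1` window r)) =
  \int[(P \x leb)%E]_(z in zeta2 @^-1` ((A `*` B) `*` `]a, +oo[%classic) `&`
     (waits `&` zeta2 @^-1` window r)) (ell (phi (Q n z.1) z.2))%:E.
Proof.
pose a1 := Num.max a 0%R.
have a10 : (0 <= a1)%R by rewrite le_max lexx orbT.
have a1P s : (a < s)%R /\ (0 < s)%R <-> (a1 < s)%R.
  by rewrite gt_max; split=> [[-> ->]|/andP[]].
have [ar|ra] := leP a1 r; last first.
  rewrite (_ : _ `&` _ = set0) ?measure0; last first.
    apply/seteqP; split=> // w [[[_ _]]] /=; rewrite in_itv/= andbT => h1.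
    move=> [_ [_ _ _ /andP[h2 h3]]]; have /a1P := conj h1 h2.
    by rewrite ltNge (le_trans h3)// ltW.
  rewrite (_ : _ `&` _ = set0) ?integral_set0//.
  apply/seteqP; split=> // z [[[_ _]]] /=; rewrite in_itv/= andbT => h1.
  move=> [_ [_ _ _ /andP[h2 h3]]]; have /a1P := conj h1 h2.
  by rewrite ltNge (le_trans h3)// ltW.
transitivity (P [set w | [/\ G w, T n w + a1%:E < T n.+1 w & ~ T n w + r%:E < T n.+1 w]]).
  congr (P _); apply/seteqP; split=> w.
    move=> [[[AQ BT]]] /=; rewrite in_itv/= andbT => h1.
    move=> [[j0 jh] [v t0 th /andP[h2 h3]]]; have /a1P h4 := conj h1 h2.
    move: t0 th j0 jh h3 h4; rewrite /zeta/= /wait /=.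
    case TE : (T n w) => [u| |]//; case TE' : (T n.+1 w) => [u'| |]//=.
    rewrite !lte_fin lee_fin => t0 th j0 jh h3 h4; split => //.
    + split; first by split.
      by split => //; rewrite /= TE; split; rewrite ?lee_fin ?lte_fin.
    + by lra.
    + by apply/negP; rewrite -leNgt; lra.
  move=> [[[AQ vr] [BT [t0 th]]] h1 /negP]; rewrite -leNgt => h2.
  move: (BT) t0 th h1 h2; rewrite /zeta /preimage/= /jump_in /window/= /wait.
  case TE : (T n w) => [u| |]//; case TE' : (T n.+1 w) => [u'| |]//=.
  rewrite !lte_fin !lee_fin => BT' t0 th h1 h2.
  have : (a1 < u' - u)%R by move: h1; rewrite ?lte_fin => h1; lra.
  move=> /a1P[h3 h4]; split.
    by split => //=; rewrite in_itv/= h3.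
  split; first by split; rewrite ?lte_fin; lra.
  by split => //; rewrite ?lee_fin ?lte_fin//; apply/andP; split; lra.
rewrite -(window_interval a10 ar (lexx r)); congr (integral _ _ _).
apply/seteqP; split=> z.
  move=> [[[AQ vr] [BT [t0 th]]] /andP[/a1P[h1 h2] h3] zw].
  apply: conj; first by split => //=; rewrite in_itv/= h1.
  by apply: conj => //; split => //; rewrite /= h2.
move=> [[[AQ BT] /=]]; rewrite in_itv/= andbT => h1.
move=> [zw [v t0 th /andP[h2 h3]]]; split => //.
by apply/andP; split => //; apply/a1P.
Qed.

End rectangle.

(** At time [s] after the last jump the next one comes with intensity [ell] if it
    has not come before. Rectangles whose last side is a half-line suffice. *)
Lemma window_law Z : measurable Z ->
  P (zeta @^-1` Z `&` (jump_in T h n `&` zeta @^-1` window r)) =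
  \int[(P \x leb)%E]_(z in zeta2 @^-1` Z `&` (waits `&` zeta2 @^-1` window r))
    (ell (phi (Q n z.1) z.2))%:E.
Proof.
move=> mZ.
pose D1 := jump_in T h n `&` zeta @^-1` window r.
pose D2 := waits `&` zeta2 @^-1` window r.
have mW := measurable_window r.
have mD1 : measurable D1.
  by apply: measurableI; [exact: (measurable_jump_in hX h n)|exact: mpre].
have mD2 : measurable D2 by apply: measurableI => //; exact: mpre.
have mf1 : measurable_fun setT ((fun=> 1%R : R) \_ D1).
  by apply: measurable_restrict_setT.
have mf2 : measurable_fun setT ((fun z : Omega * R => ell (phi (Q n z.1) z.2)) \_ D2).
  apply: measurable_restrict_setT => //.
  apply: (measurableT_comp mell (g := fun z : Omega * R => (Q n z.1, z.2))).
  apply: measurable_fun_pair; last exact: measurable_snd.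
  exact: (measurableT_comp (mQ n) measurable_fst).
have f01 : forall x, (0 <= ((fun=> 1%R : R) \_ D1) x)%R by apply: restrict_ge0.
have f02 : forall x, (0 <= ((fun z : Omega * R => ell (phi (Q n z.1) z.2)) \_ D2) x)%R.
  by apply: restrict_ge0.
have e1 Z0 : measurable Z0 -> weighted_law P mf1 f01 mzeta Z0 = P (zeta @^-1` Z0 `&` D1).
  move=> mZ0; rewrite weighted_law_restrict integral_cst ?mul1e//.
  by apply: measurableI => //; exact: mpre.
have e2 Z0 : weighted_law (P \x leb)%E mf2 f02 mzeta2 Z0 =
    \int[(P \x leb)%E]_(z in zeta2 @^-1` Z0 `&` D2) (ell (phi (Q n z.1) z.2))%:E.
  exact: weighted_law_restrict.
rewrite -(e1 Z mZ); apply: etrans (e2 Z).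
apply: measure_prod_half_lines_unique mZ => /=.
- move=> A B a mA mB; rewrite e1; last by do 2?apply: measurableX.
  by apply: etrans (window_rectangle mA mB a) _; apply/esym/e2.
- by rewrite e1//; apply: le_lt_trans (probability_le1 P _) (ltry _);
    rewrite preimage_setT setTI.
Qed.

End one_window.
End compensator.

(** * The expected number of unforced jumps *)

Section compensator_formula.
Context (R : realType) (k : nat) (dim : 'I_k.+1 -> nat).
Local Notation S := (state R dim).
Context d (Omega : measurableType d) (P : probability Omega R).
Variables (c : pdmp_data R dim) (inner : set S) (H : \bar R).
Variables (X : R -> Omega -> S) (T : nat -> Omega -> \bar R)
  (Q : nat -> Omega -> S).
Hypothesis rf : regular_flow (pd_flow c) (pd_space c) (pd_boundary c) inner.
Hypothesis wf : pdmp_data_wf c.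
Hypothesis hX : is_pdmp P c H X T Q.
Variable h : R.
Hypothesis hH : h%:E <= H.

Local Notation phi := (pd_flow c).
Local Notation E := (pd_space c).
Local Notation bd := (pd_boundary c).
Local Notation tau := (hitting_time (pd_flow c) (pd_boundary c)).
Local Notation leb := (@lebesgue_measure R).
Local Notation Y := (prejump c T Q).
Local Notation ell := (rate0 c).
Local Notation hz := (hazard c).
Local Notation wait := (wait T).

Let hsk := ip_skeleton hX.
Let mT n : measurable_fun setT (T n). Proof. exact: sk_measurable_time hsk n. Qed.
Let mQ n : measurable_fun setT (Q n). Proof. exact: sk_measurable_state hsk n. Qed.
Let mY n : measurable_fun setT (Y n). Proof. exact: measurable_prejump rf hX n. Qed.
Let mwait n : measurable_fun setT (wait n). Proof. exact: measurable_wait hX n. Qed.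
Let mpre d1 d2 (U : measurableType d1) (V : measurableType d2) (f : U -> V) (A : set V) :
  measurable_fun setT f -> measurable A -> measurable (f @^-1` A).
Proof. by move=> mf mA; rewrite -[X in measurable X]setTI; exact: mf. Qed.
Let mell : measurable_fun setT (fun z : S * R => ell (phi z.1 z.2)).
Proof. exact: measurable_rate0_flow rf wf. Qed.
Let ell0 x : (0 <= ell x)%R. Proof. exact: rate0_ge0. Qed.

Let zeta n w := (Q n w, T n w, wait n w).
Let mzeta n : measurable_fun setT (zeta n).
Proof. by apply: measurable_fun_pair => //; exact: measurable_fun_pair. Qed.

Let zeta2 n (z : Omega * R) := (Q n z.1, T n z.1, z.2).
Let mzeta2 n : measurable_fun setT (zeta2 n).
Proof.
apply: measurable_fun_pair; last exact: measurable_snd.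
apply: measurable_fun_pair; first exact: (measurableT_comp (mQ n) measurable_fst).
exact: (measurableT_comp (mT n) measurable_fst).
Qed.

Let waits n := [set z : Omega * R | T n z.1 + z.2%:E < T n.+1 z.1].
Let mwaits n : measurable (waits n).
Proof.
apply: measurable_lte_set; last exact: (measurableT_comp (mT n.+1) measurable_fst).
apply: emeasurable_funD; first exact: (measurableT_comp (mT n) measurable_fst).
by apply/measurable_EFinP; exact: measurable_snd.
Qed.

Let win j := window c h (rat_seq R j).
Let mwin j : measurable (win j). Proof. exact: (measurable_window rf wf h). Qed.

Variable A : set S.
Hypothesis mA : measurable A.

Let ZA : set (S * \bar R * R) := [set z | A (phi z.1.1 z.2)].
Let mZA : measurable ZA.
Proof.
apply: (mpre (f := fun z : S * \bar R * R => phi z.1.1 z.2)) => //.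
apply: (measurableT_comp (rf_measurable rf) (g := fun z : S * \bar R * R => (z.1.1, z.2))).
apply: measurable_fun_pair; last exact: measurable_snd.
exact: (measurableT_comp measurable_fst measurable_fst).
Qed.

Let W n := waits n `&` zeta2 n @^-1` (ZA `&` \bigcup_j win j).
Let mW n : measurable (W n).
Proof.
apply: measurableI => //; apply: mpre => //; apply: measurableI => //.
exact: bigcup_measurable.
Qed.

(** The windows of all rational lengths are made disjoint and their contributions
    are summed. *)
Let windows_law n :
  P (jump_in T h n `&` zeta n @^-1` (ZA `&` \bigcup_j win j)) =
  \int[(P \x leb)%E]_(z in W n) (ell (phi (Q n z.1) z.2))%:E.
Proof.
pose V := seqDU win.
have mV j : measurable (V j) by exact: seqDU_measurable.
have VW : \bigcup_j V j = \bigcup_j win j by rewrite -seqDU_bigcup_eq.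
have Vw j : V j `<=` win j by exact: subset_seqDU.
have tV : trivIset setT V by exact: trivIset_seqDU.
rewrite (_ : jump_in T h n `&` _ = \bigcup_j (zeta n @^-1` (ZA `&` V j) `&`
    (jump_in T h n `&` zeta n @^-1` win j))); last first.
  apply/seteqP; split=> w.
    move=> [Jw [ZAw]]; rewrite -VW => -[j _ Vj]; exists j => //.
    by split; [split|split => //; exact: Vw].
  move=> [j _ [[ZAw Vj] [Jw wj]]]; split => //; split => //.
  by exists j.
rewrite (_ : W n = \bigcup_j (zeta2 n @^-1` (ZA `&` V j) `&`
    (waits n `&` zeta2 n @^-1` win j))); last first.
  apply/seteqP; split=> w.
    move=> [Jw [ZAw]]; rewrite -VW => -[j _ Vj]; exists j => //.
    by split; [split|split => //; exact: Vw].
  move=> [j _ [[ZAw Vj] [Jw wj]]]; split => //; split => //.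
  by exists j.
have tV' (U : Type) (f : U -> S * \bar R * R) (C : nat -> set U) :
    trivIset setT (fun j => f @^-1` (ZA `&` V j) `&` C j).
  apply/trivIsetP => i j _ _ ij; rewrite -subset0 => w [[[_ wi] _] [[_ wj] _]].
  move/trivIsetP : tV => /(_ i j Logic.I Logic.I ij) e.
  by have : (V i `&` V j) (f w) by []; rewrite e.
rewrite measure_bigcup//; last first.
  move=> j _; apply: measurableI.
    exact: (mpre (mzeta n) (measurableI _ _ mZA (mV j))).
  by apply: measurableI; [exact: (measurable_jump_in hX h n)|exact: mpre].
rewrite ge0_integral_bigcup//; last 3 first.
- move=> j; apply: measurableI.
    exact: (mpre (@mzeta2 n) (measurableI _ _ mZA (mV j))).
  exact: (measurableI _ _ (mwaits n) (mpre (@mzeta2 n) (mwin j))).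
- apply: measurable_funTS; apply/measurable_EFinP.
  apply: (measurableT_comp mell (g := fun z : Omega * R => (Q n z.1, z.2))).
  apply: measurable_fun_pair; last exact: measurable_snd.
  exact: (measurableT_comp (mQ n) measurable_fst).
- by move=> z _; rewrite lee_fin.
rewrite (eq_eseriesl (Q := xpredT)); last by move=> j; rewrite in_setT.
apply: eq_eseriesr => j _; have [r0|r0] := leP 0%R (rat_seq R j).
  exact: (window_law rf wf hX hH n r0 (measurableI _ _ mZA (mV j))).
have w0 : win j = set0.
  apply/seteqP; split=> // z [_ _ _] /andP[/lt_le_trans h1 /h1].
  by rewrite ltNge ltW.
rewrite (_ : _ `&` _ = set0); last by rewrite w0 preimage_set0 !setI0.
rewrite measure0 (_ : _ `&` _ = set0) ?integral_set0//.
by rewrite w0 preimage_set0 !setI0.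
Qed.

Let ellA : S -> R := ell \_ A.

Let mellA : measurable_fun setT ellA.
Proof. by apply: measurable_restrict_setT => //; exact: measurable_rate0 rf wf. Qed.

Let ellA0 x : (0 <= ellA x)%R. Proof. exact: restrict_ge0. Qed.

Let alive n := [set z : R * Omega |
  [/\ (0 < z.1 < h)%R, T n z.2 < z.1%:E & z.1%:E < T n.+1 z.2]].

Let mtime : measurable_fun setT (fun z : R * Omega => z.1%:E : \bar R).
Proof. by apply/measurable_EFinP; exact: measurable_fst. Qed.

Let malive n : measurable (alive n).
Proof.
rewrite (_ : alive n = [set z : R * Omega | (0 < z.1 < h)%R] `&`
  ([set z | T n z.2 < z.1%:E] `&` [set z | z.1%:E < T n.+1 z.2])); last first.
  by apply/seteqP; split=> z [] => [? ? ?|? [? ?]].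
apply: measurableI; last apply: measurableI.
- apply: measurable_bool_set; apply: measurable_and; apply: measurable_fun_ltr => //;
    exact: measurable_fst.
- apply: measurable_lte_set => //; exact: (measurableT_comp (mT n) measurable_snd).
- apply: measurable_lte_set => //; exact: (measurableT_comp (mT n.+1) measurable_snd).
Qed.

Let g n (z : R * Omega) : \bar R :=
  (ellA (phi (Q n z.2) (z.1 - fine (T n z.2))) * \1_(alive n) z)%:E.

Let mg n : measurable_fun setT (g n).
Proof.
apply/measurable_EFinP; apply: measurable_funM; last exact: measurable_indic.
apply: (measurableT_comp (measurableT_comp mellA (rf_measurable rf))
  (g := fun z : R * Omega => (Q n z.2, z.1 - fine (T n z.2))%R)).
apply: measurable_fun_pair; first exact: (measurableT_comp (mQ n) measurable_snd).
apply: measurable_funB; first exact: measurable_fst.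
apply: measurableT_comp; first exact: fine_measurable.
exact: (measurableT_comp (mT n) measurable_snd).
Qed.

Let g0 n z : 0 <= g n z.
Proof. by rewrite lee_fin mulr_ge0// indicE. Qed.

Let f n (z : Omega * R) : \bar R := (ell (phi (Q n z.1) z.2) * \1_(W n) z)%:E.

Let mf n : measurable_fun setT (f n).
Proof.
apply/measurable_EFinP; apply: measurable_funM; last exact: measurable_indic.
apply: (measurableT_comp mell (g := fun z : Omega * R => (Q n z.1, z.2))).
apply: measurable_fun_pair; last exact: measurable_snd.
exact: (measurableT_comp (mQ n) measurable_fst).
Qed.

Let f0 n z : 0 <= f n z.
Proof. by rewrite lee_fin mulr_ge0// indicE. Qed.

Let goodw := good c H X T Q h.

(** Lebesgue measure is invariant under translation by the time of the last jump. *)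
Let orbit_shift n w : goodw w ->
  \int[leb]_s f n (w, s) = \int[leb]_v g n (v, w).
Proof.
move=> gw; have pw := good_proper gw.
have u0 := proper_ge0 n pw.
have [Th|hT] := ltP (T n w) h%:E; last first.
  rewrite !integral0_eq// => [v _|s _]; rewrite /g/f/=.
    rewrite indicE (_ : _ \in _ = false) ?mulr0//; apply/negbTE/negP.
    move=> /set_mem[/= /andP[_ vh] Tv _].
    by have := lt_trans Tv (vh : v%:E < h%:E); rewrite ltNge hT.
  rewrite indicE (_ : _ \in _ = false) ?mulr0//; apply/negbTE/negP.
  move=> /set_mem[_ [_ [j _ [_ _ /= Tr /andP[s0 sr]]]]].
  have : T n w <= T n w + (rat_seq R j)%:E.
    by rewrite leeDl// lee_fin (le_trans (ltW s0)).
  by move=> /le_lt_trans/(_ Tr); rewrite ltNge hT.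
have TH : T n w < H by exact: lt_le_trans hH.
have uE := proper_fin pw TH; set u := fine (T n w) in uE.
have u0' : (0 <= u)%R by rewrite -lee_fin -uE.
rewrite -(@integral_lebesgue_shift _ u (fun s => f n (w, s))); last 2 first.
- exact: (measurableT_comp (mf n) (pair1_measurable w)).
- by [].
apply: eq_integral => v _; rewrite /g/f/= -/u; congr (_%:E).
rewrite /ellA patchE !indicE; case: ifPn => [/set_mem Av|nA]; last first.
  rewrite mul0r (_ : _ \in W n = false) ?mulr0//; apply/negbTE/negP.
  by move=> /set_mem[_ [Av _]]; move/negP : nA; apply; exact/mem_set.
suff -> : ((w, (v - u)%R) \in W n) = ((v, w) \in alive n) by [].
apply/idP/idP => /set_mem.
  move=> [/= wv [_ [j _ [_ _ /= Tr /andP[s0 sr]]]]]; apply/mem_set; split => /=.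
  - apply/andP; split; first lra.
    have : (u + rat_seq R j < h)%R by rewrite -lte_fin; move: Tr; rewrite uE.
    by move=> ?; lra.
  - by rewrite uE lte_fin; lra.
  - by move: wv; rewrite /waits/= uE -EFinD addrC subrK.
move=> [/= /andP[v0 vh] Tv vT]; have uv : (u < v)%R by rewrite -lte_fin -uE.
have vE : T n w + (v - u)%:E = v%:E by rewrite uE -EFinD addrC subrK.
have s0 : (0 <= v - u)%R by lra.
have [||j [h1 h2 h3 h4]] := survives_later hH pw (good_space gw TH) TH s0.
- by rewrite vE.
- by rewrite vE.
apply/mem_set; split; first by rewrite /waits/= vE.
split => //; exists j => //; split => //=.
by apply/andP; split; [lra|exact: ltW].
Qed.

Let orbit_sum w v : goodw w -> (0 < v < h)%R -> (forall n, T n w <> v%:E) ->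
  \sum_(n <oo) g n (v, w) = (ellA (X v w))%:E.
Proof.
move=> gw /andP[v0 vh] nj.
have vH : v%:E < H by apply: lt_le_trans hH; rewrite lte_fin.
have [n [nv vn QE s0 [_ XE]]] := locate_nojump gw v0 vH nj.
have [_ _ TS _] := good_proper gw.
have mono : {homo T^~ w : m n / (m <= n)%N >-> m <= n}.
  by apply: homo_leq => [x|y x z|m]; [exact: lexx|exact: le_trans|have [] := TS m].
rewrite nneseries_esumT; last by move=> m; exact: g0.
transitivity (\esum_(m in [set n]) g m (v, w)).
  rewrite [RHS]esum_mkcond; apply: eq_esum => m _.
  case: ifPn => // /negP mn.
  rewrite /g indicE (_ : _ \in _ = false) ?mulr0//; apply/negbTE/negP.
  move=> /set_mem[/= _ mv vm]; apply: mn; apply/mem_set => /=.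
  apply/eqP; rewrite eqn_leq; apply/andP; split; rewrite leqNgt; apply/negP.
    by move=> /mono nm; have := lt_le_trans vn nm; rewrite ltNge ltW.
  by move=> /mono nm; have := lt_le_trans vm nm; rewrite ltNge ltW.
rewrite esum_set1// /g/= -XE indicE mem_set ?mulr1//.
by split => //=; rewrite v0.
Qed.

Hypothesis nsj : no_self_jump c.
Variable nu : probability S R.
Hypothesis stationary : {ae leb, forall v, (0 < v < h)%R ->
  forall B, measurable B -> P (X v @^-1` B) = nu B}.
Hypothesis regular_jumps : {ae P, forall w n, jump_in T h n w -> A (Y n w) ->
  exists j, window c h (rat_seq R j) (Q n w, T n w, wait n w)}.

(** Jumps come with intensity [ell] along the path. Summed over the orbit pieces,
    the expected number of jumps in (0, h) is the time integral of the expected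
    intensity at the current state, which stationarity makes constant. *)
Theorem compensator_formula (h0 : (0 < h)%R) :
  \sum_(n <oo) P (jump_in T h n `&` Y n @^-1` A) =
  h%:E * \int[nu]_(x in A) (ell x)%:E.
Proof.
transitivity (\sum_(n <oo) \int[leb]_v \int[P]_w g n (v, w)).
  apply: eq_eseriesr => n _.
  transitivity (P (jump_in T h n `&` zeta n @^-1` (ZA `&` \bigcup_j win j))).
    have mJ := measurable_jump_in hX h n.
    have mJA : measurable (jump_in T h n `&` Y n @^-1` A).
      by apply: measurableI => //; exact: mpre.
    have mJZ : measurable (jump_in T h n `&` zeta n @^-1` (ZA `&` \bigcup_j win j)).
      apply: measurableI => //; apply: (mpre (mzeta n)).
      by apply: measurableI => //; exact: bigcup_measurable.
    apply/eqP; rewrite eq_le; apply/andP; split; last first.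
      by apply: le_measure; rewrite ?inE// => w [Jw [AY _]].
    have [N [mN N0 hN]] := regular_jumps.
    rewrite -[leRHS]adde0 -N0; apply: le_trans (measureU2 _ mJZ mN).
    apply: le_measure; rewrite ?inE//; first exact: measurableU.
    move=> w [Jw AY]; have [wN|wN] := pselect (N w); first by right.
    left; split => //; split => //; apply: contrapT => nw; apply: wN; apply: hN.
    by move=> /(_ n Jw AY)[j wj]; apply: nw; exists j.
  rewrite windows_law.
  transitivity (\int[P]_w \int[leb]_s f n (w, s)).
    have := fubini_tonelli1 (m1 := P) (m2 := leb) (f n) (@mf n) (@f0 n).
    move=> e; apply: etrans e; rewrite [LHS]integral_mkcond.
    apply: eq_integral => z _; rewrite patchE /f indicE.
    by case: ifP => _; rewrite ?mulr1 ?mulr0.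
  transitivity (\int[P]_w \int[leb]_v g n (v, w)).
    apply: ge0_ae_eq_integral => //.
    - exact: (measurable_fun_fubini_tonelli_F (m2 := leb) (f n) (@mf n) (@f0 n)).
    - exact: (measurable_fun_fubini_tonelli_G (m1 := leb) (g n) (@mg n) (@g0 n)).
    - by move=> w _; exact: integral_ge0.
    - by move=> w _; exact: integral_ge0.
    - apply: filterS (ae_good rf wf hX hH nsj) => w gw _; exact: orbit_shift.
  apply/esym; have := fubini_tonelli (m1 := leb) (m2 := P) (g n) (@mg n) (@g0 n).
  by move=> e; exact: e.
rewrite -integral_nneseries//; last 2 first.
- by move=> n; exact: (measurable_fun_fubini_tonelli_F (m2 := P) (g n) (@mg n) (@g0 n)).
- by move=> n v _; exact: integral_ge0.
have mell_A : measurable_fun setT (EFin \o ellA) by exact/measurable_EFinP.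
have ell_A0 x : 0 <= (EFin \o ellA) x by rewrite lee_fin.
have mh : measurable (`]0%R, h[%classic : set R) by exact: measurable_itv.
have in_h v : (`]0%R, h[%classic : set R) v -> (0 < v < h)%R.
  by rewrite /= in_itv.
transitivity (\int[leb]_(v in `]0%R, h[%classic) (\int[nu]_(x in A) (ell x)%:E)); last first.
  rewrite integral_cst//= lebesgue_measure_itv/= lte_fin h0 oppr0 adde0 muleC//.
rewrite [RHS]integral_mkcond; apply: ge0_ae_eq_integral => //.
- apply: ge0_emeasurable_sum => //.
    by move=> n v _ _; exact: integral_ge0.
  by move=> n _; exact: (measurable_fun_fubini_tonelli_F (m2 := P) (g n) (@mg n) (@g0 n)).
- apply/(measurable_restrictT _ mh); exact: measurable_cst.
- by move=> v _; apply: nneseries_ge0 => n _ _; exact: integral_ge0.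
- move=> v _; rewrite patchE; case: ifP => // _; apply: integral_ge0 => x _.
  by rewrite lee_fin.
have := ae_no_fixed_time P mT; apply: filter_app; first exact: (ae_filter_ringOfSetsType leb).
move: stationary; apply: filterS; first exact: (ae_filter_ringOfSetsType leb).
move=> v st nf _.
rewrite patchE; case: ifPn => [/set_mem/in_h vh|/negP nv]; last first.
  rewrite eseries0// => n _ _; apply: integral0_eq => // w _.
  rewrite /g indicE (_ : _ \in _ = false) ?mulr0//; apply/negbTE/negP.
  move=> /set_mem[/= v0 _ _]; apply: nv; apply/mem_set => /=.
  by rewrite in_itv.
rewrite -integral_nneseries//; last first.
  by move=> n; exact: (measurableT_comp (mg n) (pair1_measurable v)).
have mXv : measurable_fun setT (X v).
  have /andP[v0 vh'] := vh; apply: (ip_measurable hX); first exact: ltW.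
  by apply: lt_le_trans hH; rewrite lte_fin.
transitivity (\int[P]_w (EFin \o ellA) (X v w)).
  apply: ge0_ae_eq_integral => //.
  - apply: ge0_emeasurable_sum => // n _.
    exact: (measurableT_comp (mg n) (pair1_measurable v)).
  - exact: (measurableT_comp mell_A mXv).
  - by move=> w _; apply: nneseries_ge0.
  - have nv : {ae P, forall w, forall n, T n w <> v%:E}.
      exists [set w | exists n, T n w = v%:E]; split => //.
        rewrite (_ : [set w | _] = \bigcup_n T n @^-1` [set v%:E]).
          by apply: bigcup_measurable => n _; apply: mpre => //; exact: emeasurable_set1.
        by apply/seteqP; split=> w [n]; exists n.
      by move=> w /= nw; apply: contrapT => nE; apply: nw => n Tn; apply: nE; exists n.
    apply: filterS2 (ae_good rf wf hX hH nsj) nv => w gw nw _.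
    exact: orbit_sum.
transitivity (\int[pushforward P (X v)]_x (EFin \o ellA) x).
  by rewrite ge0_integral_pushforward// => x _; exact: ell_A0.
rewrite (eq_measure_integral nu)//; last by move=> B mB _; exact: st.
rewrite [RHS]integral_mkcond; apply: eq_integral => x _.
by rewrite /= /ellA !patchE; case: ifP.
Qed.

End compensator_formula.

(** * The boundary measure *)

Section lower_integral.
Import HBNNSimple.
Context d (T : measurableType d) (R : realType) (m : {measure set T -> \bar R}).

(** The integral of a nonnegative function is a supremum over simple functions
    below it; without measurability it is a lower integral, still monotone. *)
Lemma lower_integral_le (f g : T -> \bar R) : (forall x, 0 <= f x) ->
  (forall x, f x <= g x) -> \int[m]_x f x <= \int[m]_x g x.
Proof.
move=> f0 fg; rewrite !ge0_integralTE//; last by move=> x; exact: le_trans (fg x).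
apply: ereal_sup_le => _ [s sf <-]; exists s => // x.
exact: le_trans (sf x) (fg x).
Qed.

(** A simple function below [f] exceeds [g] only on a measurable subset of [Z]. *)
Lemma lower_integral_off_null (f g : T -> \bar R) (Z : set T) :
  (forall x, 0 <= f x) -> measurable_fun setT g -> (forall x, 0 <= g x) ->
  (forall x, ~ Z x -> f x <= g x) ->
  (forall D, measurable D -> D `<=` Z -> m D = 0) ->
  \int[m]_x f x <= \int[m]_x g x.
Proof.
move=> f0 mg g0 fg Z0; rewrite ge0_integralTE//; apply: ge_ereal_sup.
move=> _ [s sf <-]; rewrite -integralT_nnsfun.
have ms : measurable_fun setT (fun x => (s x)%:E).
  apply/measurable_EFinP; exact: measurable_funP.
have mD : measurable [set x | g x < (s x)%:E].
  by apply: measurable_lte_set.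
apply: ae_ge0_le_integral => //.
  by move=> x _; rewrite lee_fin.
exists [set x | g x < (s x)%:E]; split => //.
- apply: Z0 => // x /= gs; apply: contrapT => /fg; rewrite leNgt => /negP; apply.
  exact: lt_le_trans gs (sf x).
- move=> x /= /not_implyP[_ /negP]; by rewrite -ltNge.
Qed.

End lower_integral.

Section count_events.
Context (R : realType) d (U : measurableType d).
Implicit Type A B : nat -> set U.

Lemma count_events_ge0 A w : 0 <= count_events R A w.
Proof. by apply: nneseries_ge0 => n _ _; rewrite lee_fin indicE. Qed.

Lemma le_count_events A B w : (forall n, A n w -> B n w) ->
  count_events R A w <= count_events R B w.
Proof.
move=> AB; apply: lee_nneseries => n _; first by rewrite lee_fin indicE.
rewrite lee_fin !indicE; case: (boolP (w \in A n)) => // /set_mem/AB Bw.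
by rewrite mem_set.
Qed.

Lemma count_events_first A B w : (forall n, A n.+1 w -> B n.+1 w) ->
  count_events R A w <= 1 + count_events R B w.
Proof.
move=> AB; have i0 (A' : nat -> set U) n : 0 <= (\1_(A' n) w)%:E :> \bar R.
  by rewrite lee_fin indicE.
rewrite /count_events (@nneseriesD1 _ (fun n => (\1_(A n) w)%:E) 0%N) => [|n _|//]; last exact: i0.
apply: leeD; first by rewrite lee_fin indicE; case: (w \in _).
rewrite [leRHS](@nneseriesD1 _ (fun n => (\1_(B n) w)%:E) 0%N) => [|n _|//]; last exact: i0.
rewrite -[leLHS]add0e; apply: leeD => //; apply: lee_nneseries => [n _ _|[//|n] _]; first exact: i0.
rewrite lee_fin !indicE; case: (boolP (w \in A n.+1)) => // /set_mem/AB Bw.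
by rewrite mem_set.
Qed.

End count_events.

Section jump_measures.
Context (R : realType) (k : nat) (dim : 'I_k.+1 -> nat).
Local Notation S := (state R dim).
Context d (Omega : measurableType d) (P : probability Omega R).
Variables (c : pdmp_data R dim) (inner : set S) (H : \bar R).
Variables (X : R -> Omega -> S) (T : nat -> Omega -> \bar R)
  (Q : nat -> Omega -> S).
Hypothesis rf : regular_flow (pd_flow c) (pd_space c) (pd_boundary c) inner.
Hypothesis wf : pdmp_data_wf c.
Hypothesis hX : is_pdmp P c H X T Q.
Variable h : R.
Hypothesis hH : h%:E <= H.
Hypothesis h0 : (0 < h)%R.
Hypothesis nsj : no_self_jump c.

Local Notation phi := (pd_flow c).
Local Notation E := (pd_space c).
Local Notation bd := (pd_boundary c).
Local Notation tau := (hitting_time (pd_flow c) (pd_boundary c)).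
Local Notation leb := (@lebesgue_measure R).
Local Notation K := (pd_jump c).
Local Notation Y := (prejump c T Q).
Local Notation ell := (rate0 c).

Let hsk := ip_skeleton hX.
Let mT n : measurable_fun setT (T n). Proof. exact: sk_measurable_time hsk n. Qed.
Let mQ n : measurable_fun setT (Q n). Proof. exact: sk_measurable_state hsk n. Qed.
Let mY n : measurable_fun setT (Y n). Proof. exact: measurable_prejump rf hX n. Qed.
Let mpre d1 d2 (U : measurableType d1) (V : measurableType d2) (f : U -> V) (A : set V) :
  measurable_fun setT f -> measurable A -> measurable (f @^-1` A).
Proof. by move=> mf mA; rewrite -[X in measurable X]setTI; exact: mf. Qed.
Let mJ n := measurable_jump_in hX h n.

Section boundary_measure.
Variables (sigma : set S -> \bar R).
Hypothesis hsigma : is_boundary_measure P c H X T sigma.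
Variable B : set S.
Hypothesis mB : measurable B.

Let forced n := jump_in T h n `&` Y n @^-1` (B `&` bd).
Let mforced n : measurable (forced n).
Proof.
apply: measurableI; first exact: mJ.
by apply: mpre => //; apply: measurableI => //; exact: rf_mbd rf.
Qed.

Let C := count_events R forced.
Let mC : measurable_fun setT C.
Proof.
apply: ge0_emeasurable_sum => [n w _ _|n _]; first by rewrite lee_fin indicE.
by apply/measurable_EFinP; exact: measurable_indic.
Qed.

Let intC : \int[P]_w C w = \sum_(n <oo) P (forced n).
Proof.
rewrite integral_nneseries//; last first.
  by move=> n; apply/measurable_EFinP; exact: measurable_indic.
by apply: eq_eseriesr => n _; rewrite integral_indic// setIT.
Qed.

Let cnt t := forced_jump_count X T t (B `&` bd).
Let goodw := good c H X T Q h.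

Let left_limitE w n : goodw w -> jump_in T h n w ->
  left_limit X (fine (T n.+1 w)) w = Y n w.
Proof.
move=> gw [T0 Th]; have Tf : T n.+1 w = (fine (T n.+1 w))%:E.
  by apply: (proper_fin (good_proper gw)); exact: lt_le_trans hH.
apply: cvg_lim; first exact: state_hausdorff.
apply: (path_left_jump rf gw) => //; first by rewrite -lte_fin -Tf.
by rewrite -Tf; exact: lt_le_trans hH.
Qed.

Let cnt_ge w : goodw w -> C w <= cnt h w.
Proof.
move=> gw; apply: le_count_events => n [Jw BY]; split; first exact: ltW (proj2 Jw).
by rewrite left_limitE.
Qed.

Let cnt_jump t w n : goodw w -> (t < h)%R -> 0 < T n.+1 w -> T n.+1 w <= t%:E ->
  (B `&` bd) (left_limit X (fine (T n.+1 w)) w) -> forced n w.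
Proof.
move=> gw th T0 Tt; have Jw : jump_in T h n w.
  by split => //; apply: le_lt_trans Tt _; rewrite lte_fin.
by rewrite left_limitE.
Qed.

Let T1_pos w n : goodw w -> T n.+2 w < H -> 0 < T n.+2 w.
Proof.
move=> gw TH; have pw := good_proper gw; have [_ _ + _] := pw => /(_ n.+1)[T12 _].
apply: (@le_lt_trans _ _ (T n.+1 w)); first exact: proper_ge0 pw.
by apply: (good_strict gw); exact: le_lt_trans T12 TH.
Qed.

Let cnt_le1 t w : goodw w -> (t < h)%R -> cnt t w <= 1 + C w.
Proof.
move=> gw th; apply: count_events_first => n [Tt BL].
apply: (@cnt_jump t) => //; apply: T1_pos => //.
by apply: le_lt_trans Tt _; apply: lt_le_trans hH; rewrite lte_fin.
Qed.

(* Paths with a jump at time [0] from B: the left limit there is not determined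
   by the process, so this set may fail to be measurable. *)
Let Z := [set w | T 1%N w <= 0 /\ (B `&` bd) (left_limit X (fine (T 1%N w)) w)].

Let cnt_le t w : goodw w -> ~ Z w -> (t < h)%R -> cnt t w <= C w.
Proof.
move=> gw nZ th; apply: le_count_events => -[|n] [Tt BL]; last first.
  apply: (@cnt_jump t) => //; apply: T1_pos => //.
  by apply: le_lt_trans Tt _; apply: lt_le_trans hH; rewrite lte_fin.
apply: (@cnt_jump t) => //; rewrite ltNge; apply/negP => T0.
by apply: nZ.
Qed.

Let sigmaE t : (0 < t)%R -> (t <= h)%R -> t%:E * sigma B = \int[P]_w cnt t w.
Proof.
move=> t0 th; rewrite (hsigma t0 _ mB); last by apply: le_trans hH; rewrite lee_fin.
by rewrite muleA -EFinM mulfV ?gt_eqF// mul1e.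
Qed.

Let sigma_ge0 : 0 <= sigma B.
Proof.
rewrite (hsigma h0 hH mB) mule_ge0//; first by rewrite lee_fin invr_ge0 ltW.
by apply: integral_ge0 => w _; exact: count_events_ge0.
Qed.

Let mgood : exists N, [/\ measurable N, P N = 0 & forall w, ~ N w -> goodw w].
Proof.
have [N [mN N0 hN]] := ae_good rf wf hX hH nsj.
by exists N; split => // w; apply: contra_notP => nw; exact: hN.
Qed.

Let upper : \sum_(n <oo) P (forced n) <= h%:E * sigma B.
Proof.
rewrite sigmaE// -intC; have [N [mN N0 hN]] := mgood.
rewrite (@ge0_negligible_integral _ _ _ P setT N C)//; last first.
  by move=> w _; exact: count_events_ge0.
rewrite integral_mkcond; apply: lower_integral_le => w; rewrite patchE.
  by case: ifP => // _; exact: count_events_ge0.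
case: ifPn => [/set_mem[_ /hN]|_]; first exact: cnt_ge.
exact: count_events_ge0.
Qed.

Let lower t : (0 < t)%R -> (t < h)%R -> t%:E * sigma B <= \sum_(n <oo) P (forced n).
Proof.
move=> t0 th; have [N [mN N0 hN]] := mgood.
have [sfin|] := boolP (sigma B < +oo); last first.
  rewrite -leNgt leye_eq => /eqP soo.
  have : \int[P]_w cnt t w <= \int[P]_w (cst 1 w + C w).
    apply: (@lower_integral_off_null _ _ _ _ _ _ N) => //.
    - by move=> w; exact: count_events_ge0.
    - by apply: emeasurable_funD.
    - by move=> w; apply: adde_ge0 => //; exact: count_events_ge0.
    - by move=> w /hN gw; exact: cnt_le1.
    - move=> D mD DN; apply/eqP; rewrite -measure_le0 -N0.
      by apply: le_measure => //; rewrite inE.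
  have -> : \int[P]_w (cst 1 w + C w) = 1 + \int[P]_w C w.
    rewrite ge0_integralD//; last by move=> w _; exact: count_events_ge0.
    by congr (_ + _); rewrite integral_cst// mul1e [LHS]probability_setT.
  rewrite -sigmaE//; last exact: ltW.
  rewrite soo gt0_muley ?lte_fin// intC leye_eq.
  by case: (\sum_(n <oo) _).
have Z0 D : measurable D -> D `<=` Z -> P D = 0.
  move=> mD DZ; have PD s : (0 < s)%R -> (s <= h)%R -> P D <= s%:E * sigma B.
    move=> s0 sh; rewrite sigmaE// -[in leLHS](setIT D) -integral_indic//.
    apply: lower_integral_le => w; first by rewrite lee_fin indicE.
    rewrite indicE; case: (boolP (w \in D)) => [/set_mem/DZ[T0 BL]|_]; last first.
      exact: count_events_ge0.
    rewrite /cnt /forced_jump_count /count_events (@nneseriesD1 _ _ 0%N)//.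
      rewrite indicE mem_set/=; last first.
        by split => //; apply: le_trans T0 _; rewrite lee_fin ltW.
      by rewrite leeDl//; apply: nneseries_ge0 => n _ _; rewrite lee_fin indicE.
  apply/eqP; rewrite -(measure_le0 P); apply/lee_addgt0Pr => e e0; rewrite add0e.
  have se : sigma B = (fine (sigma B))%:E by rewrite fineK// ge0_fin_numE.
  have f0 : (0 <= fine (sigma B))%R by rewrite fine_ge0.
  (* So small that [s * sigma B <= e]. *)
  pose s := Num.min h (e / (fine (sigma B) + 1))%R.
  have s0 : (0 < s)%R by rewrite lt_min h0 divr_gt0// ltr_wpDl.
  apply: le_trans (PD s s0 _) _; first by rewrite ge_min lexx.
  rewrite se -EFinM lee_fin.
  apply: (@le_trans _ _ (e / (fine (sigma B) + 1) * fine (sigma B))%R).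
    by rewrite ler_wpM2r// ge_min lexx orbT.
  rewrite -mulrA; apply: ler_piMr; first exact: ltW.
  by rewrite mulrC ler_pdivrMr ?mul1r; lra.
rewrite sigmaE//; last exact: ltW.
rewrite -intC.
apply: (@lower_integral_off_null _ _ _ _ _ _ (N `|` Z)) => //.
- by move=> w; exact: count_events_ge0.
- by move=> w; exact: count_events_ge0.
- by move=> w /not_orP[/hN gw nZ]; exact: cnt_le.
move=> D mD DNZ; apply/eqP; rewrite -measure_le0.
rewrite -[leRHS]add0e -[X in _ <= X + _](Z0 (D `\` N)); last 2 first.
- exact: measurableD.
- by move=> w [/DNZ[]].
rewrite -[X in _ <= _ + X]N0; apply: le_trans (measureU2 _ (measurableD mD mN) mN).
apply: le_measure; rewrite ?inE//; first by apply: measurableU => //; exact: measurableD.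
by move=> w Dw; have [|] := pselect (N w); [right|left].
Qed.

(** The boundary measure counts forced jumps in [0, t]; only those at times in
    (0, h) matter, because the count is linear in t. *)
Lemma boundary_measure_prejumps :
  h%:E * sigma B = \sum_(n <oo) P (jump_in T h n `&` Y n @^-1` (B `&` bd)).
Proof.
apply/eqP; rewrite eq_le upper andbT.
move: lower upper; rewrite -/forced; set G := \sum_(n <oo) _.
have G0 : 0 <= G by exact: nneseries_ge0.
case: (sigma B) sigma_ge0 => [s|_|//]; last first.
  have hh0 : (0 < h / 2)%R by rewrite divr_gt0.
  have hh1 : (h / 2 < h)%R by rewrite ltr_pdivrMr// ltr_pMr// ltr1n.
  move=> /(_ _ hh0 hh1) lo _; rewrite gt0_muley ?lte_fin//.
  by rewrite gt0_muley ?lte_fin in lo.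
rewrite lee_fin => s0; case: G G0 => [g|_ _|//]; last by rewrite leey.
rewrite -!EFinM !lee_fin => g0 lo _; rewrite leNgt; apply/negP => gs.
have s1 : (0 < s)%R.
  by rewrite lt_neqAle s0 andbT eq_sym; apply/eqP => s00; move: gs; rewrite s00 mulr0; lra.
have gsh : (g / s < h)%R by rewrite ltr_pdivrMr.
have gs0 : (0 <= g / s)%R by rewrite divr_ge0.
have [gm1 gm2] := midf_lt gsh.
have gm0 : (0 < (g / s + h) / 2)%R by exact: le_lt_trans gm1.
have := lo _ gm0 gm2; rewrite lee_fin.
rewrite (_ : (g / s + h) / 2 * s = (g + h * s) / 2)%R; last first.
  by field; rewrite gt_eqF.
by move=> ?; lra.
Qed.

End boundary_measure.

End jump_measures.

(** * The law of the states before jumps *)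

Section prejump_law.
Context (R : realType) (k : nat) (dim : 'I_k.+1 -> nat).
Local Notation S := (state R dim).
Context d (Omega : measurableType d) (P : probability Omega R).
Variables (c : pdmp_data R dim) (inner : set S) (H : \bar R).
Variables (X : R -> Omega -> S) (T : nat -> Omega -> \bar R)
  (Q : nat -> Omega -> S).
Hypothesis rf : regular_flow (pd_flow c) (pd_space c) (pd_boundary c) inner.
Hypothesis wf : pdmp_data_wf c.
Hypothesis hX : is_pdmp P c H X T Q.
Variable h : R.
Hypothesis hH : h%:E <= H.
Hypothesis nsj : no_self_jump c.

Local Notation phi := (pd_flow c).
Local Notation E := (pd_space c).
Local Notation bd := (pd_boundary c).
Local Notation leb := (@lebesgue_measure R).
Local Notation K := (pd_jump c).
Local Notation Y := (prejump c T Q).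
Local Notation ell := (rate0 c).

Let hsk := ip_skeleton hX.
Let mQ n : measurable_fun setT (Q n). Proof. exact: sk_measurable_state hsk n. Qed.
Let mY n : measurable_fun setT (Y n). Proof. exact: measurable_prejump rf hX n. Qed.
Let mpre d1 d2 (U : measurableType d1) (V : measurableType d2) (f : U -> V) (A : set V) :
  measurable_fun setT f -> measurable A -> measurable (f @^-1` A).
Proof. by move=> mf mA; rewrite -[X in measurable X]setTI; exact: mf. Qed.
Let mJ n := measurable_jump_in hX h n.

Let wJ n : Omega -> R := \1_(jump_in T h n).
Let mwJ n : measurable_fun setT (wJ n). Proof. exact: measurable_indic. Qed.
Let wJ0 n w : (0 <= wJ n w)%R. Proof. by rewrite /wJ indicE. Qed.

(** The expected number of jumps in (0, h) from each set of states. *)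
Definition prejump_law : {measure set S -> \bar R} :=
  mseries (fun n => weighted_law P (mwJ n) (@wJ0 n) (mY n)) 0.

Let wlE n A : measurable A -> weighted_law P (mwJ n) (@wJ0 n) (mY n) A =
  P (jump_in T h n `&` Y n @^-1` A).
Proof.
move=> mA; rewrite /weighted_law integral_indic//; exact: mpre.
Qed.

Lemma prejump_lawE A : measurable A ->
  prejump_law A = \sum_(n <oo) P (jump_in T h n `&` Y n @^-1` A).
Proof. by move=> mA; apply: eq_eseriesr => n _; exact: wlE. Qed.

(** Conditionally on the state before the jump, the new state has law [K]. *)
Lemma jump_count_kernel A B : measurable A -> measurable B ->
  \sum_(n <oo) P (jump_in T h n `&` [set w | A (Y n w) /\ B (Q n.+1 w)]) =
  \int[prejump_law]_(x in A) K x B.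
Proof.
move=> mA mB; rewrite ge0_integral_measure_series//; last first.
  exact/measurable_funTS/measurable_kernel.
apply: eq_eseriesr => n _; rewrite (jump_kernel rf hX hH n mA mB).
rewrite [RHS]integral_mkcond integral_weighted_law.
- rewrite [LHS]integral_mkcond; apply: eq_integral => w _.
  rewrite !patchE /wJ indicE in_setI; case: (w \in jump_in T h n) => /=; last first.
    by rewrite mule0.
  have -> : (w \in Y n @^-1` A) = (Y n w \in A) by apply/idP/idP => /set_mem ?; exact/mem_set.
  by rewrite mule1.
- by apply/(measurable_restrictT _ mA); exact/measurable_funTS/measurable_kernel.
- by move=> y; rewrite patchE; case: ifP.
Qed.

(** A new state on the active boundary would be left at once. *)
Lemma ae_postjump_off_boundary n :
  {ae P, forall w, jump_in T h n w -> ~ bd (Q n.+1 w)}.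
Proof.
apply: filterS (ae_good rf wf hX hH nsj) => w gw [T0 Th] Qbd.
have TH : T n.+1 w < H by exact: lt_le_trans hH.
have := good_strict gw TH; have pw := good_proper gw => T12.
have [t [Tt tT tH]] : exists t : R, [/\ T n.+1 w < t%:E, t%:E < T n.+2 w & t%:E < H].
  have Tf := proper_fin pw TH; move: T12 TH; rewrite Tf => T12 TH.
  by have [t ut [? ?]] := between_ereal T12 TH; exists t.
have [_ s0 + _] := locateP gw tH (ltW Tt) tT.
by rewrite (rf_bd0 rf Qbd) lte_fin ltNge s0.
Qed.

Variable sigma : {measure set S -> \bar R}.
Hypothesis hsigma : is_boundary_measure P c H X T sigma.
Variable nu : probability S R.
Hypothesis nu_inner : nu (~` inner) = 0.
Hypothesis stationary : {ae leb, forall v, (0 < v < h)%R ->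
  forall B, measurable B -> P (X v @^-1` B) = nu B}.
Variable G : set S.
Hypothesis mG : measurable G.
Hypothesis nuG : nu G = 0.
Hypothesis jumpG : prejump_law G = 0.
Hypothesis regular_jumps : {ae P, forall w n, jump_in T h n w -> ~ bd (Y n w) ->
  ~ G (Y n w) -> exists j, window c h (rat_seq R j) (Q n w, T n w, wait T n w)}.

(** Jumps from [bd] are counted by the boundary measure, there are none from [G],
    and all others obey the compensator formula. *)
Theorem prejump_law_formula (h0 : (0 < h)%R) A : measurable A ->
  prejump_law A = h%:E * (\int[nu]_(x in A) (ell x)%:E + sigma (A `&` bd)).
Proof.
move=> mA; have mbd := rf_mbd rf.
have mnull : measurable (bd `|` G) by exact: measurableU.
have mAr : measurable (A `\` (bd `|` G)) by exact: measurableD.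
have mAb : measurable (A `&` bd) by exact: measurableI.
have ge0 (B : set S) : 0 <= \int[nu]_(x in B) (ell x)%:E.
  by apply: integral_ge0 => x _; rewrite lee_fin rate0_ge0.
have nubd : nu bd = 0.
  apply/eqP; rewrite -measure_le0 -nu_inner; apply: le_measure; rewrite ?inE//.
    by apply: measurableC; exact: rf_minner rf.
  by move=> x bx ix; exact: (rf_disj rf ix).
have mell : measurable_fun setT (EFin \o ell).
  by apply/measurable_EFinP; exact: measurable_rate0 rf wf.
rewrite ge0_muleDr//.
rewrite (boundary_measure_prejumps rf wf hX hH h0 nsj hsigma mAb) -setIA setIid.
rewrite -(prejump_lawE mAb).
have -> : \int[nu]_(x in A) (ell x)%:E =
    \int[nu]_(x in A `\` (bd `|` G)) (ell x)%:E.
  apply: ge0_negligible_integral => //.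
  - exact: measurable_funTS.
  - by move=> x _; rewrite lee_fin rate0_ge0.
  - apply/eqP; rewrite -measure_le0; apply: le_trans (measureU2 _ mbd mG) _.
    by rewrite [X in X + _]nubd [X in _ + X]nuG adde0.
rewrite -(compensator_formula rf wf hX hH mAr nsj stationary _ h0).
  rewrite -(prejump_lawE mAr) -measureU//; last first.
    by apply/seteqP; split=> // x [[_ nx] [_ bx]]; apply: nx; left.
  apply/eqP; rewrite eq_le; apply/andP; split; last first.
    apply: le_measure; rewrite ?inE//; first exact: measurableU.
    by move=> x [[]|[]].
  rewrite -[leRHS]adde0 -jumpG; apply: le_trans (measureU2 _ _ mG); last first.
    exact: measurableU.
  apply: le_measure; rewrite ?inE//.
    by apply: measurableU => //; exact: measurableU.
  move=> x Ax; have [Gx|nG] := pselect (G x); first by right.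
  by left; have [bx|nb] := pselect (bd x); [right|left; split => // -[]].
apply: filterS regular_jumps => w hw n Jw [_ nY]; apply: hw => // y; apply: nY.
  by left.
by right.
Qed.

End prejump_law.

(** * Time reversal of paths *)

Section sample_times.
Context (R : realType) d (Omega : measurableType d) (P : probability Omega R).

Lemma never_at (U : nat -> Omega -> \bar R) v :
  (forall n, measurable_fun setT (U n)) -> P [set w | exists n, U n w = v%:E] = 0 ->
  {ae P, forall w n, U n w <> v%:E}.
Proof.
move=> mU U0; exists [set w | exists n, U n w = v%:E]; split => //.
  rewrite (_ : [set w | _] = \bigcup_n U n @^-1` [set v%:E]).
    apply: bigcup_measurable => n _; rewrite -[X in measurable X]setTI.
    exact: mU n measurableT _ (emeasurable_set1 _).
  by apply/seteqP; split=> w [n]; exists n.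
by move=> w /= nw; apply: contrapT => nE; apply: nw => n Tn; apply: nE; exists n.
Qed.

Lemma ae_time_exists (h : R) (p : R -> Prop) : (0 < h)%R ->
  {ae @lebesgue_measure R, forall v, p v} -> exists2 v, (0 < v < h)%R & p v.
Proof.
move=> h0 [N [mN N0 hN]]; apply: contrapT => np.
have sub : `]0%R, h[%classic `<=` N.
  move=> v; rewrite /= in_itv/= => vh; apply: hN => pv; apply: np; by exists v.
have pos_time : @lebesgue_measure R `]0%R, h[%classic = h%:E.
  by rewrite lebesgue_measure_itv/= lte_fin h0 oppr0 adde0.
have := le_measure (@lebesgue_measure R) => /(_ `]0%R, h[%classic N).
rewrite !inE => /(_ (measurable_itv _) mN sub).
by rewrite [X in _ <= X]N0 [X in X <= _]pos_time lee_fin leNgt h0.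
Qed.

End sample_times.

Section good_paths.
Context (R : realType) (k : nat) (dim : 'I_k.+1 -> nat).
Local Notation S := (state R dim).
Context d (Omega : measurableType d).
Variables (c : pdmp_data R dim) (H : \bar R).
Variables (X : R -> Omega -> S) (T : nat -> Omega -> \bar R)
  (Q : nat -> Omega -> S) (h : R) (w : Omega).
Hypothesis gw : good c H X T Q h w.

Lemma good_mono m n : (m <= n)%N -> T m w <= T n w.
Proof.
have [_ _ TS _] := good_proper gw.
have mono : {homo T^~ w : m n / (m <= n)%N >-> m <= n}.
  by apply: homo_leq => [x|y x z|i]; [exact: lexx|exact: le_trans|have [] := TS i].
exact: mono.
Qed.

Lemma good_inj m n : T m.+1 w < H -> T m.+1 w = T n.+1 w -> m = n.
Proof.
move=> TH mn; have lt a b : T a.+1 w < H -> (a < b)%N -> T a.+1 w < T b.+1 w.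
  by move=> aH ab; apply: lt_le_trans (good_strict gw aH) _; exact: good_mono.
by have [/(lt _ _ TH)|/lt|//] := ltngtP m n; rewrite -?mn ?ltxx// => /(_ TH).
Qed.

Lemma no_jump_between n (u : R) : T n w < u%:E -> u%:E < T n.+1 w ->
  forall m, T m w <> u%:E.
Proof.
move=> nu un m mu; have [nm|mn] := ltnP n m.
  by have := good_mono nm; rewrite mu leNgt un.
by have := good_mono mn; rewrite mu leNgt nu.
Qed.

End good_paths.

Section time_reversal.
Context (R : realType) (k : nat) (dim : 'I_k.+1 -> nat).
Local Notation S := (state R dim).
Context d (Omega : measurableType d) (P : probability Omega R).
Variables (c cs : pdmp_data R dim) (inner : set S) (H : \bar R) (h : R).
Variables (X Xs : R -> Omega -> S) (T Ts : nat -> Omega -> \bar R)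
  (Q Qs : nat -> Omega -> S).
Hypothesis rf : regular_flow (pd_flow c) (pd_space c) (pd_boundary c) inner.
Hypothesis rfs : regular_flow (pd_flow cs) (pd_space cs) (pd_boundary cs) inner.
Hypothesis wf : pdmp_data_wf c.
Hypothesis wfs : pdmp_data_wf cs.
Hypothesis hX : is_pdmp P c H X T Q.
Hypothesis hXs : is_pdmp P cs h%:E Xs Ts Qs.
Hypothesis hH : h%:E <= H.
Hypothesis nsj : no_self_jump c.
Hypothesis nsjs : no_self_jump cs.
Hypothesis hrev : is_time_reversal P h X Xs.

Local Notation Y := (prejump c T Q).
Local Notation Ys := (prejump cs Ts Qs).
Local Notation leb := (@lebesgue_measure R).

Let hsk := ip_skeleton hX.
Let hsks := ip_skeleton hXs.
Let mT n : measurable_fun setT (T n). Proof. exact: sk_measurable_time hsk n. Qed.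
Let mQ n : measurable_fun setT (Q n). Proof. exact: sk_measurable_state hsk n. Qed.
Let mY n : measurable_fun setT (Y n). Proof. exact: measurable_prejump rf hX n. Qed.
Let mTs n : measurable_fun setT (Ts n). Proof. exact: sk_measurable_time hsks n. Qed.
Let mQs n : measurable_fun setT (Qs n). Proof. exact: sk_measurable_state hsks n. Qed.
Let mYs n : measurable_fun setT (Ys n). Proof. exact: measurable_prejump rfs hXs n. Qed.
Let mpre d1 d2 (U : measurableType d1) (V : measurableType d2) (f : U -> V) (A : set V) :
  measurable_fun setT f -> measurable A -> measurable (f @^-1` A).
Proof. by move=> mf mA; rewrite -[X in measurable X]setTI; exact: mf. Qed.

Section path.
Variable w : Omega.
Hypothesis gw : good c H X T Q h w.
Hypothesis gws : good cs h%:E Xs Ts Qs h w.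
Hypothesis rw : forall t : R, (0 <= t)%R -> (t < h)%R ->
  X u w @[u --> (h - t)%R^'-] --> Xs t w.

Let lim_uniq (F : set_system S) (pF : ProperFilter F) (x y : S) :
  F --> x -> F --> y -> x = y.
Proof.
by move=> Fx Fy; exact: (cvg_unique (@state_hausdorff R k dim) Fx Fy).
Qed.

Let ltH (v : R) : (v < h)%R -> v%:E < H.
Proof. by move=> vh; apply: lt_le_trans hH; rewrite lte_fin. Qed.

Lemma reversed_at_nojump (v : R) : (0 < v)%R -> (v <= h)%R -> v%:E < H ->
  (forall n, T n w <> v%:E) -> Xs (h - v) w = X v w.
Proof.
move=> v0 vh vH nj.
have := rw (t := (h - v)%R) _ _; rewrite subKr => /(_ _ _)hl.
apply: (@lim_uniq (X u w @[u --> v^'-])).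
- by apply: hl; lra.
- exact: (path_left_nojump rf gw v0 vH nj).
Qed.

(** Just after [v] the path has no jump, and there the reversed path repeats it. *)
Lemma reversed_left_limit (v : R) : (0 < v)%R -> (v < h)%R ->
  Xs t w @[t --> (h - v)%R^'-] --> X v w.
Proof.
move=> v0 vh; have vH := ltH vh.
have [n [nv vn]] := locate gw (ltW v0) vH.
have vh' : v%:E < h%:E by rewrite lte_fin.
have [m vm [mT' mh]] := between_ereal vn vh'; rewrite lte_fin in mh.
apply: (@cvg_trans _ (X (h - t) w @[t --> (h - v)%R^'-])).
  apply: near_eq_cvg; near=> t.
  have tv : (t < h - v)%R by near: t; exact: nbhs_left_lt.
  have mt : (h - m < t)%R by near: t; apply: nbhs_left_gt; lra.
  suff : Xs (h - (h - t)) w = X (h - t) w by rewrite subKr.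
  apply: reversed_at_nojump.
  - lra.
  - lra.
  - by apply: ltH; lra.
  - apply: (no_jump_between gw (n := n)).
      by apply: (le_lt_trans nv); rewrite lte_fin; lra.
    by apply: (lt_trans _ mT'); rewrite lte_fin; lra.
move=> U /(path_right rf gw (ltW v0) vH).
rewrite /nbhs/= => -[e /= e0 he]; exists e => //= t te tv.
apply: he => /=; last lra.
by move: te; rewrite /ball_/= distrC; congr (`| _ | < _)%R; lra.
Unshelve. all: by end_near. Qed.

(** The one-sided limits of the reversed path at [h - v] are those of the path at
    [v], exchanged; if they differ, both paths jump. *)
Lemma forward_jump_reversed n (v : R) : T n.+1 w = v%:E -> (0 < v)%R -> (v < h)%R ->
  exists m, [/\ Ts m.+1 w = (h - v)%:E, Ys m w = Q n.+1 w & Qs m.+1 w = Y n w].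
Proof.
move=> Tv v0 vh; have vH := ltH vh.
have u0 : (0 < h - v)%R by lra.
have uh : (h - v < h)%R by lra.
have XsY : Xs (h - v) w = Y n w.
  have := rw (ltW u0) uh; rewrite subKr => hl.
  exact: (lim_uniq _ hl (path_left_jump rf gw Tv v0 vH)).
have XQ := path_at_jump rf gw Tv vH.
have ll := reversed_left_limit v0 vh; rewrite XQ in ll.
have [[m Tm]|nj] := pselect (exists m, Ts m w = (h - v)%:E); last first.
  have uh' : (h - v)%:E < h%:E by rewrite lte_fin.
  have := path_left_nojump rfs gws u0 uh' (fun m e => nj (ex_intro _ m e)).
  move=> ll'; have QY : Q n.+1 w = Y n w by rewrite -XsY; exact: (lim_uniq _ ll ll').
  have Jn : jump_in T h n w by split; rewrite Tv lte_fin.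
  by have := good_genuine gw Jn QY.
case: m Tm => [T0|m Tm].
  by have [T00 _ _ _] := good_proper gws; move: T0 u0; rewrite T00 => -[<-]; rewrite ltxx.
exists m; split => //.
  have uh' : (h - v)%:E < h%:E by rewrite lte_fin.
  exact: (lim_uniq _ (path_left_jump rfs gws Tm u0 uh') ll).
by rewrite -XsY (path_at_jump rfs gws Tm)// lte_fin.
Qed.

Lemma reversed_jump_forward m (u : R) : Ts m.+1 w = u%:E -> (0 < u)%R -> (u < h)%R ->
  exists n, T n.+1 w = (h - u)%:E.
Proof.
move=> Tu u0 uh; have v0 : (0 < h - u)%R by lra.
have vh : (h - u < h)%R by lra.
have [[n Tn]|nj] := pselect (exists n, T n w = (h - u)%:E); last first.
  have := reversed_at_nojump v0 (ltW vh) (ltH vh) (fun m e => nj (ex_intro _ m e)).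
  have := reversed_left_limit v0 vh; rewrite subKr => ll XX'.
  have uh' : u%:E < h%:E by rewrite lte_fin.
  have YX : Ys m w = X (h - u) w.
    exact: (lim_uniq _ (path_left_jump rfs gws Tu u0 uh') ll).
  have Jm : jump_in Ts h m w by split; rewrite Tu lte_fin.
  apply: False_ind; apply: (good_genuine gws Jm).
  by rewrite -(path_at_jump rfs gws Tu uh') XX' YX.
case: n Tn => [T0|n Tn]; last by exists n.
by have [T00 _ _ _] := good_proper gw; move: T0 v0; rewrite T00 => -[<-]; rewrite ltxx.
Qed.

Variables A B : set S.

(** The correspondence of the jump times [v] and [h - v] exchanges the states
    before and after the jump. *)
Lemma jump_pairs_reversed :
  count_events R (fun n => jump_in T h n `&` [set w | A (Y n w) /\ B (Q n.+1 w)]) w =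
  count_events R (fun m => jump_in Ts h m `&` [set w | B (Ys m w) /\ A (Qs m.+1 w)]) w.
Proof.
pose I1 := [set n | (jump_in T h n `&` [set w | A (Y n w) /\ B (Q n.+1 w)]) w].
pose I2 := [set m | (jump_in Ts h m `&` [set w | B (Ys m w) /\ A (Qs m.+1 w)]) w].
have cE (J : nat -> set Omega) : count_events R J w = \esum_(n in [set n | J n w]) 1.
  rewrite /count_events nneseries_esumT; last by move=> n; rewrite lee_fin indicE.
  rewrite [RHS]esum_mkcond; apply: eq_esum => n _.
  rewrite indicE (_ : (w \in J n) = (n \in [set n | J n w])); first by case: ifP.
  by apply/idP/idP => /set_mem ?; exact/mem_set.
have fin (U : nat -> Omega -> \bar R) n : jump_in U h n w ->
    exists2 v, U n.+1 w = v%:E & (0 < v < h)%R.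
  move=> [/=]; case: (U n.+1 w) => [v| |]//; rewrite !lte_fin => v0 vh.
  by exists v => //; apply/andP.
pose e n := xget 0%N [set m | Ts m.+1 w = h%:E - T n.+1 w].
have eP n : jump_in T h n w ->
    [/\ Ts (e n).+1 w = h%:E - T n.+1 w, Ys (e n) w = Q n.+1 w &
        Qs (e n).+1 w = Y n w].
  move=> /fin[v Tv /andP[v0 vh]].
  have [m [Tm YQ QY]] := forward_jump_reversed Tv v0 vh.
  have em : [set m | Ts m.+1 w = h%:E - T n.+1 w] (e n).
    by apply: (xgetPex 0%N); exists m => /=; rewrite Tm Tv EFinB.
  suff -> : e n = m by rewrite Tv -EFinB.
  apply: (good_inj gws); rewrite em Tv -EFinB; last by rewrite Tm.
  by rewrite lte_fin; lra.
have bij : set_bij I1 I2 e; last first.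
  rewrite !cE; apply/esym; exact: (@reindex_esum R _ _ I1 I2 e (fun=> 1) bij).
split.
- move=> n [/[dup] Jn /eP[Te YQ QY] [AY BQ]]; have [v Tv /andP[v0 vh]] := fin _ _ Jn.
  split; last by rewrite /= YQ QY.
  by split; rewrite Te Tv -EFinB lte_fin; lra.
- move=> n n' /set_mem[Jn _] /set_mem[Jn' _] ee.
  have [v Tv /andP[v0 vh]] := fin _ _ Jn; have [v' Tv' _] := fin _ _ Jn'.
  apply: (good_inj gw); first by rewrite Tv; exact: ltH.
  have [/[swap] _ /[swap] _ e1] := eP _ Jn; have [e2 _ _] := eP _ Jn'.
  by move: e1; rewrite ee e2 Tv Tv' -!EFinB => -[?]; congr (_%:E); lra.
- move=> m [Jm [BY AQ]]; have [u Tu /andP[u0 uh]] := fin _ _ Jm.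
  have [n Tn] := reversed_jump_forward Tu u0 uh.
  have Jn : jump_in T h n w by split; rewrite Tn lte_fin; lra.
  have [Te YQ QY] := eP _ Jn.
  have em : e n = m.
    apply: (good_inj gws); rewrite Te Tn -EFinB subKr//.
  exists n => //; split => //=.
  by rewrite -YQ -QY em.
Qed.

End path.

Let ae_paths : {ae P, forall w, [/\ good c H X T Q h w,
  good cs h%:E Xs Ts Qs h w & forall t : R, (0 <= t)%R -> (t < h)%R ->
  X u w @[u --> (h - t)%R^'-] --> Xs t w]}.
Proof.
have gw := ae_good rf wf hX hH nsj.
have gws := ae_good rfs wfs hXs (lexx _) nsjs.
by apply: filterS3 gw gws hrev => w ? ? ?; split.
Qed.

Lemma jump_law_reversed A B : measurable A -> measurable B ->
  \sum_(n <oo) P (jump_in T h n `&` [set w | A (Y n w) /\ B (Q n.+1 w)]) =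
  \sum_(m <oo) P (jump_in Ts h m `&` [set w | B (Ys m w) /\ A (Qs m.+1 w)]).
Proof.
move=> mA mB.
have cE (J : nat -> set Omega) : (forall n, measurable (J n)) ->
    measurable_fun setT (count_events R J) /\
    \int[P]_w count_events R J w = \sum_(n <oo) P (J n).
  move=> mJ; have mi n : measurable_fun setT (fun w => (\1_(J n) w)%:E : \bar R).
    by apply/measurable_EFinP; exact: measurable_indic.
  split.
    by apply: ge0_emeasurable_sum => // n w _ _; rewrite lee_fin indicE.
  rewrite integral_nneseries//.
  by apply: eq_eseriesr => n _; rewrite integral_indic// setIT.
have [m1 <-] := cE (fun n => jump_in T h n `&` [set w | A (Y n w) /\ B (Q n.+1 w)])
  (fun n => measurableI _ _ (measurable_jump_in hX h n)
    (measurableI _ _ (mpre (mY n) mA) (mpre (mQ n.+1) mB))).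
have [m2 <-] := cE (fun m => jump_in Ts h m `&` [set w | B (Ys m w) /\ A (Qs m.+1 w)])
  (fun n => measurableI _ _ (measurable_jump_in hXs h n)
    (measurableI _ _ (mpre (mYs n) mB) (mpre (mQs n.+1) mA))).
apply: ge0_ae_eq_integral => //.
- by move=> w _; exact: count_events_ge0.
- by move=> w _; exact: count_events_ge0.
- by apply: filterS ae_paths => w [gw gws rw] _; exact: jump_pairs_reversed.
Qed.

Variable nu : probability S R.
Hypothesis stationary : stationary_law P X nu.
Hypothesis h0 : (0 < h)%R.

Lemma ae_forward_stationary : {ae leb, forall v, (0 < v < h)%R ->
  forall B, measurable B -> P (X v @^-1` B) = nu B}.
Proof.
apply: aeW => v /andP[v0 _] B mB; exact: stationary (ltW v0) _ mB.
Qed.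

Let mX v : (0 < v < h)%R -> measurable_fun setT (X v).
Proof.
move=> /andP[v0 vh]; apply: (ip_measurable hX); first exact: ltW.
by apply: lt_le_trans hH; rewrite lte_fin.
Qed.

(** The state is interior at any time at which almost surely no jump occurs. *)
Lemma stationary_inner : nu (~` inner) = 0.
Proof.
have [v vh Tv] := ae_time_exists h0 (ae_no_fixed_time P mT).
have /andP[v0 vh'] := vh.
have mi : measurable (~` inner) by apply: measurableC; exact: rf_minner rf.
rewrite -(stationary (ltW v0) mi).
have [N [mN N0 hN]] : {ae P, forall w, inner (X v w)}.
  apply: filterS2 ae_paths (never_at mT Tv) => w [gw _ _] nj.
  apply: (path_inner rf gw v0) => //.
  by apply: lt_le_trans hH; rewrite lte_fin.
apply/eqP; rewrite -measure_le0 -N0; apply: le_measure; rewrite ?inE//.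
exact: mpre (mX vh) mi.
Qed.

(** When almost surely no jump occurs at [h - v], the reversed path at [v] is the
    path at [h - v]. *)
Lemma ae_reversed_stationary : {ae leb, forall v, (0 < v < h)%R ->
  forall B, measurable B -> P (Xs v @^-1` B) = nu B}.
Proof.
have mhT n : measurable_fun setT (fun w => h%:E - T n w).
  by apply: emeasurable_funB.
have := ae_no_fixed_time P mhT.
apply: filterS; first exact: (ae_filter_ringOfSetsType leb).
move=> v /(never_at mhT) nj /andP[v0 vh] B mB.
have u0 : (0 < h - v)%R by lra.
have uh : (h - v < h)%R by lra.
rewrite -(stationary (ltW u0) mB).
have mXv : measurable_fun setT (X (h - v)) by apply: mX; rewrite u0.
have mXsv : measurable_fun setT (Xs v).
  by apply: (ip_measurable hXs); rewrite ?lte_fin// ltW.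
have [N [mN N0 hN]] : {ae P, forall w, Xs v w = X (h - v) w}.
  apply: filterS2 ae_paths nj => w [gw gws rw] nj'.
  have := reversed_at_nojump gw rw u0 (ltW uh); rewrite subKr; apply.
    by apply: lt_le_trans hH; rewrite lte_fin.
  by move=> n Tn; apply: (nj' n); rewrite Tn -EFinB; congr (_%:E); lra.
have aux (f g : R -> Omega -> S) a b : measurable_fun setT (f a) ->
    measurable_fun setT (g b) -> (forall w, ~ N w -> f a w = g b w) ->
    P (f a @^-1` B) <= P (g b @^-1` B).
  move=> mf mg fg; rewrite -[leRHS]adde0 -N0.
  apply: le_trans (measureU2 _ (mpre mg mB) mN).
  apply: le_measure; rewrite ?inE//; [exact: mpre|apply: measurableU => //; exact: mpre|].
  by move=> w; have [|/fg e] := pselect (N w); [right|rewrite /= e; left].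
have hN' w : ~ N w -> Xs v w = X (h - v) w by apply: contra_notP => /hN.
apply/eqP; rewrite eq_le; apply/andP; split.
  exact: (aux Xs X).
by apply: (aux X Xs) => // w /hN'.
Qed.

End time_reversal.

(** * Regularity of unforced jumps *)

Section regular_jumps.
Context (R : realType) (k : nat) (dim : 'I_k.+1 -> nat).
Local Notation S := (state R dim).
Context d (Omega : measurableType d) (P : probability Omega R).
Variables (c : pdmp_data R dim) (inner : set S) (H : \bar R).
Variables (X : R -> Omega -> S) (T : nat -> Omega -> \bar R)
  (Q : nat -> Omega -> S).
Hypothesis rf : regular_flow (pd_flow c) (pd_space c) (pd_boundary c) inner.
Hypothesis wf : pdmp_data_wf c.
Variable h : R.
Hypothesis hH : h%:E <= H.

Local Notation phi := (pd_flow c).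
Local Notation E := (pd_space c).
Local Notation bd := (pd_boundary c).
Local Notation tau := (hitting_time (pd_flow c) (pd_boundary c)).
Local Notation leb := (@lebesgue_measure R).
Local Notation Y := (prejump c T Q).
Local Notation ell := (rate0 c).
Local Notation wait := (wait T).
Local Notation good := (good c H X T Q h).

Let ell0 x : (0 <= ell x)%R. Proof. exact: rate0_ge0. Qed.
Let mell : measurable_fun setT (fun z : S * R => (ell (phi z.1 z.2))%:E).
Proof. by apply/measurable_EFinP; exact: measurable_rate0_flow rf wf. Qed.
Let morb x : measurable_fun setT (fun s => (ell (phi x s))%:E).
Proof. exact: (measurableT_comp mell (pair1_measurable x)). Qed.

Lemma jump_before_exit w n : good w -> jump_in T h n w -> ~ bd (Y n w) ->
  [/\ E (Q n w), T n w < H, (0 < wait n w)%R, T n.+1 w = T n w + (wait n w)%:E &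
      (wait n w)%:E < tau (Q n w)].
Proof.
move=> gw [T0 Th] nbd; have TH : T n.+1 w < H by exact: lt_le_trans hH.
have pw := good_proper gw; have [TH' w0 TE] := waitE pw TH.
have QE := good_space gw TH'.
have wpos : (0 < wait n w)%R.
  rewrite lt_neqAle w0 andbT; apply/eqP => w00.
  have := TE; rewrite -w00 adde0 => TT.
  case: n T0 {Th nbd} TH TH' w0 TE QE w00 TT => [|n] T0 TH TH' w0 TE QE w00 TT.
    by move: T0; rewrite TT; have [-> _ _ _] := pw; rewrite ltxx.
  by have := good_strict gw TH'; rewrite TT ltxx.
split => //; rewrite lt_neqAle (wait_le_exit rf pw QE TH) andbT.
by apply/eqP => we; apply: nbd; exact: (rf_exit rf QE wpos (esym we)).
Qed.

(** The hazard accumulated before the jump is finite because the path survived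
    it; it stays finite a little longer if it does so around the jump. *)
Lemma regular_jump w n e : good w -> jump_in T h n w -> ~ bd (Y n w) -> (0 < e)%R ->
  \int[leb]_(s in `](wait n w - e)%R, (wait n w + e)%R[) (ell (phi (Q n w) s))%:E < +oo ->
  exists j, window c h (rat_seq R j) (Q n w, T n w, wait n w).
Proof.
move=> gw Jw nbd e0 fin; have [QE TH w0 TE wt] := jump_before_exit gw Jw nbd.
have [_ Th] := Jw; have pw := good_proper gw.
set s := wait n w in w0 TE wt fin *.
have [i /andP[i1 i2]] : exists i, (Num.max 0 (s - e) < rat_seq R i < s)%R.
  by apply: rat_seq_dense; rewrite gt_max w0/=; lra.
move: i1; rewrite gt_max => /andP[i0 ie].
have vi : viable c (rat_seq R i) (Q n w).
  have [_ _ _ sv] := pw; apply: sv => //; first exact: ltW.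
    by apply: (@lt_trans _ _ (T n.+1 w)); [|exact: lt_le_trans hH];
      rewrite TE (proper_fin pw TH) -!EFinD lte_fin; lra.
  by rewrite TE (proper_fin pw TH) -!EFinD lte_fin; lra.
have [v sv [vt vh]] : exists2 v, (s < v)%R & v%:E < tau (Q n w) /\
    v%:E < (Num.min (h - fine (T n w)) (s + e))%:E.
  apply: between_ereal => //; rewrite lte_fin lt_min; apply/andP; split; last lra.
  by move: Th; rewrite TE (proper_fin pw TH) -EFinD lte_fin; lra.
move: vh; rewrite lte_fin lt_min => /andP[vh ve].
have [j /andP[sj jv]] := rat_seq_dense sv; exists j.
split => //=; last first.
- by rewrite w0/= ltW.
- by rewrite (proper_fin pw TH) -EFinD lte_fin; lra.
- exact: proper_ge0 pw.
split => //; first by apply: lt_trans vt; rewrite lte_fin.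
have mI : measurable (`[0%R, rat_seq R i]%classic : set R) by exact: measurable_itv.
have mJ : measurable (`[0%R, rat_seq R j]%classic : set R) by exact: measurable_itv.
have mD := measurableD mJ mI.
rewrite /hazard (_ : `[0%R, rat_seq R j]%classic =
   `[0%R, rat_seq R i]%classic `|` (`[0%R, rat_seq R j] `\` `[0%R, rat_seq R i])); last first.
  apply/seteqP; split=> u /=.
    by move=> uj; have [ui|ui] := pselect (`[0%R, rat_seq R i]%classic u); [left|right].
  by move=> [|[]//]; rewrite !in_itv/= => /andP[-> ui]/=; rewrite (le_trans ui)//; lra.
rewrite ge0_integral_setU//; last 3 first.
- by apply: measurable_funTS; exact: morb.
- by move=> u _; rewrite lee_fin.
- by apply/disj_setPS => u [ui [_ nui]].
apply: lte_add_pinfty; first by have [] := vi.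
apply: le_lt_trans fin; apply: ge0_subset_integral => //.
- by apply: measurable_funTS; exact: morb.
- by move=> u _; rewrite lee_fin.
move=> u [/=]; rewrite !in_itv/= => /andP[u0 uj] /negP; rewrite u0/= -ltNge => iu.
by apply/andP; split; lra.
Qed.

(** A continuous intensity is bounded near the state before the jump. *)
Lemma continuous_rate_regular w n : {within E, continuous (pd_rate c)} ->
  good w -> jump_in T h n w -> ~ bd (Y n w) ->
  exists j, window c h (rat_seq R j) (Q n w, T n w, wait n w).
Proof.
move=> cl gw Jw nbd; have [QE TH w0 TE wt] := jump_before_exit gw Jw nbd.
have YE : E (Y n w) by apply: flow_space rf _ _ QE (ltW w0) wt.
have := (subspace_continuousP _ _).1 cl _ YE.
move=> /cvgrPdist_lt/(_ 1%R ltr01); rewrite near_withinE => near_Y.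
pose M := (pd_rate c (Y n w) + 1)%R.
have M0 : (0 <= M)%R by rewrite addr_ge0// (wf_rate_ge0 wf).
have near_Y' : \forall x \near Y n w, (ell x <= M)%R.
  apply: filterS near_Y => x hx; rewrite /rate0 patchE; case: ifPn => // /set_mem Ex.
  have := hx Ex; rewrite ltr_norml => /andP[h1 h2].
  by move: h1; rewrite ltrNl opprB ltrBlDl => /ltW.
have : \forall u \near wait n w, (ell (phi (Q n w) u) <= M)%R.
  have hl : \forall u \near wait n w,
      (u < wait n w)%R -> (ell (phi (Q n w) u) <= M)%R.
    exact: (rf_left rf QE w0 (ltW wt) near_Y').
  have hr : \forall u \near wait n w,
      (wait n w < u)%R -> (ell (phi (Q n w) u) <= M)%R.
    exact: (rf_right rf QE (ltW w0) wt near_Y').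
  apply: filterS2 hl hr => u ul ur.
  have [uw|wu|->] := ltgtP u (wait n w); [exact: ul|exact: ur|].
  exact: nbhs_singleton near_Y'.
move=> /nbhs_ballP[e /= e0 he].
apply: (@regular_jump w n e) => //.
apply: (@le_lt_trans _ _ (\int[leb]_(s in `](wait n w - e)%R, (wait n w + e)%R[) (cst M%:E s))).
  apply: ge0_le_integral => //.
  - by move=> u _; rewrite lee_fin.
  - by apply: measurable_funTS; exact: morb.
  - move=> u; rewrite /= in_itv/= => /andP[u1 u2]; rewrite lee_fin; apply: he.
    by rewrite -ball_normE/= ltr_norml; apply/andP; split; lra.
rewrite integral_cst//= lebesgue_measure_itv/=.
by case: ifP => _; rewrite ?mule0 ?ltry// -EFinB -EFinM ltry.
Qed.

Lemma orbit_integral_shift x s e : E x -> (0 < e)%R -> (e <= s)%R ->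
  (s + e)%:E <= tau x ->
  \int[leb]_(u in `](- e)%R, e[) (ell (phi (phi x s) u))%:E =
  \int[leb]_(u in `](s - e)%R, (s + e)%R[) (ell (phi x u))%:E.
Proof.
move=> xE e0 es st; rewrite [RHS]integral_mkcond.
rewrite -(@integral_lebesgue_shift _ (- s)%R); last 2 first.
- by apply/(measurable_restrictT _ (measurable_itv _)); by apply: measurable_funTS; exact: morb.
- by move=> u; rewrite patchE; case: ifP => // _; rewrite lee_fin.
rewrite [LHS]integral_mkcond; apply: eq_integral => u _; rewrite !patchE.
rewrite !mem_setE/= !in_itv/= opprK.
have -> : (s - e < u + s < s + e)%R = (- e < u < e)%R.
  by apply/idP/idP => /andP[? ?]; apply/andP; split; lra.
case: ifP => // /andP[u1 u2].
rewrite (rf_semigroup rf) ?(addrC s)//; first lra.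
- lra.
- by apply: lt_le_trans st; rewrite lte_fin; lra.
- by apply: lt_le_trans st; rewrite lte_fin; lra.
Qed.

Let around i y := \int[leb]_(u in `](- i.+1%:R^-1)%R, (i.+1%:R^-1)%R[) (ell (phi y u))%:E.

Let maround i : measurable_fun setT (around i).
Proof.
have mI : measurable (`](- i.+1%:R^-1)%R, (i.+1%:R^-1)%R[%classic : set R).
  exact: measurable_itv.
pose f (z : S * R) := (ell (phi z.1 z.2) *
  \1_([set: S] `*` `](- i.+1%:R^-1)%R, (i.+1%:R^-1)%R[%classic) z)%:E.
have mf : measurable_fun setT f.
  apply/measurable_EFinP; apply: measurable_funM; first by apply/measurable_EFinP; exact: mell.
  by apply: measurable_indic; exact: measurableX.
have f0 z : 0 <= f z by rewrite lee_fin mulr_ge0// indicE.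
have := measurable_fun_fubini_tonelli_F (m2 := leb) f mf f0.
congr measurable_fun; apply/funext => y; rewrite /around [RHS]integral_mkcond.
apply: eq_integral => u _; rewrite patchE /f indicE in_setX in_setT/=.
by case: ifP; rewrite ?mulr1 ?mulr0.
Qed.

(** No stationary path visits these states between its jumps, so they are null for
    the stationary law; all unforced jumps from other states are covered by windows. *)
Definition explosive := inner `&` \bigcap_i [set y | around i y = +oo].

Lemma measurable_explosive : measurable explosive.
Proof.
apply: measurableI; first exact: rf_minner rf.
apply: bigcapT_measurable => i.
have := @maround i measurableT _ (emeasurable_set1 +oo); rewrite setTI; exact.
Qed.

Let small (e : R) : (0 < e)%R -> exists i, (i.+1%:R^-1 < e :> R)%R.
Proof.
move=> e0; have [i _ hi] := @near_infty_natSinv_lt R (PosNum e0).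
by exists i; apply: hi => /=.
Qed.

(** Near the jump, the orbit of the state before it is the orbit of the last
    post-jump state, shifted in time. *)
Lemma nonexplosive_regular w n : good w -> jump_in T h n w -> ~ bd (Y n w) ->
  ~ explosive (Y n w) -> exists j, window c h (rat_seq R j) (Q n w, T n w, wait n w).
Proof.
move=> gw Jw nbd nex; have [QE TH w0 TE wt] := jump_before_exit gw Jw nbd.
have Yi : inner (Y n w) by exact: rf_inner rf _ _ QE w0 wt.
have [i fi] : exists i, around i (Y n w) < +oo.
  apply: contrapT => ni; apply: nex; split => // i _ /=; apply/eqP.
  by rewrite -leye_eq leNgt; apply/negP => fi; apply: ni; exists i.
have [v wv [vt _]] := between_ereal wt wt.
pose e := (Num.min (i.+1%:R^-1) (Num.min (wait n w) (v - wait n w)))%R.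
have e0 : (0 < e)%R by rewrite !lt_min invr_gt0 ltr0n/= w0/= subr_gt0.
have e1 : (e <= i.+1%:R^-1)%R by rewrite ge_min lexx.
have e2 : (e <= wait n w)%R by rewrite !ge_min lexx orbT.
have e3 : (e <= v - wait n w)%R by rewrite !ge_min lexx !orbT.
clearbody e; apply: (@regular_jump w n e) => //.
rewrite -orbit_integral_shift//; last first.
  apply: le_trans (ltW vt); rewrite lee_fin; by rewrite -lerBrDl.
apply: le_lt_trans fi; apply: ge0_subset_integral => //.
- by apply: measurable_funTS; exact: morb.
- by move=> u _; rewrite lee_fin.
- move=> u /=; rewrite !in_itv/= => /andP[u1 u2]; apply/andP; split.
    by apply: le_lt_trans u1; rewrite lerN2.
  exact: lt_le_trans u2 e1.
Qed.

(** Surviving a little beyond [v] bounds the hazard on both sides of [v]. *)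
Lemma nonexplosive_path w v : good w -> (0 < v)%R -> (v < h)%R ->
  (forall n, T n w <> v%:E) -> ~ explosive (X v w).
Proof.
move=> gw v0 vh nj; have vH : v%:E < H by apply: lt_le_trans hH; rewrite lte_fin.
have [n [nv vn QE s0 [st XE]]] := locate_nojump gw v0 vH nj.
have pw := good_proper gw; have TH := lt_trans nv vH.
set s := (v - fine (T n w))%R in s0 st XE.
have vE : T n w + s%:E = v%:E by rewrite (proper_fin pw TH) -EFinD /s addrC subrK.
have [||j [sj _ _ [_ jt hz]]] := survives_later hH pw QE TH (ltW s0).
- by rewrite vE lte_fin.
- by rewrite vE.
move=> [_ ex].
have [|i hi] := @small (Num.min s (rat_seq R j - s))%R.
  by rewrite lt_min s0 subr_gt0.
move: hi; rewrite lt_min => /andP[i1 i2].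
have i0 : (0 < i.+1%:R^-1 :> R)%R by rewrite invr_gt0.
have := ex i Logic.I; rewrite /= /around XE.
move: (i.+1%:R^-1)%R i0 i1 i2 => e e0 es ej.
have es' := ltW es.
rewrite orbit_integral_shift//; last by apply: le_trans (ltW jt); rewrite lee_fin; lra.
move=> aoo; move: hz; rewrite ltNge => /negP; apply; rewrite -aoo.
apply: ge0_subset_integral => //.
- by apply: measurable_funTS; exact: morb.
- by move=> u _; rewrite lee_fin.
- by move=> u /=; rewrite !in_itv/= => /andP[? ?]; apply/andP; split; lra.
Qed.

End regular_jumps.

(** * Approximation in measure by a countable algebra *)

Section countable_algebra.
Context d (Y : measurableType d) (R : realType) (U : nat -> set Y).
Hypothesis generated : @measurable _ Y = <<s range U >>.

(** Formulas serve as codes because they form a countable type; joint denial is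
    enough to generate an algebra. *)
Inductive formula := Basic of nat | Nor of formula & formula.

Fixpoint encode (t : formula) : GenTree.tree nat :=
  match t with
  | Basic n => GenTree.Leaf n
  | Nor a b => GenTree.Node 0 [:: encode a; encode b]
  end.

Fixpoint decode (t : GenTree.tree nat) : option formula :=
  match t with
  | GenTree.Leaf n => Some (Basic n)
  | GenTree.Node _ [:: a; b] =>
    if decode a is Some a' then if decode b is Some b' then Some (Nor a' b') else None
    else None
  | _ => None
  end.

Lemma encodeK : pcancel encode decode.
Proof. by elim=> //= a -> b ->. Qed.

Fixpoint denote (t : formula) : set Y :=
  match t with
  | Basic n => U n
  | Nor a b => ~` (denote a `|` denote b)
  end.

Definition algebra_seq (i : nat) : set Y :=
  if obind decode (unpickle i) is Some t then denote t else set0.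

Lemma algebra_seqP t : exists i, algebra_seq i = denote t.
Proof. by exists (pickle (encode t)); rewrite /algebra_seq pickleK/= encodeK. Qed.

Let mU n : measurable (U n).
Proof. by rewrite generated; apply: sub_sigma_algebra; exists n. Qed.

Lemma measurable_algebra_seq i : measurable (algebra_seq i).
Proof.
rewrite /algebra_seq; case: obind => //; elim=> //= a ma b mb.
by apply: measurableC; exact: measurableU.
Qed.

Variable m : {measure set Y -> \bar R}.
Hypothesis m_fin : m setT < +oo.

Let approximable (B : set Y) := measurable B /\ forall e : R, (0 < e)%R ->
  exists t, m (B `\` denote t) < e%:E /\ m (denote t `\` B) < e%:E.

Let md t : measurable (denote t).
Proof. by have [i <-] := algebra_seqP t; exact: measurable_algebra_seq. Qed.

Let approximableC B : approximable B -> approximable (~` B).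
Proof.
move=> [mB hB]; split; first exact: measurableC.
have dC (V W : set Y) : ~` V `\` ~` W = W `\` V by rewrite !setDE setCK setIC.
by move=> e /hB[t [t1 t2]]; exists (Nor t t); rewrite /= setUid !dC.
Qed.

Let le_m (A B : set Y) : measurable A -> measurable B -> A `<=` B -> m A <= m B.
Proof. by move=> mA mB AB; apply: le_measure; rewrite ?inE. Qed.

Let approximableU A B : approximable A -> approximable B -> approximable (A `|` B).
Proof.
move=> [mA hA] [mB hB]; split; first exact: measurableU.
move=> e e0; have e2 : (0 < e / 2)%R by rewrite divr_gt0.
have [a [a1 a2]] := hA _ e2; have [b [b1 b2]] := hB _ e2.
exists (Nor (Nor a b) (Nor a b)); rewrite /= setUid setCK.
have mAB : measurable (A `|` B) by exact: measurableU.
have mab : measurable (denote a `|` denote b) by exact: measurableU.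
have small (V W : set Y) : measurable V -> measurable W ->
    m V < (e / 2)%:E -> m W < (e / 2)%:E -> m (V `|` W) < e%:E.
  move=> mV mW V1 W1; apply: le_lt_trans (measureU2 _ mV mW) _.
  by rewrite [e]splitr EFinD; exact: lteD.
split.
  apply: (@le_lt_trans _ _ (m ((A `\` denote a) `|` (B `\` denote b)))).
    apply: le_m; first exact: measurableD.
      by apply: measurableU; exact: measurableD.
    by move=> y [[Ay|By] /not_orP[na nb]]; [left|right].
  by apply: small => //; exact: measurableD.
apply: (@le_lt_trans _ _ (m ((denote a `\` A) `|` (denote b `\` B)))).
  apply: le_m; first exact: measurableD.
    by apply: measurableU; exact: measurableD.
  by move=> y [[Ay|By] /not_orP[na nb]]; [left|right].
by apply: small => //; exact: measurableD.
Qed.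

Let approximable_bigcup (F : nat -> set Y) : (forall n, approximable (F n)) ->
  approximable (\bigcup_n F n).
Proof.
move=> hF; have mF : measurable (\bigcup_n F n).
  by apply: bigcup_measurable => n _; have [] := hF n.
split => // e e0; have e2 : (0 < e / 2)%R by rewrite divr_gt0.
pose D n := \big[setU/set0]_(i < n) F i.
have aD n : approximable (D n).
  elim: n => [|n ih]; last by rewrite /D big_ord_recr; exact: approximableU.
  (* The formula denotes the empty set. *)
  rewrite /D big_ord0; split => // e' e0'; exists (Nor (Basic 0) (Nor (Basic 0) (Basic 0))).
  by rewrite /= setUid setUv setCT !setD0 !measure0 lte_fin.
have mD n : measurable (D n) by have [] := aD n.
have [N hN] : exists N, m (\bigcup_n F n `\` D N) < (e / 2)%:E.
  have mG n : measurable (\bigcup_n F n `\` D n) by exact: measurableD.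
  have cap0 : \bigcap_n (\bigcup_n F n `\` D n) = set0.
    apply/seteqP; split=> // y hy; have [[n _ Fn] _] := hy 0%N Logic.I.
    have [_] := hy n.+1 Logic.I; apply.
    by rewrite /D -bigcup_mkord; exists n => /=.
  have : m \o (fun n => \bigcup_n F n `\` D n) @ \oo --> m (\bigcap_n (\bigcup_n F n `\` D n)).
    apply: nonincreasing_cvg_mu => //.
    - by apply: le_lt_trans m_fin; apply: le_m.
    - by rewrite cap0.
    - apply/nonincreasing_seqP => n; apply/subsetPset; apply: setDS.
      by rewrite /D big_ord_recr; exact: subsetUl.
  rewrite cap0 measure0 => /fine_cvgP[_ /cvgrPdist_lt/(_ _ e2)[N _ hN]]; exists N.
  have := hN N (leqnn N); rewrite sub0r normrN /= ger0_norm ?fine_ge0//.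
  rewrite -lte_fin fineK// ge0_fin_numE//.
  by apply: le_lt_trans m_fin; apply: le_m.
have [_ /(_ _ e2)[t [t1 t2]]] := aD N; exists t.
have DF : D N `<=` \bigcup_n F n.
  by rewrite /D -bigcup_mkord; move=> y [n _ Fn]; exists n.
split.
  apply: (@le_lt_trans _ _ (m ((\bigcup_n F n `\` D N) `|` (D N `\` denote t)))).
    apply: le_m; first exact: measurableD.
      by apply: measurableU; exact: measurableD.
    by move=> y [Fy nt]; have [Dy|nD] := pselect (D N y); [right|left].
  apply: le_lt_trans (measureU2 _ (measurableD mF (mD N)) (measurableD (mD N) (md t))) _.
  by rewrite [e]splitr EFinD; exact: lteD.
apply: (@lt_trans _ _ (e / 2)%:E); last by rewrite lte_fin ltr_pdivrMr// ltr_pMr// ltr1n.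
apply: le_lt_trans t2; apply: le_m; [exact: measurableD|exact: measurableD|].
by move=> y [ty nF]; split => // /DF.
Qed.

(** The sets that can be approximated in measure by the algebra form a
    sigma-algebra. *)
Lemma algebra_seq_dense B (e : R) : measurable B -> (0 < e)%R ->
  exists i, m (B `\` algebra_seq i) < e%:E /\ m (algebra_seq i `\` B) < e%:E.
Proof.
move=> mB e0; suff [_ /(_ _ e0)[t ht]] : approximable B.
  by have [i it] := algebra_seqP t; exists i; rewrite it.
have : <<s range U >> B by rewrite -generated.
apply: smallest_sub; last first.
  move=> _ [n _ <-]; split => // e' e0'; exists (Basic n) => /=.
  by rewrite setDv measure0 lte_fin.
split.
- split => // e' e0'; exists (Nor (Basic 0) (Nor (Basic 0) (Basic 0))).
  by rewrite /= setUid setUv setCT !setD0 !measure0 lte_fin.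
- by move=> V /approximableC; rewrite setTD.
- by move=> F hF; exact: approximable_bigcup.
Qed.

End countable_algebra.

(** * Kernel densities on a set of finite measure *)

Section finite_part.
Context dX (X : measurableType dX) dY (Y : measurableType dY) (R : realType).
Variable U : nat -> set Y.
Hypothesis generated : @measurable _ Y = <<s range U >>.
Variables (K : R.-pker X ~> Y) (mu : {measure set Y -> \bar R}) (F : set Y).
Hypotheses (mF : measurable F) (Foo : mu F < +oo).

Local Notation alg := (algebra_seq U).
Let malg i : measurable (alg i).
Proof. exact: measurable_algebra_seq generated i. Qed.

Section restriction.
Variable nu : {measure set Y -> \bar R}.
Hypothesis nuoo : nu F < +oo.

Definition part (A : set Y) : R := fine (nu (A `&` F)).

Lemma partE A : measurable A -> nu (A `&` F) = (part A)%:E.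
Proof.
move=> mA; rewrite fineK// ge0_fin_numE//; apply: le_lt_trans nuoo.
by apply: le_measure; rewrite ?inE//; exact: measurableI.
Qed.

Lemma part_ge0 A : (0 <= part A)%R. Proof. exact: fine_ge0. Qed.

Lemma part_split A B : measurable A -> measurable B ->
  part A = (part (A `&` B) + part (A `\` B))%R.
Proof.
move=> mA mB; apply: EFin_inj; rewrite EFinD -!partE//; last 2 first.
- exact: measurableD.
- exact: measurableI.
rewrite -measureU//; last 3 first.
- by apply: measurableI => //; exact: measurableI.
- by apply: measurableI => //; exact: measurableD.
- by apply/seteqP; split=> // y [[[_ By] _] [[_ /(_ By)]]].
by rewrite -setIUl setUIDK.
Qed.

End restriction.

Let m := part mu.
Let kap x := part (K x).

Let Koo x : K x F < +oo.
Proof.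
apply: (@le_lt_trans _ _ (K x setT)); first by apply: le_measure; rewrite ?inE.
by rewrite prob_kernel ltry.
Qed.

Let mkap A : measurable A -> measurable_fun setT (kap ^~ A).
Proof.
move=> mA; apply: measurableT_comp; first exact: fine_measurable.
by apply: measurable_kernel; exact: measurableI.
Qed.

Let tol (k : nat) : R := (1 / (2 ^ k.+1)%:R)%R.
Let tol_gt0 k : (0 < tol k)%R.
Proof. by rewrite divr_gt0// ltr0n expn_gt0. Qed.

(** For each threshold [q] the set where the density exceeds [q] maximizes
    [kap x B - q * m B]. A maximizer up to [tol k] is taken in the countable
    algebra, with the least possible index to make the choice measurable in [x]. *)
Definition near_max q k i := [set x | forall j,
  (kap x (alg j) - q * m (alg j) <= kap x (alg i) - q * m (alg i) + tol k)%R].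

Definition chosen q k : set (X * Y) :=
  \bigcup_i (seqDU (near_max q k) i `*` alg i).

Let measurable_near_max q k i : measurable (near_max q k i).
Proof.
rewrite (_ : near_max q k i = \bigcap_j [set x |
    (kap x (alg j) - q * m (alg j) <= kap x (alg i) - q * m (alg i) + tol k)%R]).
  apply: bigcapT_measurable => j; apply: measurable_bool_set.
  have mk i' : measurable_fun setT (fun x => kap x (alg i') - q * m (alg i'))%R.
    by apply: measurable_funB => //; exact: mkap.
  by apply: measurable_fun_ler => //; exact: measurable_funD.
by apply/seteqP; split=> x h => [j _|j]; apply: h.
Qed.

Lemma measurable_chosen q k : measurable (chosen q k).
Proof.
apply: bigcup_measurable => i _; apply: measurableX => //.
by apply: seqDU_measurable => j; exact: measurable_near_max.
Qed.

Let near_max_ex q k x : (0 <= q)%R -> exists i, near_max q k i x.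
Proof.
move=> q0; pose V := [set (kap x (alg i) - q * m (alg i))%R | i in [set: nat]].
have supV : has_sup V.
  split; first by exists (kap x (alg 0) - q * m (alg 0))%R, 0%N.
  exists 1%R => _ [i _ <-].
  have : (kap x (alg i) <= 1)%R.
    rewrite -lee_fin -partE// -(@prob_kernel _ _ _ _ _ K x).
    by apply: le_measure; rewrite ?inE//; exact: measurableI.
  have : (0 <= q * m (alg i))%R by rewrite mulr_ge0// part_ge0.
  by move: (q * m (alg i))%R (kap x (alg i)) => a b; lra.
have [_ [i _ <-] hi] := sup_adherent (tol_gt0 k) supV.
exists i => j; have : (kap x (alg j) - q * m (alg j) <= sup V)%R.
  by apply: ub_le_sup; [exact: supV.2|exists j].
move: hi; move: (sup V) (kap x (alg j) - q * m (alg j))%R => s a.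
move: (kap x (alg i) - q * m (alg i))%R (tol k) => b t; lra.
Qed.

Let chosenP q k x : (0 <= q)%R -> exists A, [/\ measurable A,
  forall y, chosen q k (x, y) <-> A y &
  forall B, measurable B -> (kap x B - q * m B <= kap x A - q * m A + tol k)%R].
Proof.
move=> q0; have : (\bigcup_i near_max q k i) x.
  by have [i] := near_max_ex k x q0; exists i.
rewrite seqDU_bigcup_eq => -[i _ xi]; exists (alg i); split => //.
  move=> y; split=> [[i' _ [/= xi' Ay]]|Ay]; last by exists i.
  suff -> : i = i' by [].
  by apply: (@trivIset_seqDU _ (near_max q k) i i') => //; exists x.
move=> B mB.
have xm : near_max q k i x by move: xi; apply: subset_seqDU.
(* The error of approximation enters once through [kap] and [q] times through
   [m]. *)
apply/ler_addgt0Pr => e e0; pose e' := (e / (1 + q))%R.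
have q1 : (0 < 1 + q)%R by lra.
have e0' : (0 < e')%R by rewrite divr_gt0.
pose M := measure_add (mrestr mu mF) (mrestr (K x) mF).
have ME V : measurable V -> M V = mu (V `&` F) + K x (V `&` F).
  by move=> mV; rewrite /M measure_addE.
have Moo : M setT < +oo.
  by rewrite [X in X < _]ME// setTI; apply: lte_add_pinfty.
have [j [h1 h2]] := algebra_seq_dense generated Moo mB e0'.
have mD1 := measurableD mB (malg j); have mD2 := measurableD (malg j) mB.
have a1 : (kap x (B `\` alg j) <= e')%R.
  rewrite -lee_fin -partE//; apply/ltW/(le_lt_trans _ h1).
  by rewrite [leRHS]ME// leeDr.
have a2 : (m (alg j `\` B) <= e')%R.
  rewrite -lee_fin -partE//; apply/ltW/(le_lt_trans _ h2).
  by rewrite [leRHS]ME// leeDl.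
have b1 := part_split (Koo x) mB (malg j).
have b2 := part_split (Koo x) (malg j) mB.
have c1 := part_split Foo mB (malg j).
have c2 := part_split Foo (malg j) mB.
rewrite -/m -/(kap x) [alg j `&` B]setIC in b1 b2 c1 c2.
have xj := xm j.
have p1 := part_ge0 (K x) (alg j `\` B); have p2 := part_ge0 mu (B `\` alg j).
rewrite -/m -/(kap x) in p1 p2.
have eE : (e = e' + q * e')%R by rewrite /e'; field; rewrite gt_eqF.
have q2 : (q * m (alg j `\` B) <= q * e')%R by rewrite ler_wpM2l.
have q3 : (0 <= q * m (B `\` alg j))%R by rewrite mulr_ge0.
rewrite b1 c1 eE; rewrite b2 c2 in xj; rewrite !mulrDr in xj *.
move: (kap x (alg i) - q * m (alg i))%R xj => z xj.
move: (q * m (B `&` alg j))%R (q * m (alg j `\` B))%R (q * m (B `\` alg j))%R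
  (q * e')%R xj q2 q3 => z1 z2 z3 z4 xj q2 q3.
lra.
Qed.

(** By Borel-Cantelli this lower limit is, almost everywhere and away from equality,
    the set where the density exceeds [q]. *)
Definition exceeds q := \bigcup_n \bigcap_(k in [set k | (n <= k)%N]) chosen q k.

Let measurable_exceeds q : measurable (exceeds q).
Proof.
apply: bigcup_measurable => n _; apply: bigcap_measurable; first by exists n => /=.
by move=> k _; exact: measurable_chosen.
Qed.

Definition threshold l : R := Num.max 0%R (rat_seq R l).

Let threshold_ge0 l : (0 <= threshold l)%R.
Proof. by rewrite /threshold le_max lexx. Qed.

Definition level_density (z : X * Y) : \bar R :=
  esups (fun l => (threshold l * \1_(exceeds (threshold l)) z)%:E) 0%N.

Lemma measurable_level_density : measurable_fun setT level_density.
Proof.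
apply: (@measurable_fun_esups _ _ _ setT
  (fun l z => (threshold l * \1_(exceeds (threshold l)) z)%:E)) => l.
by apply/measurable_EFinP; apply: measurable_funM => //; exact: measurable_indic.
Qed.

Lemma level_density_ge0 z : 0 <= level_density z.
Proof.
apply: le_ereal_sup_tmp; exists (threshold 0%N * \1_(exceeds (threshold 0%N)) z)%:E.
  by exists 0%N.
by rewrite lee_fin mulr_ge0// indicE.
Qed.

Section fixed_state.
Variables (x : X) (f : Y -> R).
Hypotheses (mf : measurable_fun setT f) (f0 : forall y, (0 <= f y)%R)
  (Kf : forall A, measurable A -> K x A = \int[mu]_(y in A) (f y)%:E).

Let bound_below c A : (0 <= c)%R -> measurable A ->
  (forall y, A y -> (c <= f y)%R) -> (c * m A <= kap x A)%R.
Proof.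
move=> c0 mA cf; have mAF : measurable (A `&` F) by exact: measurableI.
rewrite -lee_fin EFinM -!partE// Kf// -(@integral_cst _ _ _ mu _ mAF).
apply: ge0_le_integral => //.
- by apply: measurable_funTS; exact/measurable_EFinP.
- by move=> y [Ay _]; rewrite lee_fin; exact: cf.
Qed.

Let bound_above c A : (0 <= c)%R -> measurable A ->
  (forall y, A y -> (f y <= c)%R) -> (kap x A <= c * m A)%R.
Proof.
move=> c0 mA cf; have mAF : measurable (A `&` F) by exact: measurableI.
rewrite -lee_fin EFinM -!partE// Kf// -(@integral_cst _ _ _ mu _ mAF).
apply: ge0_le_integral => //.
- by move=> y _; rewrite lee_fin.
- by apply: measurable_funTS; exact/measurable_EFinP.
- by move=> y [Ay _]; rewrite lee_fin; exact: cf.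
Qed.

Let mge c : measurable [set y | (c <= f y)%R].
Proof. by apply: measurable_bool_set; exact: measurable_fun_ler. Qed.
Let mle c : measurable [set y | (f y <= c)%R].
Proof. by apply: measurable_bool_set; exact: measurable_fun_ler. Qed.
Let mgt c : measurable [set y | (c < f y)%R].
Proof. by apply: measurable_bool_set; exact: measurable_fun_ltr. Qed.

Let mchosen q k : measurable [set y | chosen q k (x, y)].
Proof.
have : measurable (xsection (chosen q k) x).
  by apply: measurable_xsection; exact: measurable_chosen.
by congr measurable; apply/seteqP; split=> y; rewrite /xsection/= inE.
Qed.

(** Where the density differs from [q] by [e] the near-maximizer is wrong only on
    a set of measure [tol k / e]. *)
Let error_bounds q e k : (0 <= q)%R -> (0 < e)%R ->
  (e * m ([set y | (q + e <= f y)%R] `\` [set y | chosen q k (x, y)]) <= tol k)%R /\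
  (e * m ([set y | (f y <= q - e)%R] `&` [set y | chosen q k (x, y)]) <= tol k)%R.
Proof.
move=> q0 e0; have [A [mA AE hA]] := chosenP k x q0.
have -> : [set y | chosen q k (x, y)] = A.
  by apply/seteqP; split=> y /= /AE.
pose B := [set y | (q < f y)%R]; have mB : measurable B := mgt q.
have := hA _ mB.
have b1 := part_split (Koo x) mB mA; have b2 := part_split (Koo x) mA mB.
have c1 := part_split Foo mB mA; have c2 := part_split Foo mA mB.
rewrite -/m -/(kap x) [A `&` B]setIC in b1 b2 c1 c2.
rewrite b1 b2 c1 c2 !mulrDr.
have mBA := measurableD mB mA; have mAB := measurableD mA mB.
have over : (q * m (B `\` A) <= kap x (B `\` A))%R.
  by apply: bound_below => // y [/= qf _]; exact: ltW.
have under : (kap x (A `\` B) <= q * m (A `\` B))%R.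
  by apply: bound_above => // y [_ /= /negP]; rewrite -leNgt.
move=> h; split.
- set D := [set y | (q + e <= f y)%R]; have mD : measurable D := mge _.
  have DB : (B `\` A) `&` D = D `\` A.
    apply/seteqP; split=> y; first by move=> [[_ nA] Dy].
    by move=> [Dy nA]; split => //; split => //=; apply: lt_le_trans Dy; rewrite ltrDl.
  have s1 := part_split (Koo x) mBA mD; have s2 := part_split Foo mBA mD.
  rewrite -/m -/(kap x) DB in s1 s2.
  have d1 : ((q + e) * m (D `\` A) <= kap x (D `\` A))%R.
    by apply: bound_below => [||y []//]; [lra|exact: measurableD].
  have d2 : (q * m ((B `\` A) `\` D) <= kap x ((B `\` A) `\` D))%R.
    by apply: bound_below => [//||y [[/= qf _] _]]; [exact: measurableD|exact: ltW].
  rewrite s1 s2 mulrDr in h; rewrite mulrDl in d1.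
  move: h under d1 d2.
  move: (q * m (B `&` A))%R (q * m (A `\` B))%R (q * m (D `\` A))%R
    (e * m (D `\` A))%R (q * m ((B `\` A) `\` D))%R => z1 z2 z3 z4 z5.
  by move=> *; lra.
- set D := [set y | (f y <= q - e)%R]; have mD : measurable D := mle _.
  have DB : (A `\` B) `&` D = D `&` A.
    apply/seteqP; split=> y; first by move=> [[Ay _] Dy].
    move=> [Dy Ay]; split => //; split => //= qf.
    by move: Dy; rewrite /D/= leNgt => /negP; apply; apply: lt_trans qf; rewrite ltrBlDr ltrDl.
  have [qe|qe] := leP 0%R (q - e)%R; last first.
    rewrite (_ : D `&` A = set0); last first.
      apply/seteqP; split=> // y [Dy _]; have := f0 y; rewrite leNgt => /negP; apply.
      exact: le_lt_trans Dy qe.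
    by rewrite /m /part set0I measure0/= mulr0 ltW.
  have s1 := part_split (Koo x) mAB mD; have s2 := part_split Foo mAB mD.
  rewrite -/m -/(kap x) DB in s1 s2.
  have d1 : (kap x (D `&` A) <= (q - e) * m (D `&` A))%R.
    by apply: bound_above => [//||y []//]; exact: measurableI.
  have d2 : (kap x ((A `\` B) `\` D) <= q * m ((A `\` B) `\` D))%R.
    apply: bound_above => [//||y [[_ /= /negP]]]; first exact: measurableD.
    by rewrite -leNgt.
  rewrite s1 s2 mulrDr in h; rewrite mulrBl in d1.
  move: h over d1 d2.
  move: (q * m (A `&` B))%R (q * m (B `\` A))%R (q * m (D `&` A))%R
    (e * m (D `&` A))%R (q * m ((A `\` B) `\` D))%R => z1 z2 z3 z4 z5.
  by move: (q * m (B `&` A))%R => z6 *; lra.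
Qed.

Let borel_cantelli (V : nat -> set Y) e : (0 < e)%R -> (forall k, measurable (V k)) ->
  (forall k, (e * m (V k) <= tol k)%R) ->
  {ae mu, forall y, F y -> exists n, forall k, (n <= k)%N -> ~ V k y}.
Proof.
move=> e0 mV hV; pose W k := V k `&` F.
have mW k : measurable (W k) by exact: measurableI.
exists (lim_sup_set W); split.
- by apply: bigcapT_measurable => n; apply: bigcup_measurable.
- apply: lim_sup_set_cvg0 => //.
  apply: (@le_lt_trans _ _ (\sum_(k <oo) (e^-1 / (2 ^ k.+1)%:R)%:E)).
    apply: lee_nneseries => // k _; rewrite partE// lee_fin -/m.
    by rewrite -(ler_pM2l e0) mulrA mulfV ?gt_eqF//; exact: hV.
  apply: le_lt_trans (epsilon_trick0 _ _) (ltry _).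
  by rewrite invr_ge0 ltW.
- move=> y /= /not_implyP[Fy hy] n _; apply: contrapT => nW; apply: hy; exists n.
  by move=> k nk Vk; apply: nW; exists k.
Qed.

(** A function is the supremum of the rational thresholds that it exceeds. *)
Lemma level_densityP : {ae mu, forall y, F y -> level_density (x, y) = (f y)%:E}.
Proof.
have bc1 l j : {ae mu, forall y, F y -> exists n, forall k, (n <= k)%N ->
    ~ ([set y | (threshold l + j.+1%:R^-1 <= f y)%R] `\`
       [set y | chosen (threshold l) k (x, y)]) y}.
  apply: (@borel_cantelli _ (j.+1%:R^-1)%R); first by rewrite invr_gt0.
    by move=> k; apply: measurableD => //; exact: mge.
  by move=> k; apply: (error_bounds _ _ _).1; rewrite ?invr_gt0.
have bc2 l j : {ae mu, forall y, F y -> exists n, forall k, (n <= k)%N ->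
    ~ ([set y | (f y <= threshold l - j.+1%:R^-1)%R] `&`
       [set y | chosen (threshold l) k (x, y)]) y}.
  apply: (@borel_cantelli _ (j.+1%:R^-1)%R); first by rewrite invr_gt0.
    by move=> k; apply: measurableI => //; exact: mle.
  by move=> k; apply: (error_bounds _ _ _).2; rewrite ?invr_gt0.
have b1 := ae_foralln (fun l => ae_foralln (bc1 l)).
have b2 := ae_foralln (fun l => ae_foralln (bc2 l)).
apply: filter_app b2; apply: filterS b1 => y h1 h2 Fy.
have small (e : R) : (0 < e)%R -> exists j, (j.+1%:R^-1 < e :> R)%R.
  by move=> e0; have [j _ hj] := @near_infty_natSinv_lt R (PosNum e0); exists j; apply: hj => /=.
have in_level l : (threshold l < f y)%R -> exceeds (threshold l) (x, y).
  rewrite -subr_gt0 => /small[j jf]; have [n hn] := h1 l j Fy.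
  exists n => // k /= nk; apply: contrapT => nc; apply: (hn k nk); split => //=.
  by rewrite -lerBrDl ltW.
have out_level l : (f y < threshold l)%R -> ~ exceeds (threshold l) (x, y).
  rewrite -subr_gt0 => /small[j jf] [n _ hn]; have [n' hn'] := h2 l j Fy.
  apply: (hn' (maxn n n')); first exact: leq_maxr.
  split; last by apply: hn => /=; exact: leq_maxl.
  by rewrite /= lerBrDl -lerBrDr ltW.
apply/eqP; rewrite eq_le; apply/andP; split.
  apply: ge_ereal_sup => _ [l _ <-]; rewrite lee_fin indicE.
  case: (boolP (_ \in _)) => [/set_mem ex|_]; last by rewrite mulr0.
  by rewrite mulr1 leNgt; apply/negP => /out_level.
rewrite leNgt; apply/negP => lt_f.
have ld_fin : level_density (x, y) \is a fin_num.
  by rewrite ge0_fin_numE ?level_density_ge0// (lt_trans lt_f)// ltry.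
move: lt_f; rewrite -(fineK ld_fin) lte_fin => /rat_seq_dense[l /andP[l1 l2]].
have l0 : (0 <= fine (level_density (x, y)))%R by rewrite fine_ge0// level_density_ge0.
have tl : threshold l = rat_seq R l by rewrite /threshold max_r// (le_trans l0)// ltW.
have : (threshold l)%:E <= level_density (x, y).
  apply: le_ereal_sup_tmp; exists (threshold l * \1_(exceeds (threshold l)) (x, y))%:E.
    by exists l.
  by rewrite indicE mem_set ?mulr1//; apply: in_level; rewrite tl.
by rewrite -(fineK ld_fin) lee_fin leNgt tl l1.
Qed.

End fixed_state.

End finite_part.

(** * Jointly measurable kernel densities *)

Section joint_density.
Context dX (X : measurableType dX) dY (Y : measurableType dY) (R : realType).
Variable U : nat -> set Y.
Hypothesis generated : @measurable _ Y = <<s range U >>.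
Variables (K : R.-pker X ~> Y) (mu : {sigma_finite_measure set Y -> \bar R}).

(** The pieces of finite measure are treated one by one. *)
Theorem jointly_measurable_density : exists p : X -> Y -> \bar R,
  [/\ measurable_fun setT (fun z : X * Y => p z.1 z.2), forall x y, 0 <= p x y &
      forall x, (K x : set Y -> \bar R) `<< mu ->
      forall B, measurable B -> K x B = \int[mu]_(y in B) p x y].
Proof.
have [F TF /all_and2[mF Foo]] := sigma_finiteT mu.
pose D := seqDU F.
have mD j : measurable (D j) by exact: seqDU_measurable.
have Doo j : mu (D j) < +oo.
  by apply: le_lt_trans (Foo j); apply: le_measure; rewrite ?inE//; exact: subset_seqDU.
pose g j (z : X * Y) := level_density U K mu (D j) z * (\1_(D j) z.2)%:E.
have g0 j z : 0 <= g j z.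
  by apply: mule_ge0; [exact: level_density_ge0|rewrite lee_fin indicE].
have mg j : measurable_fun setT (g j).
  apply: emeasurable_funM; first exact: (measurable_level_density generated K mu (mD j)).
  apply/measurable_EFinP.
  have mi : measurable_fun setT (\1_(D j) : Y -> R) by exact: measurable_indic.
  exact: (measurableT_comp mi measurable_snd).
exists (fun x y => \sum_(j <oo) g j (x, y)); split.
- have := ge0_emeasurable_sum (D := setT) (P := xpredT) (fun j z _ _ => g0 j z) (fun j _ => mg j).
  by congr measurable_fun; apply/funext => -[x y].
- by move=> x y; exact: nneseries_ge0.
move=> x Kmu.
have KT : K x setT < +oo by rewrite prob_kernel ltry.
have Kmu' : (mfrestr measurableT KT : set Y -> \bar R) `<< mu.
  apply/null_content_dominatesP => A mA A0.
  by rewrite /mfrestr/= /mrestr setIT; move/null_content_dominatesP : Kmu; exact.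
have [f [f0 ffin /integrableP[mf _] Kf]] := radon_nikodym_sigma_finite Kmu'.
have fE y : f y = (fine (f y))%:E by rewrite fineK.
have Kf' A : measurable A -> K x A = \int[mu]_(y in A) (fine (f y))%:E.
  move=> mA; transitivity (\int[mu]_(y in A) f y).
    by rewrite -Kf//; change (K x A = K x (A `&` setT)); rewrite setIT.
  by apply: eq_integral => y _.
have mf' : measurable_fun setT (fun y => fine (f y)).
  by apply: measurableT_comp => //; exact: fine_measurable.
have f0' y : (0 <= fine (f y))%R by rewrite fine_ge0.
have ld := ae_foralln (fun j => level_densityP generated (mD j) (Doo j) mf' f0' Kf').
move=> B mB; rewrite Kf'//; apply: ge0_ae_eq_integral => //.
- by apply: measurable_funTS; exact/measurable_EFinP.
- apply: measurable_funTS; apply: ge0_emeasurable_sum => // j _.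
  exact: (measurableT_comp (mg j) (pair1_measurable x)).
- by move=> y _; rewrite lee_fin.
- by move=> y _; apply: nneseries_ge0 => n _ _; exact: g0.
apply: filterS ld => y hy _.
have [j _ Dj] : (\bigcup_j D j) y by rewrite -seqDU_bigcup_eq -TF.
rewrite nneseries_esumT// (_ : \esum_(i in _) _ = \esum_(i in [set j]) g i (x, y)).
  by rewrite esum_set1// /g hy// indicE mem_set// mule1.
rewrite [RHS]esum_mkcond; apply: eq_esum => i _; case: ifPn => // /negP ij.
rewrite /g indicE (_ : _ \in _ = false) ?mule0//; apply/negbTE/negP => /set_mem Di.
apply: ij; apply/mem_set; apply: (@trivIset_seqDU _ F) => //.
by exists y.
Qed.

End joint_density.

(** Unlike [weighted_law], the density may be infinite. *)
Section density_measure.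
Context d (T : measurableType d) (R : realType) (m : {measure set T -> \bar R}).
Variables (g : T -> \bar R).
Hypotheses (mg : measurable_fun setT g) (g0 : forall x, 0 <= g x).

Definition density_measure of measurable_fun setT g & (forall x, 0 <= g x) :=
  fun A : set T => \int[m]_(x in A) g x.
Local Notation dm := (density_measure mg g0).

Let dm0 : dm set0 = 0. Proof. exact: integral_set0. Qed.
Let dm_ge0 A : 0 <= dm A. Proof. by apply: integral_ge0 => x _. Qed.
Let dm_sigma : semi_sigma_additive dm.
Proof.
move=> F mF tF mUF; rewrite /density_measure ge0_integral_bigcup//; last exact: measurable_funTS.
by apply: is_cvg_nneseries => n _ _; apply: integral_ge0 => x _.
Qed.

HB.instance Definition _ := isMeasure.Build d T R dm dm0 dm_ge0 dm_sigma.

End density_measure.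

Lemma algebra_seq_unique d (Y : measurableType d) (R : realType) (U : nat -> set Y)
    (m1 m2 : {measure set Y -> \bar R}) :
  @measurable _ Y = <<s range U >> ->
  (forall i, m1 (algebra_seq U i) = m2 (algebra_seq U i)) -> m1 setT < +oo ->
  forall A, measurable A -> m1 A = m2 A.
Proof.
move=> gen m12 m1oo A mA; have malg := measurable_algebra_seq gen.
apply: (measure_unique (range (algebra_seq U)) (fun=> setT)) => //.
- rewrite gen; apply/seteqP; split.
    apply: smallest_sub; first exact: smallest_sigma_algebra.
    move=> _ [n _ <-]; apply: sub_sigma_algebra.
    by have [i iE] := algebra_seqP U (Basic n); exists i.
  apply: smallest_sub; first exact: smallest_sigma_algebra.
  by move=> _ [i _ <-]; have := malg i; rewrite gen.
- move=> _ _ [i _ <-] [j _ <-].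
  have alg_denote i' : exists t, algebra_seq U i' = denote U t.
    rewrite /algebra_seq; case: obind => [t|]; first by exists t.
    exists (Nor (Basic 0) (Nor (Basic 0) (Basic 0))).
    by rewrite /= setUid setUv setCT.
  have [a ->] := alg_denote i; have [b ->] := alg_denote j.
  (* By De Morgan this denotes the intersection. *)
  have [l lE] := algebra_seqP U (Nor (Nor a a) (Nor b b)).
  by exists l => //; rewrite lE /= !setUid -setCI setCK.
- (* The negation of the empty set. *)
  move=> _; have [l lE] := algebra_seqP U (Nor (Nor (Basic 0) (Nor (Basic 0) (Basic 0)))
    (Nor (Basic 0) (Nor (Basic 0) (Basic 0)))).
  exists l => //; rewrite lE /= !setUid.
  by apply/seteqP; split=> // y _ /=; tauto.
- by rewrite bigcup_const.
- by move=> _ [i _ <-]; exact: m12.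
Qed.

(** * Identities between densities *)

Section exchange_densities.
Context d (S : measurableType d) (R : realType) (U : nat -> set S).
Hypothesis generated : @measurable _ S = <<s range U >>.
Variables (mu : {sigma_finite_measure set S -> \bar R})
  (W : {finite_measure set S -> \bar R}) (L : R.-pker S ~> S) (D : set S)
  (p : S * S -> \bar R) (q : S -> R).
Hypotheses (mD : measurable D) (mp : measurable_fun setT p) (p0 : forall z, 0 <= p z)
  (mq : measurable_fun setT q) (q0 : forall y, (0 <= q y)%R)
  (qoo : \int[mu]_y (q y)%:E < +oo).
Hypothesis exchange : forall A B, measurable A -> measurable B -> A `<=` D ->
  \int[mu]_(y in B) (L y A * (q y)%:E) = \int[W]_(x in A) \int[mu]_(y in B) p (x, y).

Let pA A : S * S -> \bar R := fun z => p z * (\1_A z.1)%:E.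

Let mpA A : measurable A -> measurable_fun setT (pA A).
Proof.
move=> mA; apply: emeasurable_funM => //; apply/measurable_EFinP.
have mi : measurable_fun setT (\1_A : S -> R) by exact: measurable_indic.
exact: (measurableT_comp mi measurable_fst).
Qed.

Let pA0 A z : 0 <= pA A z.
Proof. by apply: mule_ge0 => //; rewrite lee_fin indicE. Qed.

Let pAE A y : \int[W]_(x in A) p (x, y) = \int[W]_x pA A (x, y).
Proof.
rewrite integral_mkcond; apply: eq_integral => x _; rewrite patchE /pA indicE.
by case: ifP => _; rewrite ?mule1 ?mule0.
Qed.

Let mLq A : measurable A -> measurable_fun setT (fun y => L y A * (q y)%:E).
Proof.
move=> mA; apply: emeasurable_funM; first exact: measurable_kernel.
exact/measurable_EFinP.
Qed.

Let Lq_int A : measurable A -> mu.-integrable setT (fun y => L y A * (q y)%:E).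
Proof.
move=> mA; apply/integrableP; split; first exact: mLq.
apply: le_lt_trans qoo; apply: ge0_le_integral => //.
- by apply: measurableT_comp => //; exact: mLq.
- exact/measurable_EFinP.
- move=> y _; rewrite gee0_abs ?mule_ge0// ?lee_fin//.
  rewrite -[leRHS]mul1e lee_wpmul2r// ?lee_fin// -(@prob_kernel _ _ _ _ _ L y).
  by apply: le_measure; rewrite ?inE.
Qed.

Let exchange_ae A : measurable A -> A `<=` D ->
  {ae mu, forall y, L y A * (q y)%:E = \int[W]_(x in A) p (x, y)}.
Proof.
move=> mA AD; have mG : measurable_fun setT (fun y => \int[W]_(x in A) p (x, y)).
  have := measurable_fun_fubini_tonelli_G (m1 := W) (pA A) (mpA mA) (@pA0 A).
  by congr measurable_fun; apply/funext => y; rewrite pAE.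
suff : ae_eq mu setT (fun y => L y A * (q y)%:E) (fun y => \int[W]_(x in A) p (x, y)).
  by apply: filterS => y; exact.
apply: integral_ae_eq => //; first exact: Lq_int.
move=> B _ mB; rewrite exchange//.
pose G (z : S * S) := pA A z * (\1_B z.2)%:E.
have mGG : measurable_fun setT G.
  apply: emeasurable_funM; first exact: mpA.
  apply/measurable_EFinP.
  have mi : measurable_fun setT (\1_B : S -> R) by exact: measurable_indic.
  exact: (measurableT_comp mi measurable_snd).
have GG0 z : 0 <= G z by apply: mule_ge0 => //; rewrite lee_fin indicE.
transitivity (\int[W]_x \int[mu]_y G (x, y)).
  rewrite [LHS]integral_mkcond; apply: eq_integral => x _; rewrite patchE /G /pA/=.
  case: ifPn => xA; last first.
    rewrite integral0_eq// => y _; rewrite indicE (negbTE xA) mule0 mul0e//.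
  rewrite [LHS]integral_mkcond; apply: eq_integral => y _; rewrite patchE.
  rewrite indicE xA mule1 indicE; by case: ifP => _; rewrite ?mule1 ?mule0.
have := fubini_tonelli (m1 := W) (m2 := mu) G mGG GG0; move=> e; apply: etrans e _.
rewrite [RHS]integral_mkcond; apply: eq_integral => y _; rewrite patchE /G/= indicE.
case: ifP => yB; last by rewrite integral0_eq// => x _; rewrite mule0.
by rewrite pAE; apply: eq_integral => x _; rewrite mule1.
Qed.

(** An identity between measures for every [y] outside a single null set, because
    measures are determined by their values on a countable algebra. *)
Lemma exchange_densities : {ae mu, forall y A, measurable A -> A `<=` D ->
  (q y)%:E * L y A = \int[W]_(x in A) p (x, y)}.
Proof.
have malg := measurable_algebra_seq generated.
have all_codes : {ae mu, forall y i, L y (algebra_seq U i `&` D) * (q y)%:E =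
    \int[W]_(x in algebra_seq U i `&` D) p (x, y)}.
  by apply: ae_foralln => i; apply: exchange_ae => //; exact: measurableI.
apply: filterS all_codes => y hy A mA AD.
have mpy : measurable_fun setT (fun x => p (x, y)).
  exact: (measurableT_comp mp (pair2_measurable y)).
pose m1 : {measure set S -> \bar R} := mscale (NngNum (q0 y)) (mrestr (L y) mD).
pose m2 : {measure set S -> \bar R} :=
  mrestr (density_measure W mpy (fun x => p0 (x, y))) mD.
have m1E B : m1 B = (q y)%:E * L y (B `&` D) by [].
have m2E B : m2 B = \int[W]_(x in B `&` D) p (x, y) by [].
have AE : A = A `&` D by apply/esym/setIidPl.
rewrite {1}AE -m1E [in RHS]AE -m2E; apply: (algebra_seq_unique generated) => //.
  by move=> i; rewrite m1E m2E -hy muleC.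
rewrite m1E setTI; apply: (@le_lt_trans _ _ ((q y)%:E * 1)); last by rewrite mule1 ltry.
rewrite lee_wpmul2l ?lee_fin// -(@prob_kernel _ _ _ _ _ L y).
by apply: le_measure; rewrite ?inE.
Qed.

End exchange_densities.

(** * The reversed characteristics *)

Section set_function_integral.
Import HBNNSimple.

(** The integral with respect to a set function only sees its values on measurable
    sets, whether or not it is bundled as a measure. *)
Lemma eq_set_function_integral d (T : measurableType d) (R : realType)
    (m1 m2 : set T -> \bar R) (D : set T) (f : T -> \bar R) :
  (forall A, measurable A -> m1 A = m2 A) ->
  \int[m1]_(x in D) f x = \int[m2]_(x in D) f x.
Proof.
move=> m12; rewrite /integral.
by congr (ereal_sup _ - ereal_sup _); apply/seteqP; split=> _ [h hg <-];
  exists h => //; apply: eq_fsbigr => r _; rewrite m12.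
Qed.

End set_function_integral.

Theorem proposition5 (R : realType) (k : nat) (dim : 'I_k.+1 -> nat)
  (* open sets, vector fields and flow *)
  (Eo : forall i : 'I_k.+1, set 'rV[R]_(dim i))
  (r : forall i : 'I_k.+1, 'rV[R]_(dim i) -> 'rV[R]_(dim i))
  (hflow : flow_setting Eo r)
  (* jump intensity and jump measures of X *)
  (lambda : state R dim -> R)
  (mu_ : R.-pker (state R dim) ~> (state R dim)) :
  let phi := flow Eo r in
  let E0 := interior_states Eo in
  let E := states Eo r in
  let Es := reversed_states Eo r in
  let Gamma := active_boundary Eo r in
  let Gammas := passive_boundary Eo r in
  let c := PdmpData phi E Gamma lambda mu_ in
  forall
  (hc : pdmp_data_wf c)
  (hA1 : forall x, E x -> exists2 e : R, (0 < e)%R &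
     cumulative_rate phi lambda x `[0%R, e] < +oo)
  (hA2 : forall x, E x -> exit_time c x = +oo ->
     cumulative_rate phi lambda x `[0%R, +oo[ = +oo)
  (hA3 : finite_expected_jumps c)
  (hA4 : no_self_jump c)
  (* the stationary process X started with nu *)
  (d : measure_display) (Omega : measurableType d) (P : probability Omega R)
  (X : R -> Omega -> state R dim) (T : nat -> Omega -> \bar R)
  (Q : nat -> Omega -> state R dim) (hX : is_pdmp P c +oo X T Q)
  (nu : probability (state R dim) R) (hnuE : nu (~` E) = 0)
  (hstart : forall B, measurable B -> P (Q 0%N @^-1` B) = nu B)
  (hB1 : stationary_law P X nu)
  (hB2 : \int[nu]_(x in E) (lambda x)%:E < +oo)
  (hB3 : {within E, continuous lambda})
  (hB4 : forall A x, measurable A -> A `<=` E -> E x ->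
     (fun h : R => mu_ (phi x h) A) @
       within (flow_defined Eo r x) (nbhs (0%R : R)) --> mu_ x A)
  (hB5 : forall e : R, (0 < e)%R -> \forall h \near (0%R : R)^'+,
     forall x, Gamma x ->
     mu_ x [set y | E y /\ hitting_time phi Gamma y < h%:E] < e%:E)
  (* the boundary measure of X *)
  (sigma : {finite_measure set (state R dim) -> \bar R})
  (hsigma : is_boundary_measure P c +oo X T sigma),
  let xi := total_rate c nu sigma in
  let piW := pi_W c nu sigma in
  let piQ := pi_Q c nu sigma in
  forall
  (* (D1) and (D2) *)
  (beta : state R dim -> R)
  (hbeta_meas : measurable_fun E0 beta)
  (hbeta_ge0 : forall y, E0 y -> (0 <= beta y)%R)
  (hD1 : forall B, measurable B -> B `<=` E0 ->
     piQ B = \int[nu]_(y in B) (beta y)%:E)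
  (hD2 : forall x, Es x -> exists2 e : R, (0 < e)%R &
     cumulative_rate (fun y s => phi y (- s)%R) beta x `[0%R, e] < +oo)
  (* the time reversal of X on [0, tT] and its characteristics *)
  (tT : R) (htT : (0 < tT)%R)
  (Xs : R -> Omega -> state R dim) (hrev : is_time_reversal P tT X Xs)
  (lambdas : state R dim -> R)
  (mus_ : R.-pker (state R dim) ~> (state R dim)),
  let cs := PdmpData (fun x t => phi x (- t)%R) Es Gammas lambdas mus_ in
  forall
  (hcs : pdmp_data_wf cs) (hcs_A4 : no_self_jump cs)
  (Ts : nat -> Omega -> \bar R) (Qs : nat -> Omega -> state R dim)
  (hXs : is_pdmp P cs tT%:E Xs Ts Qs)
  (sigmas : {measure set (state R dim) -> \bar R})
  (hsigmas : is_boundary_measure P cs tT%:E Xs Ts sigmas)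
  (* the dominating measure *)
  (mu : {sigma_finite_measure set (state R dim) -> \bar R})
  (hmuE : mu (~` E) = 0)
  (hdom : forall x, Es x -> (mu_ x : set (state R dim) -> \bar R) `<< mu),
  piQ `<< mu /\
  (exists p, is_kernel_density mu_ Es mu p) /\
  forall (q : state R dim -> \bar R) (p : state R dim -> state R dim -> \bar R),
  is_density piQ mu q -> is_kernel_density mu_ Es mu p ->
  [/\ {ae mu, forall y, forall A, measurable A -> A `<=` Es ->
         q y * mus_ y A = \int[piW]_(x in A) p x y},
      forall B, measurable B -> B `<=` Es ->
         \int[nu]_(y in B) (lambdas y)%:E =
         xi * \int[mu]_(y in B) q y,
      (sigmas : set (state R dim) -> \bar R) `<<
         (fun B => mu (B `&` Gammas)) &
      forall B, measurable B ->
         sigmas B = xi * \int[mu]_(y in B `&` Gammas) q y].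
Proof.
move=> phi E0 E Es Gamma Gammas c hc hA1 hA2 hA3 hA4 d Omega P X T Q hX nu hnuE
  hstart hB1 hB2 hB3 hB4 hB5 sigma hsigma xi piW piQ beta hbeta_meas hbeta_ge0 hD1
  hD2 tT htT Xs hrev lambdas mus_ cs hcs hcs_A4 Ts Qs hXs sigmas hsigmas mu hmuE hdom.
have rf : regular_flow (pd_flow c) (pd_space c) (pd_boundary c) E0.
  exact: regular_flow_states hflow.
have rfs : regular_flow (pd_flow cs) (pd_space cs) (pd_boundary cs) E0.
  exact: regular_flow_reversed hflow.
have hH : tT%:E <= +oo by exact: leey.
have nuE0 : nu (~` E0) = 0.
  exact: (stationary_inner rf rfs hc hcs hX hXs hH hA4 hcs_A4 hrev hB1 htT).
have st_r := ae_reversed_stationary rf rfs hc hcs hX hXs hH hA4 hcs_A4 hrev hB1.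
have st_f := ae_forward_stationary tT hB1.
have mE0 : measurable E0 := rf_minner rf.
have mE : measurable E := rf_mspace rf.
have mEs : measurable Es := rf_mspace rfs.
have mGamma : measurable Gamma := rf_mbd rf.
have mGammas : measurable Gammas := rf_mbd rfs.
have nu_off B : measurable B -> (forall x, B x -> ~ E0 x) -> nu B = 0.
  move=> mB BE0; apply/eqP; rewrite -measure_le0 -nuE0; apply: le_measure; rewrite ?inE//.
  exact: measurableC.
pose K := pd_jump c; pose Ks := pd_jump cs.
pose Y := prejump c T Q; pose Ys := prejump cs Ts Qs.
pose W := prejump_law rf hX tT; pose Ws := prejump_law rfs hXs tT.
pose ell := rate0 c; pose ells := rate0 cs.
have ell0 x : (0 <= ell x)%R by exact: (rate0_ge0 hc).
have ells0 x : (0 <= ells x)%R by exact: (rate0_ge0 hcs).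
have mell : measurable_fun setT ell by exact: (measurable_rate0 rf hc).
have mells : measurable_fun setT ells by exact: (measurable_rate0 rfs hcs).
have mid : measurable_fun setT (id : state R dim -> state R dim) by exact: measurable_id.
have mind : measurable_fun setT (\1_Gamma : state R dim -> R) by exact: measurable_indic.
have ind0 x : (0 <= \1_Gamma x :> R)%R by rewrite indicE.
pose M : {measure set (state R dim) -> \bar R} :=
  measure_add (weighted_law nu mell ell0 mid) (weighted_law sigma mind ind0 mid).
have ME B : measurable B -> M B = \int[nu]_(x in B) (ell x)%:E + sigma (B `&` Gamma).
  move=> mB; rewrite /M [LHS]measure_addE; congr (_ + _).
  by rewrite /= /weighted_law integral_indic// setIC.
(* Forward in time the continuity of the intensity makes all unforced jumps
   regular. *)
have WE B : measurable B -> W B = tT%:E * M B.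
  move=> mB; rewrite ME//; apply: (prejump_law_formula hc hH hA4 hsigma nuE0 st_f
    (G := set0)) => //.
  apply: filterS (ae_good rf hc hX hH hA4) => w gw n Jw nbd _.
  exact: (continuous_rate_regular rf hc hH hB3 gw Jw nbd).
have EellE A : measurable A -> \int[nu]_(x in A) (ell x)%:E =
    \int[nu]_(x in A `&` E) (lambda x)%:E.
  move=> mA; rewrite [RHS]integral_mkcondr; apply: eq_integral => x _.
  by rewrite /ell /rate0 !patchE; case: ifP.
have xiE : xi = M setT.
  rewrite ME// EellE// setTI [sigma _ in RHS]/=; congr (_ + sigma _).
  by rewrite setTI.
have xi_fin : xi = (fine xi)%:E.
  rewrite fineK// /xi /total_rate fin_numD; apply/andP; split.
    rewrite ge0_fin_numE//; apply: integral_ge0 => x Ex.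
    by rewrite lee_fin; exact: (wf_rate_ge0 hc).
  exact: fin_num_measure.
have xi0 : (0 <= fine xi)%R by rewrite fine_ge0// xiE measure_ge0.
pose MK B := \int[M]_x K x B.
have mK B : measurable B -> measurable_fun setT (K ^~ B) by exact: measurable_kernel.
have mEell : measurable_fun setT (EFin \o ell) by exact/measurable_EFinP.
have piQE B : measurable B -> piQ B = ((fine xi)^-1)%:E * MK B.
  move=> mB; rewrite /piQ /pi_Q -/xi; congr (_ * _).
  rewrite /MK ge0_integral_measure_add//; last exact: mK.
  congr (_ + _).
    rewrite integral_weighted_law//; last exact: mK.
    rewrite [LHS]integral_mkcond; apply: eq_integral => x _.
    rewrite /ell /rate0 !patchE muleC; case: ifP => // _.
    by rewrite mule0.
  rewrite integral_weighted_law//; last exact: mK.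
  rewrite [LHS]integral_mkcond; apply: eq_integral => x _.
  by rewrite patchE indicE; case: ifP => _; rewrite ?mule1 ?mule0.
have MK0 B : 0 <= MK B by apply: integral_ge0.
have MK_le B : measurable B -> MK B <= xi.
  move=> mB; rewrite xiE -[leRHS]mul1e -integral_cst//.
  apply: ge0_le_integral => //; first exact: mK.
  move=> x _; rewrite -(@prob_kernel _ _ _ _ _ K x).
  by apply: le_measure; rewrite ?inE.
(* If xi = 0 both sides vanish. *)
have xi_piQ B : measurable B -> xi * piQ B = MK B.
  move=> mB; rewrite piQE// xi_fin muleA -EFinM.
  have [x0|x0] := eqVneq (fine xi) 0%R; last by rewrite mulfV// mul1e.
  rewrite x0 mul0r mul0e; apply/eqP; rewrite eq_le MK0/=.
  by apply: le_trans (MK_le _ mB) _; rewrite xi_fin x0.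
(* The jumps from A into B are counted forwards, then backwards. *)
have J_fwd A B : measurable A -> measurable B ->
    \sum_(n <oo) P (jump_in T tT n `&` [set w | A (Y n w) /\ B (Q n.+1 w)]) =
    \int[W]_(x in A) K x B.
  by move=> mA mB; exact: (jump_count_kernel rf hX hH mA mB).
have J_rev A B : measurable A -> measurable B ->
    \int[W]_(x in A) K x B = \int[Ws]_(y in B) Ks y A.
  move=> mA mB; rewrite -J_fwd//.
  rewrite (jump_law_reversed rf rfs hc hcs hX hXs hH hA4 hcs_A4 hrev mA mB).
  exact: (jump_count_kernel rfs hXs (lexx _) mB mA).
have tT0 : (0 <= tT)%R by exact: ltW.
have intW A B : measurable A -> measurable B ->
    \int[W]_(x in A) K x B = tT%:E * \int[M]_(x in A) K x B.
  move=> mA mB; rewrite -[X in X%:E * _]/((NngNum tT0)%:num)%R -ge0_integral_mscale//.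
    apply: eq_measure_integral => V mV _; exact: WE.
  by apply: measurable_funTS; exact: mK.
have WsE B : measurable B -> Ws B = tT%:E * MK B.
  move=> mB; rewrite /MK -intW// J_rev//.
  rewrite (eq_integral (cst 1)); last by move=> y _; exact: prob_kernel.
  by rewrite integral_cst// mul1e.
have MK_Gamma B : measurable B -> B `<=` Gamma -> MK B = 0.
  move=> mB BG; suff : tT%:E * MK B = 0.
    by move=> /eqP; rewrite mule_eq0 eqe gt_eqF//= => /eqP.
  rewrite /MK -intW// -J_fwd//; apply: eseries0 => n _ _.
  have [N [mN N0 hN]] := ae_postjump_off_boundary rf hc hX hH hA4 n.
  apply/eqP; rewrite -measure_le0 -N0; apply: le_measure; rewrite ?inE//.
    apply: measurableI; first exact: (measurable_jump_in hX).
    rewrite (_ : [set w | _ /\ _] = setT `&` Q n.+1 @^-1` B); last first.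
      by apply/seteqP; split=> w [].
    exact: (sk_measurable_state (ip_skeleton hX) n.+1).
  by move=> w [Jw [_ Bw]]; apply: hN => /(_ Jw); apply; exact: BG.
(* Backward in time the intensity may fail to be integrable along orbits, but only
   at a null set of states; the post-jump law does not charge it, so no reversed
   jump starts there. *)
pose G := explosive cs E0.
have mG : measurable G by exact: (measurable_explosive rfs hcs).
have nuG : nu G = 0.
  have mTs n : measurable_fun setT (Ts n) by exact: (sk_measurable_time (ip_skeleton hXs)).
  have [v /andP[v0 vT] [/(never_at mTs) nj stv]] : exists2 v, (0 < v < tT)%R &
      P [set w | exists n, Ts n w = v%:E] = 0 /\
      ((0 < v < tT)%R -> forall B, measurable B -> P (Xs v @^-1` B) = nu B).
    apply: ae_time_exists htT _; move: st_r; apply: filter_app.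
      exact: (ae_filter_ringOfSetsType (@lebesgue_measure R)).
    have := ae_no_fixed_time P mTs; apply: filterS.
      exact: (ae_filter_ringOfSetsType (@lebesgue_measure R)).
    by move=> v ? ?; split.
  have vv : (0 < v < tT)%R by rewrite v0.
  rewrite -stv//; have [N [mN N0 hN]] : {ae P, forall w, ~ G (Xs v w)}.
    apply: filterS2 (ae_good rfs hcs hXs (lexx _) hcs_A4) nj => w gw nw.
    exact: (nonexplosive_path rfs hcs (lexx _) gw v0 vT nw).
  apply/eqP; rewrite -measure_le0 -N0; apply: le_measure; rewrite ?inE//.
    rewrite -[X in measurable X]setTI; apply: (ip_measurable hXs) => //.
    exact: ltW.
  by move=> w Gw; apply: hN => /(_ Gw).
have jumpG : Ws G = 0.
  rewrite WsE// -xi_piQ// hD1//; last by move=> x [].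
  have -> : \int[nu]_(y in G) (beta y)%:E = 0.
    rewrite (@ge0_negligible_integral _ _ _ nu G G)//; first by rewrite setDv integral_set0.
      by apply/measurable_EFinP; apply: measurable_funS hbeta_meas => // x [].
    by move=> y [Ey _]; rewrite lee_fin; exact: hbeta_ge0.
  by rewrite !mule0.
have WsE' B : measurable B ->
    Ws B = tT%:E * (\int[nu]_(x in B) (ells x)%:E + sigmas (B `&` Gammas)).
  move=> mB; apply: (prejump_law_formula hcs (lexx _) hcs_A4 hsigmas nuE0 st_r mG nuG jumpG) => //.
  apply: filterS (ae_good rfs hcs hXs (lexx _) hcs_A4) => w gw n Jw nbd nG.
  exact: (nonexplosive_regular rfs hcs (lexx _) gw Jw nbd nG).
have rates B : measurable B ->
    \int[nu]_(x in B) (ells x)%:E + sigmas (B `&` Gammas) = xi * piQ B.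
  move=> mB; rewrite xi_piQ//; have := WsE B mB; rewrite WsE'// => e.
  have t0 : (0 < tT%:E :> \bar R) by rewrite lte_fin.
  have tf : tT%:E \is a fin_num by [].
  have := congr1 (fun u => (tT^-1)%:E * u) e.
  by rewrite !muleA -!EFinM mulVf ?gt_eqF// !mul1e.
(* The states outside Es are passive boundary points, which are null for nu. *)
have M_Es : M (~` Es) = 0.
  have mC : measurable (~` Es) by exact: measurableC.
  rewrite ME// (_ : ~` Es `&` Gamma = set0); last first.
    by apply/seteqP; split=> // x [nEs Gx]; apply: nEs; right.
  rewrite measure0 adde0 (@ge0_negligible_integral _ _ _ nu (~` Es) (~` Es))//.
  - by rewrite setDv integral_set0.
  - exact: measurable_funTS.
  - by move=> x _; rewrite lee_fin.
  - by apply: nu_off => // x nEs E0x; apply: nEs; left.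
split; last split.
- move=> N Nnull B mB BN; rewrite piQE// /MK ge0_integral_ae0 ?mule0//; first exact: mK.
  exists (~` Es); split => //; first exact: measurableC.
  move=> x /= nx Ex; apply: nx => _; exact: (hdom x Ex N Nnull B mB BN).
- have [p [mp p0 pE]] := jointly_measurable_density
    (@measurable_state_generated R k dim) mu_ mu.
  exists p; split; first exact: measurable_funTS.
  move=> x Ex; split => //; last exact: pE (hdom x Ex).
  exact: (measurableT_comp mp (pair1_measurable x)).
move=> q p [mq q0 qE] [mp pE].
have piQ_fin : piQ setT < +oo.
  rewrite piQE//; apply: (@le_lt_trans _ _ (((fine xi)^-1)%:E * xi)).
    by rewrite lee_wpmul2l ?lee_fin ?invr_ge0//; exact: MK_le.
  by rewrite xi_fin -EFinM ltry.
have qint : mu.-integrable setT q.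
  apply/integrableP; split => //; under eq_integral => y _ do rewrite gee0_abs//.
  by rewrite -qE.
have qfin := integrable_ae measurableT qint.
(* A real-valued version of the density, to be used as a weight. *)
pose q' y := fine (q y).
have mq' : measurable_fun setT q' by apply: measurableT_comp => //; exact: fine_measurable.
have q'0 y : (0 <= q' y)%R by exact: fine_ge0.
have intq B : measurable B -> \int[mu]_(y in B) (q' y)%:E = piQ B.
  move=> mB; rewrite qE//; apply: ge0_ae_eq_integral => //.
  - by apply: measurable_funTS; exact/measurable_EFinP.
  - exact: measurable_funTS.
  - by move=> y _; rewrite lee_fin.
  - by apply: filterS qfin => y /(_ Logic.I) qf _; rewrite /q' fineK.
pose p' : state R dim * state R dim -> \bar R :=
  (fun z => p z.1 z.2) \_ (Es `*` setT).
have mp' : measurable_fun setT p'.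
  have mX : measurable (Es `*` [set: state R dim]) by exact: measurableX.
  exact/(measurable_restrictT _ mX).
have p'E x y : Es x -> p' (x, y) = p x y.
  by move=> Ex; rewrite /p' patchE mem_set.
have p'0 z : 0 <= p' z.
  rewrite /p' patchE; case: ifP => // /set_mem[Ex _].
  by have [_ + _] := pE _ Ex.
have c0 : (0 <= (fine xi)^-1)%R by rewrite invr_ge0.
pose PWm : {measure set (state R dim) -> \bar R} := mscale (NngNum c0) M.
have PWmE A : PWm A = ((fine xi)^-1)%:E * M A by [].
have PWoo : PWm setT < +oo by rewrite PWmE -xiE xi_fin -EFinM ltry.
pose PW : {finite_measure set (state R dim) -> \bar R} := mfrestr measurableT PWoo.
have PWE A : PW A = ((fine xi)^-1)%:E * M A.
  by rewrite -PWmE; change (PWm (A `&` setT) = PWm A); rewrite setIT.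
have intPW A B : measurable A -> measurable B ->
    \int[PW]_(x in A) K x B = ((fine xi)^-1)%:E * \int[M]_(x in A) K x B.
  move=> mA mB; rewrite -[X in X%:E * _]/((NngNum c0)%:num)%R -ge0_integral_mscale//.
    by apply: eq_measure_integral => V mV _; exact: PWE.
  by apply: measurable_funTS; exact: mK.
have cc0 : (0 <= (fine xi)^-1 * tT^-1)%R by rewrite mulr_ge0// invr_ge0.
have exch A B : measurable A -> measurable B -> A `<=` Es ->
    \int[mu]_(y in B) (Ks y A * (q' y)%:E) =
    \int[PW]_(x in A) \int[mu]_(y in B) p' (x, y).
  move=> mA mB AEs.
  have mKs : measurable_fun setT (Ks ^~ A) by exact: measurable_kernel.
  transitivity (\int[PW]_(x in A) K x B); last first.
    apply: eq_integral => x /set_mem Ax; have [_ _ ->//] := pE x (AEs x Ax).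
    by apply: eq_integral => y _; rewrite p'E//; exact: AEs.
  rewrite intPW//.
  transitivity (\int[weighted_law mu mq' q'0 mid]_(y in B) Ks y A).
    rewrite [RHS]integral_mkcond integral_weighted_law.
    - rewrite [LHS]integral_mkcond; apply: eq_integral => y _.
      by rewrite !patchE; case: ifP => //; rewrite mul0e.
    - by apply/(measurable_restrictT _ mB); exact: measurable_funTS.
    - by move=> y; rewrite patchE; case: ifP.
  transitivity (\int[mscale (NngNum cc0) Ws]_(y in B) Ks y A).
    apply: eq_measure_integral => V mV _.
    transitivity (piQ V); first exact: intq.
    rewrite piQE//; transitivity (((fine xi)^-1 * tT^-1)%:E * Ws V); last by [].
    by rewrite WsE// muleA -EFinM -mulrA mulVf ?gt_eqF// mulr1.
  rewrite ge0_integral_mscale//; last exact: measurable_funTS.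
  rewrite -J_rev// intW// muleA -EFinM.
  by congr (_%:E * _); rewrite /= -mulrA mulVf ?gt_eqF// mulr1.
have qint' : \int[mu]_y (q' y)%:E < +oo by rewrite intq.
have nu_E0 B : measurable B -> (forall x, B x -> ~ E0 x) ->
    \int[nu]_(x in B) (ells x)%:E = 0.
  move=> mB BE0; rewrite (@ge0_negligible_integral _ _ _ nu B B)//.
  - by rewrite setDv integral_set0.
  - by apply: measurable_funTS; exact/measurable_EFinP.
  - by move=> x _; rewrite lee_fin.
  - exact: nu_off.
have sigmasE B : measurable B -> sigmas B = xi * \int[mu]_(y in B `&` Gammas) q y.
  move=> mB; have mBG : measurable (B `&` Gammas) by exact: measurableI.
  rewrite -qE// -rates// nu_E0//; last by move=> x [_ Gx] /(rf_disj rfs).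
  rewrite add0e -setIA setIid.
  rewrite (hsigmas tT htT (lexx _) _ mB) (hsigmas tT htT (lexx _) _ mBG).
  by rewrite -setIA setIid.
split => //.
- have ex := exchange_densities (@measurable_state_generated R k dim) mEs mp' p'0
    mq' q'0 qint' exch.
  apply: filterS2 ex qfin => y hy /(_ Logic.I) qf A mA AEs.
  rewrite -[q y]fineK// hy//.
  transitivity (\int[PW]_(x in A) p x y).
    by apply: eq_integral => x /set_mem Ax; rewrite p'E//; exact: AEs.
  apply: eq_set_function_integral => V mV.
  by rewrite PWE ME// EellE.
- move=> B mB BEs.
  have mB0 : measurable (B `&` E0) by exact: measurableI.
  have mB1 : measurable (B `\` E0) by exact: measurableD.
  transitivity (\int[nu]_(x in B) (ells x)%:E).
    apply: eq_integral => x /set_mem Bx; rewrite /ells /rate0 patchE mem_set//.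
    exact: BEs.
  have BE : B = (B `&` E0) `|` (B `\` E0) by rewrite setUIDK.
  have disj : [disjoint B `&` E0 & B `\` E0].
    by apply/disj_setPS => x [[_ ?] [_]].
  have int_split (m : {measure set (state R dim) -> \bar R}) g :
      measurable_fun setT g -> (forall x, 0 <= g x) -> \int[m]_(x in B) g x =
      \int[m]_(x in B `&` E0) g x + \int[m]_(x in B `\` E0) g x.
    move=> mg g0; rewrite {1}BE ge0_integral_setU//; exact: measurable_funTS.
  rewrite (int_split nu); last 2 first.
  + exact/measurable_EFinP.
  + by move=> x; rewrite lee_fin; exact: ells0.
  rewrite (nu_E0 (B `\` E0)) ?adde0//; last by move=> x [].
  rewrite (int_split mu q mq q0).
  rewrite ge0_muleDr ?integral_ge0//.
  rewrite -!qE// (xi_piQ (B `\` E0))// MK_Gamma//; last first.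
    by move=> x [/BEs[]].
  rewrite adde0 -rates// (_ : B `&` E0 `&` Gammas = set0) ?measure0 ?adde0//.
  by apply/seteqP; split=> // x [[_ /(rf_disj rfs)]].
- move=> N Nnull B mB BN; rewrite sigmasE//.
  have mBG : measurable (B `&` Gammas) by exact: measurableI.
  have B0 : mu (B `&` Gammas) = 0 by exact: Nnull.
  rewrite (@ge0_negligible_integral _ _ _ mu (B `&` Gammas) (B `&` Gammas))//.
    by rewrite setDv integral_set0 mule0.
  exact: measurable_funTS.
Qed.
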